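(* Let $n,p,l,k$ be positive integers with $l\le n$, and let $\mathbb{Y}$ be a (potentially infinite) alphabet. Then $$R^{(k),n}_{n^pl}(\mathbb{Y})=\mathfrak{T}^k_{p^{n-l}(p+1)^l}(\mathbb{Y}).$$
   Context: Notation: $n^pl$ is the partition $(n,\dots,n,l)$ with $p$ parts equal to $n$ followed by $l$. $p^{n-l}(p+1)^l$ is the vector $(v_0,\dots,v_{n-1})\in\mathbb{Z}^n$ with the first $n-l$ entries equal to $p$ and the last $l$ entries equal to $p+1$. $\lambda'$ denotes the conjugate of a partition $\lambda$, $\ell(\lambda)$ its length. Jack polynomials: let $\Psi_\lambda$ be the products of power sums and $\langle\Psi_\lambda,\Psi_\mu\rangle_\alpha=\delta_{\lambda\mu}z_\lambda\alpha^{\ell(\lambda)}$, where $z_\lambda=\prod_i i^{m_i(\lambda)}m_i(\lambda)!$, $m_i(\lambda)$ being the multiplicity of $i$ in $\lambda$. The Jack polynomials $P_\lambda^{(\alpha)}$ are the unique symmetric functions orthogonal for $\langle\,,\rangle_\alpha$ with $P_\lambda^{(\alpha)}=m_\lambda+\sum_{\mu<\lambda}u^{(\alpha)}_{\lambda\mu}m_\mu$ ($m_\mu$ the monomial functions, $<$ the dominance order). $(Q_\lambda^{(\alpha)})$ is the basis dual to $(P_\lambda^{(\alpha)})$ for $\langle\,,\rangle_\alpha$. Second scalar product: for $\mathbb{X}=\{x_1,\dots,x_n\}$ and $\mathbb{X}^\vee=\{x_1^{-1},\dots,x_n^{-1}\}$, $\langle f,g\rangle'_{n,\alpha}=\frac1{n!}\mathrm{C.T.}\left\{f(\mathbb{X})g(\mathbb{X}^\vee)\prod_{i\ne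 j}(1-x_ix_j^{-1})^{1/\alpha}\right\}$, where C.T. denotes the constant term in $x_1,\dots,x_n$. Normalization: $R_\lambda^{(\alpha),n}(\mathbb{Y}):=\langle P_{\lambda'}^{(1/\alpha)},Q_{\lambda'}^{(1/\alpha)}\rangle'_{n,1/\alpha}\,Q_\lambda^{(\alpha)}(\mathbb{Y})$. Hyperdeterminant: for $M=(M_{i_1\cdots i_{2k}})_{0\le i_1,\dots,i_{2k}\le n-1}$, $\mathrm{Det}(M)=\frac1{n!}\sum_{\sigma_1,\dots,\sigma_{2k}}\mathrm{sign}(\sigma_1)\cdots\mathrm{sign}(\sigma_{2k})\prod_{i=0}^{n-1}M_{\sigma_1(i)\cdots\sigma_{2k}(i)}$, the sum being over $2k$-tuples of permutations of $\{0,\dots,n-1\}$. Shifted Toeplitz hyperdeterminant, for $v\in\mathbb{Z}^n$: $\mathfrak{T}^k_v(\mathbb{Y})=\mathrm{Det}\left(\Lambda^{i_1+\cdots+i_k-(i_{k+1}+\cdots+i_{2k})+v_{i_1}}(\mathbb{Y})\right)_{0\le i_1,\dots,i_{2k}\le n-1}$, where $\Lambda^m$ is the $m$-th elementary symmetric function ($\Lambda^0=1$, $\Lambda^m=0$ for $m<0$). *)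

(* Defs.v *)
From HB Require Import structures.
From mathcomp Require Import all_boot all_order all_algebra all_fingroup.
From mathcomp Require Import fraction.
From mathcomp Require Import boolp classical_sets functions cardinality fsbigop.
From mathcomp Require Import mpoly.

Set Implicit Arguments.
Unset Strict Implicit.
Unset Printing Implicit Defensive.

Import GRing.Theory.

Local Open Scope ring_scope.

#[local] Obligation Tactic := idtac.

Record intpart := IntPart {
  parts :> seq nat;
  intpartP : sorted geq parts && (0%N \notin parts) }.

HB.instance Definition _ := [isSub for parts].
HB.instance Definition _ := [Choice of intpart by <:].

Definition conj_parts (s : seq nat) : seq nat :=
  mkseq (fun j => count (fun x => (j < x)%N) s) (head 0%N s).

Lemma conj_partsP (lam : intpart) :
  sorted geq (conj_parts lam) && (0%N \notin conj_parts lam).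
Proof.
rewrite /conj_parts; apply/andP; split.
  rewrite sorted_map; apply: (@sub_sorted _ ltn); last exact: iota_ltn_sorted.
  by move=> i j lt_ij; apply: sub_count => x /(ltn_trans lt_ij).
apply/negP => /mapP [j]; rewrite mem_iota add0n /=.
case: lam => [[|x s] lamP] //= ltj; by rewrite ltj.
Qed.

Definition conj_intpart (lam : intpart) : intpart := IntPart (conj_partsP lam).

(* The partition n^p l = (n, ..., n, l), with p parts equal to n. *)
Lemma near_rectP (n p l : nat) : (0 < l)%N -> (l <= n)%N ->
  sorted geq (rcons (nseq p n) l) && (0%N \notin rcons (nseq p n) l).
Proof.
move=> l_gt0 le_ln; have n_gt0 := leq_trans l_gt0 le_ln.
apply/andP; split; last first.
  rewrite mem_rcons inE mem_nseq negb_or negb_and.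
  by rewrite ![0%N == _]eq_sym -!lt0n l_gt0 n_gt0 orbT.
case: p => //= p; rewrite rcons_path; apply/andP; split.
  by elim: p => //= p ->; rewrite /= leqnn.
by elim: p => //= p.
Qed.

Definition near_rect (n p l : nat) (l_gt0 : (0 < l)%N) (le_ln : (l <= n)%N) :
  intpart := IntPart (near_rectP p l_gt0 le_ln).

Definition dom_lt (mu lam : intpart) : Prop :=
  [/\ mu <> lam, sumn mu = sumn lam
    & forall i, (sumn (take i mu) <= sumn (take i lam))%N].

Definition zpart (lam : intpart) : nat :=
  \prod_(i <- undup lam) (i ^ count_mem i lam * (count_mem i lam)`!)%N.

(* Specialization of the last variable to 0. *)
Definition kill_last (N : nat) (f : {mpoly rat[N.+1]}) : {mpoly rat[N]} :=
  mmap (@mpolyC N rat)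
    (fun i => if unlift ord_max i is Some j then 'X_j else 0) f.

Arguments kill_last : simpl never.

(* Symmetric functions in infinitely many letters y_0, y_1, ..., as the graded *)
(* inverse limit of the rings of symmetric polynomials: f N is                 *)
(* f(y_0, ..., y_(N-1)), and f itself is f(Y) for an infinite alphabet Y.      *)
Record symfun := SymFun {
  sf_at :> forall N, {mpoly rat[N]};
  sf_sym : forall N, sf_at N \is symmetric;
  sf_stable : forall N, kill_last (sf_at N.+1) = sf_at N;
  sf_bounded : exists d, forall N, (msize (sf_at N) <= d)%N }.

Lemma symfunP (f g : symfun) : (forall N, f N = g N) -> f = g.
Proof.
case: f => f f1 f2 f3; case: g => g g1 g2 g3 /= fg.
have e : f = g by apply: functional_extensionality_dep.
by subst g; congr SymFun; exact: Prop_irrelevance.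
Qed.

HB.instance Definition _ := gen_eqMixin symfun.
HB.instance Definition _ := gen_choiceMixin symfun.

Section KillLast.
Variable N : nat.

Lemma kill_last_is_zmod_morphism : zmod_morphism (@kill_last N).
Proof. by move=> f g; rewrite /kill_last raddfB. Qed.
HB.instance Definition _ := GRing.isZmodMorphism.Build _ _ (@kill_last N)
  kill_last_is_zmod_morphism.

Lemma kill_last_is_monoid_morphism : monoid_morphism (@kill_last N).
Proof. by split=> [|f g]; rewrite /kill_last ?rmorph1 ?rmorphM. Qed.
HB.instance Definition _ := GRing.isMonoidMorphism.Build _ _ (@kill_last N)
  kill_last_is_monoid_morphism.

Lemma kill_lastZ c (f : {mpoly rat[N.+1]}) : kill_last (c *: f) = c *: kill_last f.
Proof. by rewrite /kill_last mmapZ mul_mpolyC. Qed.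

Lemma kill_lastXU (i : 'I_N.+1) :
  kill_last 'X_i = if unlift ord_max i is Some j then 'X_j else 0.
Proof. by rewrite /kill_last mmapX mmap1U. Qed.

Lemma mcoeff_kill_last (f : {mpoly rat[N.+1]}) (m : 'X_{1..N}) :
  (kill_last f)@_m = f@_(mnmwiden m).
Proof.
rewrite {1}[f]mpolyE (raddf_sum (@kill_last N)) [in RHS](mpolyE f) !raddf_sum.
apply: eq_bigr => u _ /=.
rewrite kill_lastZ !mcoeffZ mcoeffX; congr (_ * _).
rewrite /kill_last mmapX /mmap1 big_ord_recr /= unlift_none.
under eq_bigr => i _.
  have -> : widen_ord (leqnSn N) i = lift ord_max i.
    by apply: val_inj; rewrite /= /bump leqNgt ltn_ord.
  rewrite liftK; over.
have -> : \prod_(i < N) 'X_i ^+ u (lift ord_max i) =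
          'X_[[multinom u (lift ord_max i) | i < N]] :> {mpoly rat[N]}.
  by rewrite [in RHS]mpolyXE_id; apply: eq_bigr => i _; rewrite mnmE.
have liftE (i : 'I_N) : lift ord_max i = widen_ord (leqnSn N) i.
  by apply: val_inj; rewrite /= /bump leqNgt ltn_ord.
have [u0|u0] := eqVneq (u ord_max) 0%N.
  rewrite u0 expr0 mulr1 mcoeffX; congr (_ : bool)%:R.
  apply/eqP/eqP => [<-|->]; apply/mnmP => i.
    have [j ->|->] := unliftP ord_max i; last by rewrite u0 mnmwiden_ordmax.
    by rewrite liftE mnmwiden_widen mnmE liftE.
  by rewrite mnmE liftE mnmwiden_widen.
rewrite expr0n (negbTE u0) mulr0 mcoeff0.
by case: eqP => // e; move: u0; rewrite e mnmwiden_ordmax.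
Qed.

End KillLast.

Section SymFunRing.
Implicit Types f g : symfun.

Fact sf_zero_bounded : exists d, forall N, (msize (0 : {mpoly rat[N]}) <= d)%N.
Proof. by exists 0%N => N; rewrite msize0. Qed.

Definition sf_zero : symfun :=
  @SymFun (fun N => 0) (fun N => rpred0 _) (fun N => rmorph0 _) sf_zero_bounded.

Fact sf_one_bounded : exists d, forall N, (msize (1 : {mpoly rat[N]}) <= d)%N.
Proof. by exists 1%N => N; rewrite msize1. Qed.

Definition sf_one : symfun :=
  @SymFun (fun N => 1) (fun N => rpred1 _) (fun N => rmorph1 _) sf_one_bounded.

Program Definition sf_add f g : symfun := @SymFun (fun N => f N + g N) _ _ _.
Next Obligation. by move=> f g N; apply: rpredD; exact: sf_sym. Qed.
Next Obligation. by move=> f g N; rewrite (rmorphD (@kill_last N)) /= !sf_stable. Qed.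
Next Obligation.
move=> f g; have [[d fd] [e ge]] := (sf_bounded f, sf_bounded g).
exists (maxn d e) => N; apply: leq_trans (msizeD_le _ _) _.
by rewrite geq_max !leq_max fd ge orbT.
Qed.

Program Definition sf_opp f : symfun := @SymFun (fun N => - f N) _ _ _.
Next Obligation. by move=> f N; rewrite rpredN; exact: sf_sym. Qed.
Next Obligation. by move=> f N; rewrite (rmorphN (@kill_last N)) /= sf_stable. Qed.
Next Obligation.
by move=> f; have [d fd] := sf_bounded f; exists d => N; rewrite msizeN.
Qed.

Program Definition sf_mul f g : symfun := @SymFun (fun N => f N * g N) _ _ _.
Next Obligation. by move=> f g N; apply: rpredM; exact: sf_sym. Qed.
Next Obligation. by move=> f g N; rewrite (rmorphM (@kill_last N)) /= !sf_stable. Qed.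
Next Obligation.
move=> f g; have [[d fd] [e ge]] := (sf_bounded f, sf_bounded g).
exists (d + e)%N => N; have [->|f0] := eqVneq (f N) 0.
  by rewrite mul0r msize0.
have [->|g0] := eqVneq (g N) 0; first by rewrite mulr0 msize0.
by rewrite msizeM //; apply: leq_trans (leq_pred _) (leq_add _ _).
Qed.

Program Definition sf_scale (c : rat) f : symfun :=
  @SymFun (fun N => c *: f N) _ _ _.
Next Obligation. by move=> c f N; apply: rpredZ; exact: sf_sym. Qed.
Next Obligation. by move=> c f N; rewrite kill_lastZ sf_stable. Qed.
Next Obligation.
move=> c f; have [d fd] := sf_bounded f; exists d => N.
exact: leq_trans (msizeZ_le _ _) (fd N).
Qed.

Fact sf_addA : associative sf_add.
Proof. by move=> f g h; apply: symfunP => N /=; rewrite addrA. Qed.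
Fact sf_addC : commutative sf_add.
Proof. by move=> f g; apply: symfunP => N /=; rewrite addrC. Qed.
Fact sf_add0 : left_id sf_zero sf_add.
Proof. by move=> f; apply: symfunP => N /=; rewrite add0r. Qed.
Fact sf_addN : left_inverse sf_zero sf_opp sf_add.
Proof. by move=> f; apply: symfunP => N /=; rewrite addNr. Qed.

HB.instance Definition _ :=
  GRing.isZmodule.Build symfun sf_addA sf_addC sf_add0 sf_addN.

Fact sf_mulA : associative sf_mul.
Proof. by move=> f g h; apply: symfunP => N /=; rewrite mulrA. Qed.
Fact sf_mulC : commutative sf_mul.
Proof. by move=> f g; apply: symfunP => N /=; rewrite mulrC. Qed.
Fact sf_mul1 : left_id sf_one sf_mul.
Proof. by move=> f; apply: symfunP => N /=; rewrite mul1r. Qed.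
Fact sf_mulD : left_distributive sf_mul sf_add.
Proof. by move=> f g h; apply: symfunP => N /=; rewrite mulrDl. Qed.
Fact sf_one_neq0 : sf_one != 0.
Proof.
apply/eqP => /(congr1 (fun f : symfun => f 0%N)) /eqP /=.
by rewrite oner_eq0.
Qed.

HB.instance Definition _ := GRing.Zmodule_isComNzRing.Build symfun
  sf_mulA sf_mulC sf_mul1 sf_mulD sf_one_neq0.

Fact sf_scaleA a b f : sf_scale a (sf_scale b f) = sf_scale (a * b) f.
Proof. by apply: symfunP => N /=; rewrite scalerA. Qed.
Fact sf_scale1 : left_id 1 sf_scale.
Proof. by move=> f; apply: symfunP => N /=; rewrite scale1r. Qed.
Fact sf_scaleDr : right_distributive sf_scale +%R.
Proof. by move=> a f g; apply: symfunP => N /=; rewrite scalerDr. Qed.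
Fact sf_scaleDl f : {morph sf_scale^~ f : a b / a + b}.
Proof. by move=> a b; apply: symfunP => N /=; rewrite scalerDl. Qed.

HB.instance Definition _ := GRing.Zmodule_isLmodule.Build rat symfun
  sf_scaleA sf_scale1 sf_scaleDr sf_scaleDl.

Fact sf_scaleAl (a : rat) (f g : symfun) : a *: (f * g) = a *: f * g.
Proof. by apply: symfunP => N /=; rewrite scalerAl. Qed.

HB.instance Definition _ :=
  GRing.Lmodule_isLalgebra.Build rat symfun sf_scaleAl.
HB.instance Definition _ := GRing.Lalgebra_isComAlgebra.Build rat symfun.

End SymFunRing.

(* The power sum of exponent k.+1; the one of exponent 0 is not stable. *)
Program Definition powersumS (k : nat) : symfun :=
  @SymFun (fun N => \sum_(i < N) 'X_i ^+ k.+1) _ _ _.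
Next Obligation.
move=> k N; apply/issymP => s; rewrite (raddf_sum (msym s)) [RHS](reindex_inj (@perm_inj _ s)) /=.
apply: eq_bigr => i _. by rewrite rmorphXn /= /msym mmapX mmap1U.
Qed.
Next Obligation.
move=> k N; rewrite (raddf_sum (@kill_last N)) /= big_ord_recr /=.
rewrite (rmorphXn (@kill_last N)) /= kill_lastXU.
rewrite unlift_none expr0n addr0; apply: eq_bigr => i _.
rewrite (rmorphXn (@kill_last N)) /= kill_lastXU.
have -> : widen_ord (leqnSn N) i = lift ord_max i.
  by apply: val_inj; rewrite /= /bump leqNgt ltn_ord.
by rewrite liftK.
Qed.
Next Obligation.
move=> k; exists k.+2 => N; apply: leq_trans (msize_sum _ _ _) _.
by apply/bigmax_leqP => i _; rewrite mpolyXn msizeX mdegMn mdeg1 mul1n.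
Qed.

Definition powersum_prod (lam : intpart) : symfun :=
  \prod_(i <- lam) powersumS i.-1.

Program Definition elemsym (k : nat) : symfun :=
  @SymFun (fun N => mesym N rat k) _ _ _.
Next Obligation. by move=> k N; exact: mesym_sym. Qed.
Next Obligation.
move=> k N; apply/mpolyP => m; rewrite mcoeff_kill_last !mcoeff_mesym.
congr (_ : bool)%:R; rewrite /mechar; congr (_ && _).
  rewrite !mdegE big_ord_recr /= mnmwiden_ordmax addn0.
  by under eq_bigr => i _ do rewrite mnmwiden_widen.
apply/forallP/forallP => h i; first by rewrite -mnmwiden_widen.
have [j ->|->] := unliftP ord_max i; last by rewrite mnmwiden_ordmax.
have -> : lift ord_max j = widen_ord (leqnSn N) j.
  by apply: val_inj; rewrite /= /bump leqNgt ltn_ord.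
by rewrite mnmwiden_widen.
Qed.
Next Obligation.
move=> k; exists k.+1 => N; rewrite msizeE; apply/bigmax_leqP_seq => m.
by rewrite mem_msupp_mesym /mechar => /andP [/eqP ->].
Qed.

Definition elemsymz (m : int) : symfun := if m is Posz k then elemsym k else 0.

Definition mnm_type (N : nat) (m : 'X_{1..N}) : seq nat :=
  [seq x <- m | (0 < x)%N].

(* The bound on the degree of m only makes the sum range over a finite type. *)
Definition monomial_mpoly (lam : seq nat) (N : nat) : {mpoly rat[N]} :=
  \sum_(m : 'X_{1..N < (sumn lam).+1} | perm_eq (mnm_type m) lam) 'X_[m].

Lemma mcoeff_monomial (lam : seq nat) N (m : 'X_{1..N}) :
  (monomial_mpoly lam N)@_m = (perm_eq (mnm_type m) lam)%:R.
Proof.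
rewrite /monomial_mpoly raddf_sum /=.
have sumE : mdeg m = sumn (mnm_type m).
  rewrite /mdeg /mnm_type sumnE big_filter [RHS]big_mkcond /=.
  by apply: eq_bigr => -[|x] _.
have [mlam|mNlam] := boolP (perm_eq (mnm_type m) lam); last first.
  apply: big1 => u ulam; rewrite mcoeffX; case: eqP => // e.
  by rewrite -e ulam in mNlam.
have ltm : (mdeg m < (sumn lam).+1)%N by rewrite sumE (perm_sumn mlam).
rewrite (bigD1 (BMultinom ltm)) //= mcoeffX eqxx big1 ?addr0 // => u.
case/andP => _ neq; rewrite mcoeffX; case: eqP => // e.
by case/eqP: neq; apply: val_inj.
Qed.

Program Definition monomialsym (lam : intpart) : symfun :=
  @SymFun (monomial_mpoly lam) _ _ _.
Next Obligation.
move=> lam N; apply/issymP => s; apply/mpolyP => m.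
rewrite mcoeff_sym !mcoeff_monomial; congr (_ : bool)%:R.
apply/permPl: lam; apply: perm_filter.
by apply/tuple_permP; exists s.
Qed.
Next Obligation.
move=> lam N; apply/mpolyP => m; rewrite mcoeff_kill_last !mcoeff_monomial.
by rewrite /mnm_type /mnmwiden filter_rcons.
Qed.
Next Obligation.
move=> lam; exists (sumn lam).+1 => N; rewrite msizeE.
apply/bigmax_leqP_seq => m; rewrite mcoeff_msupp mcoeff_monomial.
case: (boolP (perm_eq _ _)) => [mlam _ _|]; last by rewrite eqxx.
rewrite ltnS -(perm_sumn mlam) /mdeg /mnm_type sumnE big_filter [leqRHS]big_mkcond.
by rewrite leq_sum //= => -[|x] _.
Qed.

Definition powersum_coord (f : symfun) : intpart -> rat :=
  xget (fun=> 0) [set c | finite_set [set lam | c lam != 0] /\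
    f = \sum_(lam \in [set: intpart]) c lam *: powersum_prod lam].

Definition jack_scalar (alpha : rat) (f g : symfun) : rat :=
  \sum_(lam \in [set: intpart])
    powersum_coord f lam * powersum_coord g lam
    * ((zpart lam)%:R * alpha ^+ size lam).

Definition is_jack (alpha : rat) (P : intpart -> symfun) : Prop :=
  (forall lam, exists u : intpart -> rat,
     P lam = monomialsym lam
       + \sum_(mu \in [set mu | dom_lt mu lam]) u mu *: monomialsym mu)
  /\ (forall lam mu, lam <> mu -> jack_scalar alpha (P lam) (P mu) = 0).

Definition is_dual (alpha : rat) (P Q : intpart -> symfun) : Prop :=
  forall lam mu, jack_scalar alpha (P lam) (Q mu) = (lam == mu)%:R.

Local Notation "x %:F" := (@FracField.tofrac _ x).

(* Laurent polynomials are seen in the fraction field: F is Laurent when *)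
(* F * (x_0 ... x_(n-1))^N is a polynomial q for some N, and its constant *)
(* term is then the coefficient of (x_0 ... x_(n-1))^N in q.              *)
Definition const_term (n : nat) (F : {fraction {mpoly rat[n]}}) : rat :=
  xget 0 [set c | exists (N : nat) (q : {mpoly rat[n]}),
    F * (\prod_(i < n) ('X_i)%:F) ^+ N = q%:F /\ c = q@_[multinom N | i < n]].

(* f(x_0^-1, ..., x_(n-1)^-1) *)
Definition inv_eval (n : nat) (f : {mpoly rat[n]}) : {fraction {mpoly rat[n]}} :=
  mmap (fun c => (c%:MP)%:F) (fun i => (('X_i)%:F)^-1) f.

(* <f, g>'_{n, alpha} for alpha = 1 / k, so that the exponent 1 / alpha is k. *)
Definition jack_scalar' (n k : nat) (f g : symfun) : rat :=
  (n`!%:R)^-1 * const_term ((f n)%:F * inv_eval (g n) *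
    \prod_(i < n) \prod_(j < n | i != j) (1 - ('X_i)%:F / ('X_j)%:F) ^+ k).

(* R_lam^{(k), n}: Q stands for Q^{(k)}, and P', Q' for P^{(1/k)}, Q^{(1/k)}. *)
Definition jack_R (n k : nat) (P' Q' Q : intpart -> symfun) (lam : intpart) :
    symfun :=
  jack_scalar' n k (P' (conj_intpart lam)) (Q' (conj_intpart lam)) *: Q lam.

Definition hyperdet (R : comAlgType rat) (n k : nat)
    (M : ('I_(k + k) -> 'I_n) -> R) : R :=
  (n`!%:R : rat)^-1 *: \sum_(s : {ffun 'I_(k + k) -> 'S_n})
    (\prod_(j < k + k) (-1) ^+ s j) * \prod_(i < n) M (fun j => s j i).

(* lshift k a ranges over the first k indices, rshift k a over the last k. *)
Definition shifted_toeplitz (n k : nat) (k_gt0 : (0 < k)%N) (v : 'I_n -> int) :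
    symfun :=
  hyperdet (fun i : 'I_(k + k) -> 'I_n => elemsymz
    (\sum_(a < k) (i (lshift k a))%:Z - \sum_(a < k) (i (rshift k a))%:Z
     + v (i (lshift k (Ordinal k_gt0))))).

Definition near_const_vec (n p l : nat) (i : 'I_n) : int :=
  if (i < n - l)%N then p%:Z else p.+1%:Z.

(* Main.v *)
Require Import Defs.
From mathcomp Require Import all_boot all_order all_algebra all_fingroup.
From mathcomp Require Import fraction zify ring.
From mathcomp Require Import boolp classical_sets cardinality fsbigop.
From mathcomp Require Import ssrcomplements mpoly.

(** Write B for the bilinear form that is diagonal on products of power sums,
    with the sign of l times z_l as the value of B(p_l, p_l), and omega_a for the
    ring endomorphism sending p_r to (-1)^(r-1) a p_r. Then
    <f, g>_a = B(f, omega_a g) for every a, and B makes products of elementary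
    functions dual to monomials: B(e_nu, g) is the coefficient of x^nu in g
    (omega_form_eprod).

    Let T be the hyperdeterminant and lam = n^p l. Its k + k permutations sum up
    to k + k alternants in n variables, which are Vandermonde determinants up to
    sign, except for one, where the jump of the vector v leaves a gap in the
    exponents and thus contributes a factor e_l (altp_gap_exp). Hence
    B(T, g) = <x^p e_l, g>' for every g (jack_scalar'_toeplitz). The conjugate
    lam' is dominance-minimal among the partitions with at most n parts, so that
    x^p e_l is P'_lam' in n variables (jack_conj_near_rect), and by duality
    omega_k P_lam = Q'_lam' (jack_duality). The coefficient of Q_lam in the
    theorem is therefore <T, P_lam>_k, and what is left is that T is orthogonal
    to P_mu for mu <> lam.

    All monomials of T have exponents at most n, and lam dominates every
    partition of its weight with parts at most n; by triangularity it is enough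
    that <T, m_s>_k = 0 for s <> lam with the weight of lam and parts at most n
    (toep_orth_jack).

    If s has fewer than p parts equal to n, then m_s is a combination of products
    of n elementary functions, one of which has degree q < p. Since omega_k sends
    the generating function prod_j (1 + u y_j) to prod_i (1 - u x_i)^(-k), the
    numbers <T, e_nu>_k have as generating function a coefficient of
    h(x) prod_(i <> j) (x_j - x_i)^k / prod_(a, i) (1 - u_a x_i)^k, with n - 1
    parameters u_a for the n variables x_i. The degree of h, which is at most
    q + 1 <= p in each variable, is small enough for the coefficient to be a sum
    of local terms at the poles 1 / u_a. Two of the variables always share a
    pole, and (x_i - x_j)^(2k) has too high an order for poles of order k
    (selberg_residue, selberg_orth).

    Otherwise s has more than p + 1 parts (near_rect_uniq). Let R be the
    hyperdeterminant of the rectangle n^(p+1). One has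
    B(T, g) = B(R, e_(n-l) g), so that <T, m_s>_k = <R, f m_s>_k for some
    symmetric function f, and all monomials of f m_s have more than p + 1 parts.
    For the rectangle h has one degree less, and the previous case covers all
    the partitions needed; so R is already known to be orthogonal to every P_mu
    except that of the rectangle, which has p + 1 parts (toep_orth_long). *)

Set Implicit Arguments.
Unset Strict Implicit.
Unset Printing Implicit Defensive.
Import Order.TTheory GRing.Theory Num.Theory.
Local Open Scope ring_scope.

(** * Partitions and coefficients of symmetric functions *)

Definition pos_part (s : seq nat) := [seq x <- s | (0 < x)%N].

Lemma mkpartP (s : seq nat) :
  sorted geq (sort geq (pos_part s)) && (0%N \notin sort geq (pos_part s)).
Proof.
rewrite sort_sorted /=; last by move=> x y; rewrite /geq /= leq_total.
by rewrite mem_sort mem_filter.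
Qed.

Definition mkpart (s : seq nat) : intpart := IntPart (mkpartP s).

Lemma intpart_inj : injective parts.
Proof. exact: val_inj. Qed.

Lemma geq_trans : transitive geq.
Proof. by move=> x y z /= h1 h2; apply: leq_trans h2 h1. Qed.
Lemma geq_anti : antisymmetric geq.
Proof. by move=> x y; rewrite /= andbC -eqn_leq => /eqP. Qed.
Lemma geq_total : total geq.
Proof. by move=> x y; rewrite /geq /= leq_total. Qed.

Lemma intpart_sorted (l : intpart) : sorted geq l.
Proof. by case/andP: (intpartP l). Qed.
Lemma intpart_pos (l : intpart) x : x \in parts l -> (0 < x)%N.
Proof. by case/andP: (intpartP l) => _ h; case: x => // h'; rewrite h' in h. Qed.

Lemma pos_part_id (l : intpart) : pos_part l = l.
Proof. by apply/all_filterP/allP => x; exact: intpart_pos. Qed.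

Lemma perm_mkpart s : perm_eq (mkpart s) (pos_part s).
Proof. by rewrite perm_sort. Qed.

Lemma mkpartK (l : intpart) : mkpart l = l.
Proof.
apply: intpart_inj => /=; rewrite pos_part_id; apply: sorted_sort.
  exact: geq_trans.
exact: intpart_sorted.
Qed.

Lemma mkpart_perm s t : perm_eq (pos_part s) (pos_part t) -> mkpart s = mkpart t.
Proof.
by move=> h; apply: intpart_inj; apply/perm_sortP => //;
  [exact: geq_total|exact: geq_trans|exact: geq_anti].
Qed.

Lemma mkpart_eq s (l : intpart) : (mkpart s == l) = perm_eq (pos_part s) l.
Proof.
apply/eqP/idP => [<-|h]; first by rewrite perm_sym perm_mkpart.
by rewrite -[RHS]mkpartK; apply: mkpart_perm; rewrite pos_part_id.
Qed.

Lemma intpart_perm (l m : intpart) : perm_eq l m -> l = m.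
Proof. by move=> h; rewrite -(mkpartK l); apply/eqP; rewrite mkpart_eq pos_part_id. Qed.

Lemma sumn_pos_part s : sumn (pos_part s) = sumn s.
Proof. by rewrite !sumnE big_filter [LHS]big_mkcond /=; apply: eq_bigr => -[]. Qed.

Lemma sumn_mkpart s : sumn (mkpart s) = sumn s.
Proof. by rewrite (perm_sumn (perm_mkpart s)) sumn_pos_part. Qed.

Lemma size_mkpart s : size (mkpart s) = size (pos_part s).
Proof. exact: perm_size (perm_mkpart s). Qed.

Definition mnm_seq N (s : seq nat) : 'X_{1..N} := [multinom nth 0%N s i | i < N].

(** Computed in the least number of letters in which x^s occurs; by sf_coefE any
    larger number of letters gives the same value. *)
Definition sf_coef (f : symfun) (s : intpart) : rat := (f (size s))@_(mnm_seq (size s) s).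

Lemma perm_pos_part s :
  perm_eq s (pos_part s ++ nseq (size s - size (pos_part s)) 0%N).
Proof.
have h := permEl (perm_filterC (fun x => 0 < x)%N s); move: (perm_size h) => sz.
rewrite size_cat in sz; rewrite perm_sym; apply: perm_trans h.
rewrite perm_cat2l -/(pos_part s) in sz *; rewrite -sz addKn.
set z := [seq x <- s | predC _ x].
suff e : z = nseq (size z) 0%N by rewrite -e.
by apply/all_pred1P/allP => x; rewrite mem_filter /= -eqn0Ngt => /andP[/eqP->].
Qed.

Lemma sf_coef_perm (f : symfun) N (m m' : 'X_{1..N}) :
  perm_eq (pos_part m) (pos_part m') -> (f N)@_m = (f N)@_m'.
Proof.
move=> h.
have /tuple_permP [s es] : perm_eq m m'.
  rewrite (permPl (perm_pos_part m)) (permPr (perm_pos_part m')) !size_tuple.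
  by rewrite (perm_size h) perm_cat2r.
have -> : m = [multinom m' (s i) | i < N].
  by apply: val_inj; apply: val_inj; rewrite /= es.
by rewrite msym_coeff ?sf_sym.
Qed.

Lemma mnm_seqE N (s : seq nat) : (size s <= N)%N ->
  mnm_seq N s = s ++ nseq (N - size s) 0%N :> seq nat.
Proof.
move=> h; apply: (@eq_from_nth _ 0%N).
  by rewrite size_tuple size_cat size_nseq subnKC.
move=> i; rewrite size_tuple => lt_iN.
rewrite -[LHS](mnm_nth 0%N _ (Ordinal lt_iN)) mnmE nth_cat nth_nseq /=.
by case: ltnP => // h2; rewrite nth_default // if_same.
Qed.

Lemma pos_part_mnm_seq N (s : intpart) : (size s <= N)%N ->
  pos_part (mnm_seq N s) = s.
Proof.
move=> h; rewrite mnm_seqE // /pos_part filter_cat -/(pos_part s) pos_part_id.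
by rewrite (@eq_in_filter _ _ pred0) ?filter_pred0 ?cats0 // => x /nseqP[->].
Qed.

Lemma mkpart_mnm_seq N (s : intpart) : (size s <= N)%N -> mkpart (mnm_seq N s) = s.
Proof. by move=> h; apply/eqP; rewrite mkpart_eq pos_part_mnm_seq. Qed.

Lemma sf_coef_widen (f : symfun) N s : (size s <= N)%N ->
  (f N)@_(mnm_seq N s) = (f (size s))@_(mnm_seq (size s) s).
Proof.
elim: N => [|N IH]; first by rewrite leqn0 => /eqP ->.
rewrite leq_eqVlt => /predU1P [<-//|]; rewrite ltnS => h.
rewrite -IH // -(sf_stable f N) mcoeff_kill_last; congr mcoeff.
apply/mnmP => i; rewrite mnmE.
have [j ->|->] := unliftP ord_max i; last by rewrite mnmwiden_ordmax nth_default.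
have -> : lift ord_max j = widen_ord (leqnSn N) j.
  by apply: val_inj; rewrite /= /bump leqNgt ltn_ord.
by rewrite mnmwiden_widen mnmE.
Qed.

Lemma size_mkpart_mnm N (m : 'X_{1..N}) : (size (mkpart m) <= N)%N.
Proof. by rewrite size_mkpart -[X in (_ <= X)%N](size_tuple m) size_filter count_size. Qed.

Lemma sf_coefE (f : symfun) N (m : 'X_{1..N}) : (f N)@_m = sf_coef f (mkpart m).
Proof.
rewrite /sf_coef -(sf_coef_widen _ (size_mkpart_mnm m)); apply: sf_coef_perm.
by rewrite pos_part_mnm_seq ?size_mkpart_mnm // perm_sym perm_mkpart.
Qed.

Lemma sf_coef_ext f g : (forall s, sf_coef f s = sf_coef g s) -> f = g.
Proof. by move=> h; apply: symfunP => N; apply/mpolyP => m; rewrite !sf_coefE. Qed.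

Lemma sf_coef0 s : sf_coef 0 s = 0.
Proof. by rewrite /sf_coef mcoeff0. Qed.
Lemma sf_coefD f g s : sf_coef (f + g) s = sf_coef f s + sf_coef g s.
Proof. by rewrite /sf_coef mcoeffD. Qed.
Lemma sf_coefN f s : sf_coef (- f) s = - sf_coef f s.
Proof. by rewrite /sf_coef mcoeffN. Qed.
Lemma sf_coefB f g s : sf_coef (f - g) s = sf_coef f s - sf_coef g s.
Proof. by rewrite sf_coefD sf_coefN. Qed.
Lemma sf_coefZ c f s : sf_coef (c *: f) s = c * sf_coef f s.
Proof. by rewrite /sf_coef mcoeffZ. Qed.
Lemma sf_coef_sum (I : Type) (r : seq I) P (F : I -> symfun) s :
  sf_coef (\sum_(i <- r | P i) F i) s = \sum_(i <- r | P i) sf_coef (F i) s.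
Proof. by elim/big_rec2: _ => [|i x y _ <-]; rewrite ?sf_coef0 ?sf_coefD. Qed.

Lemma sf_atM (f g : symfun) N : (f * g) N = f N * g N. Proof. by []. Qed.
Lemma sf_at1 N : (1 : symfun) N = 1. Proof. by []. Qed.
Lemma sf_at_sum (I : Type) (r : seq I) P (F : I -> symfun) N :
  (\sum_(i <- r | P i) F i) N = \sum_(i <- r | P i) F i N.
Proof. by elim/big_rec2: _ => [|i x y _ <-]. Qed.
Lemma sf_at_prod (I : Type) (r : seq I) P (F : I -> symfun) N :
  (\prod_(i <- r | P i) F i) N = \prod_(i <- r | P i) F i N.
Proof. by elim/big_rec2: _ => [|i x y _ <-]. Qed.

Lemma sf_coef_monomial (l s : intpart) : sf_coef (monomialsym l) s = (s == l)%:R.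
Proof.
rewrite /sf_coef /= mcoeff_monomial; congr (_ : bool)%:R.
rewrite /mnm_type -/(pos_part _) pos_part_mnm_seq //.
by apply/idP/eqP => [/intpart_perm|->//].
Qed.

(** A duplicate-free list, so that finitely supported sums over partitions become
    ordinary big operators. *)
Definition parts_le (d : nat) : seq intpart :=
  undup [seq mkpart (m : 'X_{1..d}) | m : 'X_{1..d < d.+1}].

Lemma parts_le_uniq d : uniq (parts_le d). Proof. exact: undup_uniq. Qed.

Lemma size_le_sumn (s : intpart) : (size s <= sumn s)%N.
Proof.
case: s => s /= /andP [_]; elim: s => //= x s IH; rewrite inE negb_or eq_sym.
by case/andP => /negPf xn0 /IH h; rewrite -addn1 addnC leq_add // lt0n xn0.
Qed.

Lemma mdeg_mnm_seq N (s : intpart) : (size s <= N)%N -> mdeg (mnm_seq N s) = sumn s.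
Proof.
by move=> h; rewrite /mdeg -sumnE -sumn_pos_part pos_part_mnm_seq.
Qed.

Lemma mem_parts_le d s : (s \in parts_le d) = (sumn s <= d)%N.
Proof.
rewrite mem_undup; apply/mapP/idP => [[m _ ->]|h].
  by rewrite sumn_mkpart sumnE -/(mdeg m) -ltnS bmdeg.
have hs : (size s <= d)%N := leq_trans (size_le_sumn s) h.
have hm : (mdeg (mnm_seq d s) < d.+1)%N by rewrite mdeg_mnm_seq.
by exists (BMultinom hm); rewrite ?mem_enum //= mkpart_mnm_seq.
Qed.

Lemma sf_coef_bounded f : exists d, forall s, sf_coef f s != 0 -> (sumn s <= d)%N.
Proof.
have [d fd] := sf_bounded f; exists d => s; rewrite /sf_coef -mcoeff_msupp.
move=> /msize_mdeg_lt; rewrite mdeg_mnm_seq // => /ltnW/leq_trans; apply.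
exact: fd.
Qed.

Lemma monomial_expansion f d : (forall s, sf_coef f s != 0 -> (sumn s <= d)%N) ->
  f = \sum_(s <- parts_le d) sf_coef f s *: monomialsym s.
Proof.
move=> hd; apply: sf_coef_ext => t; rewrite sf_coef_sum.
under eq_bigr do rewrite sf_coefZ sf_coef_monomial.
have [ht|ht] := boolP (t \in parts_le d).
  rewrite (bigD1_seq t) ?parts_le_uniq //= eqxx mulr1 big1 ?addr0 // => s.
  by rewrite eq_sym => /negPf ->; rewrite mulr0.
rewrite big_seq big1 => [|s hs]; last first.
  by case: eqP => [e|_]; rewrite ?mulr0 //; rewrite e hs in ht.
by apply: contraNeq ht => /hd; rewrite mem_parts_le.
Qed.

(** Linear subspaces are represented by predicates closed under c *: g + h; an
    induction of this form replaces a manipulation of linear combinations. *)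
Lemma monomial_ind (H : symfun -> Prop) f :
  H 0 -> (forall c g h, H g -> H h -> H (c *: g + h)) ->
  (forall s, sf_coef f s != 0 -> H (monomialsym s)) -> H f.
Proof.
move=> H0 HL Hm; have [d hd] := sf_coef_bounded f; rewrite (monomial_expansion hd).
elim/big_rec: _ => // s g _ Hg.
have [->|ne] := eqVneq (sf_coef f s) 0; first by rewrite scale0r add0r.
by apply: HL => //; apply: Hm.
Qed.

(** * Power sums as a basis *)

Lemma mnm_split N (m : 'X_{1..N}) j :
  perm_eq m (m j :: [seq m i | i <- rem j (enum 'I_N)]).
Proof.
have -> : m = [seq m i | i <- enum 'I_N] :> seq nat.
  apply: (@eq_from_nth _ 0%N); first by rewrite size_tuple size_map size_enum_ord.
  move=> i; rewrite size_tuple => lt; rewrite (nth_map (Ordinal lt)) ?size_enum_ord //.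
  by rewrite (mnm_nth 0%N) nth_enum_ord.
by rewrite -map_cons; apply: perm_map; apply: perm_to_rem; rewrite mem_enum.
Qed.

Lemma mcoeff_mulXe N (g : {mpoly rat[N]}) j e (m : 'X_{1..N}) :
  ('X_j ^+ e * g)@_m = if (e <= m j)%N then g@_(m - U_(j) *+ e) else 0.
Proof.
rewrite mpolyXn mulrC; have [h|h] := boolP (_ <= _)%N.
  have /submK e1 : (U_(j) *+ e <= m)%MM.
    apply/mnm_lepP => i; rewrite mulmnE mnm1E.
    by case: (eqVneq j i) => [<-|_]; rewrite ?mul1n ?mul0n.
  by rewrite -[in LHS]e1 addmC mcoeffMX.
apply/eqP; rewrite mcoeff_eq0 (perm_mem (msuppMX _ _)); apply/mapP => -[t _ e1].
by move: h; rewrite e1 mnmDE mulmnE mnm1E eqxx mul1n leq_addr.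
Qed.

Lemma mcoeff_psumM N (g : {mpoly rat[N]}) r (m : 'X_{1..N}) :
  (powersumS r N * g)@_m
  = \sum_(j < N) if (r < m j)%N then g@_(m - U_(j) *+ r.+1) else 0.
Proof.
rewrite /= mulr_suml (raddf_sum (mcoeff m)) /=.
by apply: eq_bigr => j _; rewrite mcoeff_mulXe.
Qed.

(** Allowing unsorted sequences makes it possible to add or remove a factor
    without sorting. *)
Definition pprod (s : seq nat) : symfun := \prod_(i <- s) powersumS i.-1.

Lemma pprod_cons r s : pprod (r :: s) = powersumS r.-1 * pprod s.
Proof. by rewrite /pprod big_cons. Qed.

Lemma pprod_ge0 s N (m : 'X_{1..N}) : 0 <= (pprod s N)@_m.
Proof.
elim: s m => [|r s IH] m; first by rewrite /pprod big_nil /= mcoeff1 ler0n.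
rewrite pprod_cons mcoeff_psumM; apply: sumr_ge0 => j _.
by case: ifP.
Qed.

(** A monomial of the product arises by choosing a variable for each factor. It
    involves as many variables as there are factors only if the choices are
    distinct, and then its exponents are the exponents of the factors. *)
Lemma pprod_supp s N (m : 'X_{1..N}) : 0%N \notin s -> (pprod s N)@_m != 0 ->
  [/\ sumn m = sumn s, (size (pos_part m) <= size s)%N &
      size (pos_part m) = size s -> perm_eq (pos_part m) s].
Proof.
elim: s m => [|r s IH] m.
  rewrite /pprod big_nil /= mcoeff1 => _; have [-> _|] := eqVneq m 0%MM; last by rewrite eqxx.
  have e : pos_part (0%MM : 'X_{1..N}) = [::].
    by rewrite /pos_part (@eq_in_filter _ _ pred0) ?filter_pred0 // => x /tnthP[i ->];
      rewrite -mnm_tnth mnm0E.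
  by rewrite e -sumn_pos_part e.
rewrite inE negb_or eq_sym -lt0n => /andP [r_gt0 s_pos].
rewrite pprod_cons mcoeff_psumM => h.
have [j hj] : exists j, (if (r.-1 < m j)%N
    then (pprod s N)@_(m - U_(j) *+ r.-1.+1) else 0) != 0.
  apply/existsP; apply: contraR h; rewrite negb_exists => /forallP h.
  by rewrite big1 // => j _; apply/eqP/negPn; exact: h.
move: hj; rewrite prednK //; case: ifP; last by rewrite eqxx.
move=> lt_rm; set m' := (m - _)%MM => /(IH _ s_pos) [sum_m' sz_m' perm_m'].
have m'j : m' j = (m j - r)%N by rewrite mnmBE mulmnE mnm1E eqxx mul1n.
set R := [seq m i | i <- rem j (enum 'I_N)].
have pm : perm_eq m (m j :: R) := mnm_split m j.
have pm' : perm_eq m' (m' j :: R).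
  rewrite (permPl (mnm_split m' j)); suff -> : R = [seq m' i | i <- rem j (enum 'I_N)] by [].
  apply/eq_in_map => i; rewrite mem_rem_uniq ?enum_uniq // inE => /andP [ne _].
  by rewrite mnmBE mulmnE mnm1E eq_sym (negPf ne) mul0n subn0.
have ppm : perm_eq (pos_part m) (m j :: pos_part R).
  have := perm_filter (fun x => 0 < x)%N pm.
  by rewrite /= (leq_trans r_gt0 lt_rm).
have ppm' : perm_eq (pos_part m') (if (0 < m' j)%N then m' j :: pos_part R else pos_part R).
  exact: perm_filter pm'.
have smm : sumn m = (r + sumn m')%N.
  rewrite (perm_sumn pm) (perm_sumn pm') /= m'j addnA subnKC //; exact: lt_rm.
rewrite (perm_size ppm) /= smm sum_m'; split => //.
  move: (perm_size ppm') sz_m' => ->; case: ifP => _ /=; last by [].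
  by move=> hh; apply: leq_trans hh _.
rewrite m'j in ppm' *; case: ifP ppm' => [gt0 ppm' [e]|/negbT gt0 ppm' [e]].
  by move: (perm_size ppm') sz_m' => /= ->; rewrite e ltnn.
have mjr : m j = r by lia.
rewrite (permPl ppm) mjr perm_cons -(permPl ppm') perm_m' //.
by rewrite (perm_size ppm').
Qed.

Lemma pprod_gt0 s N : 0%N \notin s -> (size s <= N)%N ->
  0 < (pprod s N)@_(mnm_seq N s).
Proof.
suff H (m : 'X_{1..N}) : 0%N \notin s -> perm_eq (pos_part m) s -> 0 < (pprod s N)@_m.
  move=> s0 hs; apply: H => //; rewrite mnm_seqE // /pos_part filter_cat.
  rewrite [X in _ ++ X](@eq_in_filter _ _ pred0) ?filter_pred0 ?cats0; last first.
    by move=> x /nseqP[->].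
  suff /all_filterP -> : all (fun x => 0 < x)%N s by [].
  by apply/allP => -[] // h; rewrite h in s0.
elim: s m => [|r s IH] m.
  move=> _ h; rewrite /pprod big_nil /= mcoeff1.
  suff -> : m = 0%MM by rewrite eqxx ltr01.
  by apply/eqP; rewrite -mdeg_eq0 /mdeg -sumnE -sumn_pos_part (perm_sumn h).
rewrite inE negb_or eq_sym -lt0n => /andP [r_gt0 s_pos] h.
have /mapP [j _ mj] : r \in [seq m i | i <- enum 'I_N].
  have : r \in pos_part m by rewrite (perm_mem h) mem_head.
  rewrite mem_filter => /andP [_ /tnthP [j ->]]; apply/mapP; exists j; first by rewrite mem_enum.
  by rewrite mnm_tnth.
rewrite pprod_cons mcoeff_psumM (bigD1 j) //= prednK // -mj leqnn.
apply: ltr_wpDr.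
  by apply: sumr_ge0 => i _; case: ifP => // _; exact: pprod_ge0.
apply: IH => //; set m' := (m - _)%MM.
have m'j : m' j = 0%N by rewrite mnmBE mulmnE mnm1E eqxx mul1n -mj subnn.
set R := [seq m i | i <- rem j (enum 'I_N)].
have pm : perm_eq m (m j :: R) := mnm_split m j.
have pm' : perm_eq m' (m' j :: R).
  rewrite (permPl (mnm_split m' j)); suff -> : R = [seq m' i | i <- rem j (enum 'I_N)] by [].
  apply/eq_in_map => i; rewrite mem_rem_uniq ?enum_uniq // inE => /andP [ne _].
  by rewrite mnmBE mulmnE mnm1E eq_sym (negPf ne) mul0n subn0.
have := perm_filter (fun x => 0 < x)%N pm'; rewrite m'j /= => /permPl ->.
have := perm_filter (fun x => 0 < x)%N pm; rewrite -mj /= r_gt0 => /permPl hh.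
by move: h; rewrite hh perm_cons.
Qed.

Lemma powersum_prodE (l : intpart) : powersum_prod l = pprod l. Proof. by []. Qed.

Lemma intpart0 (l : intpart) : 0%N \notin parts l.
Proof. by case/andP: (intpartP l). Qed.

Lemma sf_coef_powersum_supp (l s : intpart) : sf_coef (powersum_prod l) s != 0 ->
  [/\ sumn s = sumn l, (size s <= size l)%N & size s = size l -> s = l].
Proof.
rewrite /sf_coef powersum_prodE => /(pprod_supp (intpart0 l)).
rewrite pos_part_mnm_seq // -sumn_pos_part pos_part_mnm_seq //.
by case=> e1 e2 e3; split=> // /e3/intpart_perm.
Qed.

Lemma sf_coef_powersum_diag (l : intpart) : sf_coef (powersum_prod l) l != 0.
Proof. by rewrite gt_eqF // /sf_coef powersum_prodE pprod_gt0 // intpart0. Qed.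

(** p_l is a nonzero multiple of m_l up to monomial functions with fewer parts;
    so m_l is reached by induction on its length. *)
Lemma powersum_ind (H : symfun -> Prop) :
  H 0 -> (forall c g h, H g -> H h -> H (c *: g + h)) ->
  (forall l, H (powersum_prod l)) -> forall f, H f.
Proof.
move=> H0 HL Hp.
suff Hm l : H (monomialsym l) by move=> f; apply: monomial_ind.
have [d] := ubnP (size l); elim: d l => // d IH l ltd.
set c := sf_coef (powersum_prod l) l.
have -> : monomialsym l =
   (- c^-1) *: (powersum_prod l - c *: monomialsym l) + (c^-1 *: powersum_prod l + 0).
  rewrite scaleNr scalerBr scalerA mulVf ?sf_coef_powersum_diag // scale1r addr0 opprB.
  by rewrite subrK.
apply: (HL); last exact: HL.
apply: monomial_ind => // s; rewrite sf_coefB sf_coefZ sf_coef_monomial.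
have [->|ne] := eqVneq s l; first by rewrite mulr1 subrr eqxx.
rewrite mulr0 subr0 => /sf_coef_powersum_supp [_ le_sl sz]; apply: IH.
rewrite ltnS in ltd; apply: leq_trans ltd; rewrite ltn_neqAle le_sl andbT.
by apply: contraNneq ne => /sz ->.
Qed.

(** By decreasing length: apart from p_l itself, m_l occurs only in products p_t
    of the same weight with more factors. *)
Lemma powersum_free (r : seq intpart) (c : intpart -> rat) : uniq r ->
  \sum_(l <- r) c l *: powersum_prod l = 0 -> forall l, l \in r -> c l = 0.
Proof.
move=> ur h0 l lr.
have [d] := ubnP (sumn l - size l); elim: d l lr => // d IH l lr ltd.
have := congr1 (sf_coef^~ l) h0; rewrite sf_coef0 sf_coef_sum (bigD1_seq l) //= big_seq_cond big1 ?addr0.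
  by rewrite sf_coefZ => /eqP; rewrite mulf_eq0 (negPf (sf_coef_powersum_diag l)) orbF => /eqP.
move=> t /andP [tr ne]; rewrite sf_coefZ.
have [->|] := eqVneq (sf_coef (powersum_prod t) l) 0; first by rewrite mulr0.
case/sf_coef_powersum_supp => e1 e2 e3; rewrite IH ?mul0r //.
have szlt : (size l < size t)%N.
  by rewrite ltn_neqAle e2 andbT; apply: contraNneq ne => /e3 ->.
by have := size_le_sumn t; move: ltd; rewrite ltnS; lia.
Qed.

(** * Forms and operators diagonal on power sums *)

Lemma fs_parts (V : nmodType) (F : intpart -> V) d :
  (forall l, F l != 0 -> (sumn l <= d)%N) ->
  \sum_(l \in [set: intpart]) F l = \sum_(l <- parts_le d) F l.
Proof.
move=> h; rewrite (fsbigE (parts_le d)).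
- by apply: eq_bigl => l; exact: mem_set.
- exact: parts_le_uniq.
- by [].
- by move=> l _; apply: contraNeq => /h; rewrite mem_parts_le.
Qed.

Lemma parts_le_widen (V : nmodType) (F : intpart -> V) d d' :
  (d <= d')%N -> (forall l, F l != 0 -> (sumn l <= d)%N) ->
  \sum_(l <- parts_le d) F l = \sum_(l <- parts_le d') F l.
Proof.
move=> le h; rewrite -!fs_parts // => l /h hl; exact: leq_trans le.
Qed.

(** The bound d turns the expansion into a sum over a list, and two expansions
    can be compared after enlarging d. *)
Definition powersum_expansion (f : symfun) (c : intpart -> rat) (d : nat) :=
  (forall l, c l != 0 -> (sumn l <= d)%N)
  /\ f = \sum_(l <- parts_le d) c l *: powersum_prod l.

Lemma powersum_expansion_widen f c d d' : (d <= d')%N ->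
  powersum_expansion f c d -> powersum_expansion f c d'.
Proof.
move=> le [h ->]; split; first by move=> l /h hl; exact: leq_trans le.
apply: parts_le_widen => // l; apply: contraNT => hl.
suff -> : c l = 0 by rewrite scale0r.
by apply: contraNeq hl => /h.
Qed.

Lemma powersum_expansion_ex f : exists c d, powersum_expansion f c d.
Proof.
apply: (powersum_ind (H := fun f => exists c d, powersum_expansion f c d)) f.
- exists (fun=> 0), 0%N; split=> [l|]; first by rewrite eqxx.
  by rewrite big1 // => l _; rewrite scale0r.
- move=> a g h [c [d hc]] [c' [d' hc']].
  exists (fun l => a * c l + c' l), (maxn d d').
  have [s1 ->] := powersum_expansion_widen (leq_maxl d d') hc.
  have [s2 ->] := powersum_expansion_widen (leq_maxr d d') hc'.
  split=> [l|].
    have [c0|/s1 //] := eqVneq (c l) 0; have [c'0|/s2 //] := eqVneq (c' l) 0.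
    by rewrite c0 c'0 mulr0 addr0 eqxx.
  rewrite scaler_sumr -big_split; apply: eq_bigr => l _.
  by rewrite scalerDl scalerA.
- move=> l; exists (fun t => (t == l)%:R), (sumn l); split=> [t|].
    by have [->//|_] := eqVneq t l; rewrite eqxx.
  rewrite (bigD1_seq l) ?parts_le_uniq ?mem_parts_le //= eqxx scale1r big1 ?addr0 //.
  by move=> t /negPf ->; rewrite scale0r.
Qed.

Lemma powersum_expansion_uniq f c c' d d' :
  powersum_expansion f c d -> powersum_expansion f c' d' -> c =1 c'.
Proof.
move=> /(powersum_expansion_widen (leq_maxl d d')) [s1 e1].
move=> /(powersum_expansion_widen (leq_maxr d d')) [s2 e2] l.
have [hl|hl] := boolP (l \in parts_le (maxn d d')).
  apply/eqP; rewrite -subr_eq0; apply/eqP; move: l hl.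
  apply: powersum_free; first exact: parts_le_uniq.
  under eq_bigr do rewrite scalerBl.
  by rewrite sumrB -e1 -e2 subrr.
rewrite mem_parts_le in hl.
by rewrite (contraNeq (s1 l) hl) (contraNeq (s2 l) hl).
Qed.

(** powersum_coord is defined by choice; existence and uniqueness of expansions
    characterize the chosen function. *)
Lemma powersum_coordP f : exists d, powersum_expansion f (powersum_coord f) d.
Proof.
pose S := [set c | finite_set [set lam | c lam != 0] /\
    f = \sum_(lam \in [set: intpart]) c lam *: powersum_prod lam]%classic.
have /(xgetPex (fun=> 0)) : (exists c, S c)%classic.
  have [c [d [h e]]] := powersum_expansion_ex f; exists c; split.
    apply: (@sub_finite_set _ _ [set` parts_le d]%classic) => [l /= /h|].
      by rewrite mem_parts_le.
    exact: finite_seq.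
  rewrite (@fs_parts _ _ d) // => l; apply: contraNT => hl.
  suff -> : c l = 0 by rewrite scale0r.
  by apply: contraNeq hl => /h.
rewrite -[xget _ _]/(powersum_coord f); case=> /finite_seqP [r hr] e.
pose d := \max_(l <- r) sumn l.
have h l : powersum_coord f l != 0 -> (sumn l <= d)%N.
  move=> hl; have lr : l \in r by have : [set` r]%classic l by rewrite -hr.
  by rewrite /d (big_rem l) //= leq_maxl.
exists d; split=> //; rewrite {1}e (@fs_parts _ _ d) // => l; apply: contraNT => hl.
suff -> : powersum_coord f l = 0 by rewrite scale0r.
by apply: contraNeq hl => /h.
Qed.

Lemma powersum_coordE f c d : powersum_expansion f c d -> powersum_coord f =1 c.
Proof. by have [d' h] := powersum_coordP f; exact: powersum_expansion_uniq h. Qed.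

Lemma powersum_coord_lin a f g l :
  powersum_coord (a *: f + g) l = a * powersum_coord f l + powersum_coord g l.
Proof.
have [d hf] := powersum_coordP f; have [d' hg] := powersum_coordP g; move: l.
apply: (@powersum_coordE _ _ (maxn d d')).
have [s1 e1] := powersum_expansion_widen (leq_maxl d d') hf.
have [s2 e2] := powersum_expansion_widen (leq_maxr d d') hg.
split=> [l|].
  have [c0|/s1 //] := eqVneq (powersum_coord f l) 0.
  have [c'0|/s2 //] := eqVneq (powersum_coord g l) 0.
  by rewrite c0 c'0 mulr0 addr0 eqxx.
rewrite {1}e1 {1}e2 scaler_sumr -big_split; apply: eq_bigr => l _.
by rewrite scalerDl scalerA.
Qed.

Lemma powersum_coord0 l : powersum_coord 0 l = 0.
Proof.
have := powersum_coord_lin 1 0 0 l; rewrite scale1r addr0 mul1r => /eqP.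
by rewrite -subr_eq0 opprD addrA subrr add0r oppr_eq0 => /eqP.
Qed.
Lemma powersum_coordZ a f l : powersum_coord (a *: f) l = a * powersum_coord f l.
Proof. by rewrite -[a *: f]addr0 powersum_coord_lin powersum_coord0 addr0. Qed.

Lemma powersum_coord_prod l t : powersum_coord (powersum_prod l) t = (t == l)%:R.
Proof.
move: t; apply: (@powersum_coordE _ _ (sumn l)); split=> [t|].
  by have [->//|_] := eqVneq t l; rewrite eqxx.
rewrite (bigD1_seq l) ?parts_le_uniq ?mem_parts_le //= eqxx scale1r big1 ?addr0 //.
by move=> t /negPf ->; rewrite scale0r.
Qed.

Lemma powersum_coord_bounded f : exists d, forall l, powersum_coord f l != 0 -> (sumn l <= d)%N.
Proof. by have [d [h _]] := powersum_coordP f; exists d. Qed.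

Lemma powersum_coord_inj f g : powersum_coord f =1 powersum_coord g -> f = g.
Proof.
move=> h; have [[d hf] [d' hg]] := (powersum_coordP f, powersum_coordP g).
have [_ e1] := powersum_expansion_widen (leq_maxl d d') hf.
have [_ e2] := powersum_expansion_widen (leq_maxr d d') hg.
by apply: etrans e1 _; apply: etrans _ (esym e2); apply: eq_bigr => l _; rewrite h.
Qed.

(** The Jack scalar products of all parameters, and the form relating e_nu to
    monomials, differ only in the weight. *)
Definition diag_form (w : intpart -> rat) (f g : symfun) : rat :=
  \sum_(l \in [set: intpart]) powersum_coord f l * powersum_coord g l * w l.

Lemma jack_scalarE a f g :
  jack_scalar a f g = diag_form (fun l => (zpart l)%:R * a ^+ size l) f g.
Proof. by []. Qed.

Section DiagForm.
Variable w : intpart -> rat.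

Lemma diag_formC f g : diag_form w f g = diag_form w g f.
Proof. by apply: eq_fsbigr => l _; rewrite [_ * powersum_coord f l]mulrC. Qed.

Lemma diag_form_parts f g d : (forall l, powersum_coord f l != 0 -> (sumn l <= d)%N) ->
  diag_form w f g = \sum_(l <- parts_le d) powersum_coord f l * powersum_coord g l * w l.
Proof.
by move=> h; apply: fs_parts => l; rewrite !mulf_eq0 !negb_or -andbA => /and3P [/h].
Qed.

Lemma diag_form_linr c f g h : diag_form w f (c *: g + h) = c * diag_form w f g + diag_form w f h.
Proof.
have [d hd] := powersum_coord_bounded f; rewrite !(diag_form_parts _ hd) mulr_sumr -big_split.
by apply: eq_bigr => l _; rewrite powersum_coord_lin mulrDr mulrDl /= mulrCA !mulrA.
Qed.
Lemma diag_form_linl c f g h : diag_form w (c *: g + h) f = c * diag_form w g f + diag_form w h f.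
Proof. by rewrite diag_formC diag_form_linr !(diag_formC f). Qed.
Lemma diag_form0r f : diag_form w f 0 = 0.
Proof. by apply: fsbig1 => l _; rewrite powersum_coord0 mulr0 mul0r. Qed.
Lemma diag_form0l f : diag_form w 0 f = 0. Proof. by rewrite diag_formC diag_form0r. Qed.
Lemma diag_formZr c f g : diag_form w f (c *: g) = c * diag_form w f g.
Proof. by rewrite -[c *: g]addr0 diag_form_linr diag_form0r addr0. Qed.
Lemma diag_formDr f g h : diag_form w f (g + h) = diag_form w f g + diag_form w f h.
Proof. by rewrite -[g]scale1r diag_form_linr mul1r scale1r. Qed.
Lemma diag_formZl c f g : diag_form w (c *: f) g = c * diag_form w f g.
Proof. by rewrite diag_formC diag_formZr diag_formC. Qed.
Lemma diag_formDl f g h : diag_form w (f + g) h = diag_form w f h + diag_form w g h.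
Proof. by rewrite diag_formC diag_formDr !(diag_formC h). Qed.
Lemma diag_form_suml (I : Type) (r : seq I) P (F : I -> symfun) g :
  diag_form w (\sum_(i <- r | P i) F i) g = \sum_(i <- r | P i) diag_form w (F i) g.
Proof. by elim/big_rec2: _ => [|i x y _ <-]; rewrite ?diag_form0l ?diag_formDl. Qed.

Lemma diag_form_prodr f l : diag_form w f (powersum_prod l) = powersum_coord f l * w l.
Proof.
rewrite diag_formC (@diag_form_parts _ _ (sumn l)) => [|t]; last first.
  by rewrite powersum_coord_prod; have [->//|_] := eqVneq t l; rewrite eqxx.
rewrite (bigD1_seq l) ?parts_le_uniq ?mem_parts_le //= powersum_coord_prod eqxx mul1r big1 ?addr0 //.
by move=> t /negPf ne; rewrite powersum_coord_prod ne !mul0r.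
Qed.

Lemma diag_form_prod l t : diag_form w (powersum_prod l) (powersum_prod t) = (l == t)%:R * w l.
Proof. by rewrite diag_form_prodr powersum_coord_prod eq_sym; case: eqP => [->|_]; rewrite ?mul0r. Qed.

Lemma diag_form_nondeg f : (forall l, w l != 0) ->
  (forall g, diag_form w f g = 0) -> f = 0.
Proof.
move=> w0 h; apply: powersum_coord_inj => l; rewrite powersum_coord0; apply/eqP.
by have /eqP := h (powersum_prod l); rewrite diag_form_prodr mulf_eq0 (negPf (w0 l)) orbF.
Qed.

Definition pscale (f : symfun) : symfun :=
  \sum_(l \in [set: intpart]) (w l * powersum_coord f l) *: powersum_prod l.

Lemma pscale_coord f l : powersum_coord (pscale f) l = w l * powersum_coord f l.
Proof.
have [d hd] := powersum_coord_bounded f; move: l; apply: (@powersum_coordE _ _ d).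
split=> [l|]; first by rewrite mulf_eq0 negb_or => /andP [_ /hd].
apply: fs_parts => l; apply: contraNT => hl.
suff -> : powersum_coord f l = 0 by rewrite mulr0 scale0r.
by apply: contraNeq hl => /hd.
Qed.

Lemma pscale_lin c f g : pscale (c *: f + g) = c *: pscale f + pscale g.
Proof.
by apply: powersum_coord_inj => l; rewrite pscale_coord !powersum_coord_lin !pscale_coord mulrDr mulrCA.
Qed.
Lemma pscale0 : pscale 0 = 0.
Proof. by apply: powersum_coord_inj => l; rewrite pscale_coord powersum_coord0 mulr0. Qed.
Lemma pscaleZ c f : pscale (c *: f) = c *: pscale f.
Proof. by rewrite -[c *: f]addr0 pscale_lin pscale0 addr0. Qed.
Lemma pscaleD f g : pscale (f + g) = pscale f + pscale g.
Proof. by rewrite -[f]scale1r pscale_lin !scale1r. Qed.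
Lemma pscale_sum (I : Type) (r : seq I) P (F : I -> symfun) :
  pscale (\sum_(i <- r | P i) F i) = \sum_(i <- r | P i) pscale (F i).
Proof. by elim/big_rec2: _ => [|i x y _ <-]; rewrite ?pscale0 ?pscaleD. Qed.
Lemma pscale_prod l : pscale (powersum_prod l) = w l *: powersum_prod l.
Proof.
apply: powersum_coord_inj => t; rewrite pscale_coord powersum_coordZ powersum_coord_prod.
by case: eqP => [->|]; rewrite ?mulr0.
Qed.

End DiagForm.

Lemma pprod_mkpart s : 0%N \notin s -> pprod s = powersum_prod (mkpart s).
Proof.
move=> s0; rewrite powersum_prodE; apply: perm_big; rewrite perm_sym.
rewrite (permPl (perm_mkpart s)) /pos_part.
suff /all_filterP -> : all (fun x => 0 < x)%N s by [].
by apply/allP => -[] // h; rewrite h in s0.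
Qed.

Definition pscale_mul (a : nat -> rat) := pscale (fun l => \prod_(i <- l) a i.-1).

Section PscaleMul.
Variable a : nat -> rat.
Local Notation om := (pscale_mul a).

Lemma pscale_mul_pprod s : 0%N \notin s ->
  om (pprod s) = (\prod_(i <- s) a i.-1) *: pprod s.
Proof.
move=> s0; rewrite pprod_mkpart // /pscale_mul pscale_prod; congr (_ *: _).
apply: perm_big; rewrite (permPl (perm_mkpart s)) /pos_part.
suff /all_filterP -> : all (fun x => 0 < x)%N s by [].
by apply/allP => -[] // h; rewrite h in s0.
Qed.

(** The eigenvalue on p_l is multiplicative in the parts of l. *)
Lemma pscale_mulM f g : om (f * g) = om f * om g.
Proof.
apply: (powersum_ind (H := fun f => om (f * g) = om f * om g)) f.
- by rewrite mul0r /pscale_mul pscale0 mul0r.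
- move=> c f h e1 e2.
  by rewrite mulrDl -scalerAl /pscale_mul !pscale_lin mulrDl -scalerAl -e1 -e2.
move=> l; apply: (powersum_ind (H := fun g => om (_ * g) = om _ * om g)) g.
- by rewrite mulr0 /pscale_mul pscale0 mulr0.
- move=> c f h e1 e2.
  by rewrite mulrDr -scalerAr /pscale_mul !pscale_lin mulrDr -scalerAr -e1 -e2.
move=> t; rewrite !powersum_prodE.
have -> : pprod l * pprod t = pprod (l ++ t) by rewrite /pprod big_cat.
rewrite !pscale_mul_pprod ?intpart0 ?mem_cat ?negb_or ?intpart0 //.
by rewrite -scalerAl -scalerAr scalerA big_cat /pprod big_cat.
Qed.

Lemma pscale_mul1 : om 1 = 1.
Proof.
have -> : 1 = pprod [::] by rewrite /pprod big_nil.
by rewrite pscale_mul_pprod // big_nil scale1r.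
Qed.

Lemma pscale_mul_prod (I : Type) (r : seq I) P (F : I -> symfun) :
  om (\prod_(i <- r | P i) F i) = \prod_(i <- r | P i) om (F i).
Proof. by elim/big_rec2: _ => [|i x y _ <-]; rewrite ?pscale_mul1 ?pscale_mulM. Qed.

Lemma pscale_mul_powersum r : om (powersumS r) = a r *: powersumS r.
Proof.
have -> : powersumS r = pprod [:: r.+1] by rewrite /pprod big_seq1.
by rewrite pscale_mul_pprod // big_seq1.
Qed.
End PscaleMul.

(** * Duality of elementary and monomial functions *)

Lemma alt_sum_tail (m : nat) :
  \sum_(r < m) (-1) ^+ r * (m - r.+1 <= 1)%N%:R = (m == 1)%N%:R :> rat.
Proof.
case: m => [|[|m]]; rewrite ?big_ord0 ?big_ord1 //= !big_ord_recr /=.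
rewrite big1 ?add0r => [|i _]; first by rewrite !subSS subnn subSnn /= !mulr1 exprS mulN1r subrr.
have -> : (m.+2 - i.+1 <= 1)%N = false by have := ltn_ord i; lia.
by rewrite mulr0.
Qed.

Lemma mnmB_mulU N (m : 'X_{1..N}) (j i : 'I_N) e :
  (m - U_(j) *+ e)%MM i = if i == j then (m j - e)%N else m i.
Proof.
rewrite mnmBE mulmnE mnm1E eq_sym; case: eqP => [->|_]; first by rewrite mul1n.
by rewrite mul0n subn0.
Qed.

Lemma mdegB_mulU N (m : 'X_{1..N}) (j : 'I_N) e : (e <= m j)%N ->
  mdeg (m - U_(j) *+ e)%MM = (mdeg m - e)%N.
Proof.
move=> h; rewrite !mdegE (bigD1 j) //= mnmB_mulU eqxx [in RHS](bigD1 j) //=.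
rewrite addnBAC //; congr (_ + _ - _)%N; apply: eq_bigr => i ne.
by rewrite mnmB_mulU (negPf ne).
Qed.

(** Coefficient by coefficient: in a monomial with a single exponent above 1, the
    contributions of two consecutive powers of that variable cancel. *)
Lemma newton a :
  a%:R *: elemsym a = \sum_(r < a) (-1) ^+ r *: (powersumS r * elemsym (a - r.+1)).
Proof.
apply: symfunP => N; apply/mpolyP => m; rewrite sf_at_sum raddf_sum /= mcoeffZ mcoeff_mesym.
under eq_bigr => r _.
  rewrite mcoeffZ (mcoeff_psumM _ r) mulr_sumr.
  under eq_bigr => j _ do rewrite /= mcoeff_mesym.
  over.
rewrite exchange_big /=.
have [ea|nea] := eqVneq (mdeg m) a; last first.
  rewrite [mechar a m]/mechar (negPf nea) mulr0 big1 // => j _; rewrite big1 // => r _.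
  case: ifP => lt; rewrite ?mulr0 //; rewrite /mechar mdegB_mulU //.
  have h : (m j <= mdeg m)%N by rewrite mdegE (bigD1 j) //= leq_addr.
  have -> : (mdeg m - r.+1 == a - r.+1)%N = false.
    by apply/negP => /eqP; have := ltn_ord r; move/eqP: nea; lia.
  by rewrite mulr0.
have key j : \sum_(r < a) (-1) ^+ r *
     (if (r < m j)%N then (mechar (a - r.+1)%N (m - U_(j) *+ r.+1)%MM)%:R else 0)
   = ([forall i, m i <= 1]%N && (m j == 1%N))%:R :> rat.
  have mja : (m j <= a)%N by rewrite -ea mdegE (bigD1 j) //= leq_addr.
  have -> : \sum_(r < a) (-1) ^+ r *
     (if (r < m j)%N then (mechar (a - r.+1)%N (m - U_(j) *+ r.+1)%MM)%:R else 0)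
   = \sum_(r < a | (r < m j)%N) ([forall i, (i != j) ==> (m i <= 1)]%N)%:R *
     ((-1) ^+ r * (m j - r.+1 <= 1)%N%:R) :> rat.
    rewrite [RHS]big_mkcond; apply: eq_bigr => r _; case: ifP => lt; last by rewrite mulr0.
    rewrite mulrCA; congr (_ * _); rewrite -natrM mulnb; congr (_ : bool)%:R.
    rewrite /mechar mdegB_mulU // ea eqxx /=.
    apply/forallP/andP => [h|[/forallP h1 h2] i].
      split; last by have := h j; rewrite mnmB_mulU eqxx.
      by apply/forallP => i; apply/implyP => /negPf ne; have := h i; rewrite mnmB_mulU ne.
    by rewrite mnmB_mulU; case: eqP => // /eqP ne; exact: implyP (h1 i) ne.
  rewrite -mulr_sumr -(big_ord_widen a (fun r => (-1) ^+ r * (m j - r.+1 <= 1)%N%:R)) //.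
  rewrite alt_sum_tail -natrM mulnb; congr (_ : bool)%:R.
  have [mj|_] := eqVneq (m j) 1%N; rewrite ?andbF // !andbT.
  apply/forallP/forallP => h i; last by apply/implyP.
  have [->|ne] := eqVneq i j; first by rewrite mj.
  exact: implyP (h i) ne.
under eq_bigr do rewrite key.
rewrite /mechar ea eqxx /=; case: forallP => h; last by rewrite mulr0 big1.
rewrite mulr1 -ea mdegE natr_sum; apply: eq_bigr => j _.
by have := h j; case: (m j) => [|[]].
Qed.

(** z_l for unsorted sequences, where it satisfies the recursion zseq_cons. *)
Definition zseq (s : seq nat) : nat :=
  \prod_(i <- undup s) (i ^ count_mem i s * (count_mem i s)`!)%N.

Lemma zseq_perm s t : perm_eq s t -> zseq s = zseq t.
Proof.
move=> h; rewrite /zseq (perm_big _ (perm_undup (perm_mem h))) /=.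
by apply: eq_bigr => i _; move/seq.permP: h => ->.
Qed.

Lemma zseq_cons r s : zseq (r :: s) = (r * (count_mem r s).+1 * zseq s)%N.
Proof.
rewrite /zseq /= .
have E t : r \notin t -> \prod_(i <- t) (i ^ ((r == i) + count_mem i s) * ((r == i) + count_mem i s)`!)%N
   = \prod_(i <- t) (i ^ count_mem i s * (count_mem i s)`!)%N.
  move=> rt; rewrite !big_seq; apply: eq_bigr => i it.
  by case: eqP => [e|]; rewrite // e it in rt.
case: ifP => [rs|/negbT rs].
  have rs' : r \in undup s by rewrite mem_undup.
  rewrite !(perm_big _ (perm_to_rem rs')) !big_cons /= E; last first.
    by rewrite mem_rem_uniq ?undup_uniq // inE eqxx.
  by rewrite eqxx add1n expnS factS; ring.
rewrite big_cons eqxx E; last by rewrite mem_undup.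
rewrite (count_memPn rs) addn0 expn1 !muln1; congr (_ * _)%N.
Qed.

Lemma zpartE (l : intpart) : zpart l = zseq l. Proof. by []. Qed.

Lemma zpart_neq0 (l : intpart) : (zpart l)%:R != 0 :> rat.
Proof.
rewrite pnatr_eq0 zpartE; elim: (parts l) (intpart0 l) => [|r s IH].
  by rewrite /zseq big_nil.
rewrite inE negb_or eq_sym => /andP [r0 /IH h].
by rewrite zseq_cons !muln_eq0 !negb_or r0 h.
Qed.

Definition omega_weight (l : intpart) : rat := \prod_(i <- l) (-1) ^+ i.-1 * (zpart l)%:R.
(** This is <f, omega_k g>_(1/k) for every nonzero k. *)
Definition omega_form := diag_form omega_weight.

Lemma signM_id (n : nat) : (-1) ^+ n * (-1) ^+ n = 1 :> rat.
Proof. by rewrite -exprD addnn -mul2n exprM sqrrN !expr1n. Qed.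

(** For k = 1, the classical involution exchanging e_r and h_r. *)
Definition omega (k : rat) := pscale_mul (fun i => (-1) ^+ i * k).

Lemma jack_omega_form k f g : jack_scalar k f g = omega_form f (omega k g).
Proof.
rewrite jack_scalarE; apply: eq_fsbigr => l _; rewrite pscale_coord.
rewrite -mulrA -[RHS]mulrA; congr (_ * _); rewrite [_ * powersum_coord g l]mulrC.
rewrite -[RHS]mulrA; congr (_ * _); rewrite mulrC /omega_weight mulrA; congr (_ * _).
rewrite big_split /= -mulrA mulrCA -big_split /= [X in _ * X]big1 ?mulr1.
  by rewrite big_const_seq count_predT -Monoid.iteropE.
by move=> i _; rewrite signM_id.
Qed.

Lemma omegaK k : k != 0 -> cancel (omega k) (omega k^-1).
Proof.
move=> k0 f; apply: powersum_coord_inj => l; rewrite !pscale_coord mulrA -big_split /= big1 ?mul1r //.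
by move=> i _; rewrite mulrACA signM_id mulVf // mul1r.
Qed.

Lemma omega_formC f g : omega_form f g = omega_form g f. Proof. exact: diag_formC. Qed.

Lemma jack_omega_form_inv k f g : k != 0 -> jack_scalar k^-1 f (omega k g) = omega_form f g.
Proof. by move=> k0; rewrite jack_omega_form omegaK. Qed.

Lemma jack_omega k f g : k != 0 ->
  jack_scalar k^-1 (omega k f) (omega k g) = jack_scalar k f g.
Proof. by move=> k0; rewrite jack_omega_form_inv // omega_formC -jack_omega_form jack_scalarE diag_formC. Qed.

(** Multiplication by a power sum is adjoint to the derivation with respect to
    this power sum, up to a factor. *)
Lemma omega_form_powersumM r f s : 0%N \notin s ->
  omega_form (powersumS r * f) (pprod s)
  = (-1) ^+ r * (r.+1 * count_mem r.+1 s)%:R * omega_form f (pprod (rem r.+1 s)).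
Proof.
move=> s0; apply: (powersum_ind (H := fun f => omega_form (_ * f) _ = _ * omega_form f _)) f.
- by rewrite mulr0 /omega_form !diag_form0l mulr0.
- move=> c f g e1 e2; rewrite mulrDr -scalerAr /omega_form !diag_form_linl.
  by rewrite (e1 : diag_form _ _ _ = _) (e2 : diag_form _ _ _ = _) /omega_form; ring.
move=> t.
have -> : powersumS r * powersum_prod t = pprod (r.+1 :: t) by rewrite pprod_cons.
have rs0 : 0%N \notin rem r.+1 s by apply: contra s0; exact: mem_rem.
have rt0 : 0%N \notin r.+1 :: t by rewrite inE negb_or /= intpart0.
rewrite (pprod_mkpart rt0) (pprod_mkpart rs0) (pprod_mkpart s0) /omega_form !diag_form_prod.
have pid u : 0%N \notin u -> pos_part u = u.
  by move=> h; apply/all_filterP/allP => -[] // h'; rewrite h' in h.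
rewrite mkpart_eq pid // [t == _]eq_sym mkpart_eq pid //.
have pms := perm_mkpart s; rewrite pid // in pms.
have pmr := perm_mkpart (rem r.+1 s); rewrite pid // in pmr.
rewrite (permPr pms).
have [rs|rs] := boolP (r.+1 \in s); last first.
  rewrite (count_memPn rs) muln0 mulr0 mul0r.
  case: (boolP (perm_eq _ _)) => [/perm_mem h|_]; last by rewrite mul0r.
  by rewrite -h mem_head in rs.
rewrite (permPr (perm_to_rem rs)) perm_cons perm_sym; case: (boolP (perm_eq _ _)) => // h; last by rewrite !mul0r mulr0.
rewrite !mul1r /omega_weight.
have sw u v : perm_eq u v -> \prod_(i <- u) (-1) ^+ i.-1 = \prod_(i <- v) (-1) ^+ i.-1 :> rat.
  by move=> huv; exact: perm_big.
rewrite (sw _ _ (perm_mkpart (r.+1 :: t))) pid //.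
rewrite !zpartE (zseq_perm (perm_mkpart (r.+1 :: t))) pid //.
rewrite zseq_cons big_cons /=.
have -> : count_mem r.+1 s = (count_mem r.+1 t).+1.
  have := perm_to_rem rs => /seq.permP ->; rewrite /= eqxx add1n; congr _.+1.
  by move/seq.permP: h => ->.
rewrite natrM; ring.
Qed.

Lemma mderiv_pprod N (i : 'I_N) s : 0%N \notin s ->
  (pprod s N)^`M(i) = \sum_(x <- s) x%:R *: ('X_i ^+ x.-1 * pprod (rem x s) N).
Proof.
elim: s => [|r s IH] s0; first by rewrite /pprod !big_nil /= mderivC.
move: s0; rewrite inE negb_or eq_sym => /andP [r0 s0].
rewrite pprod_cons sf_atM mderivM IH // big_cons; congr (_ + _).
  rewrite /= eqxx (raddf_sum (mderiv i)) /= (bigD1 i) //= big1 ?addr0 => [|j ne].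
    rewrite prednK ?lt0n // mpolyXn mderivX mulmnE mnm1E eqxx mul1n -scalerAl.
    congr (_ *: (_ * _)); rewrite mpolyXn; congr 'X_[_].
    apply/mnmP => j; rewrite mnmBE !mulmnE !mnm1E; case: eqP => _; last by rewrite !mul0n.
    by rewrite !mul1n subn1.
  by rewrite mpolyXn mderivX mulmnE mnm1E (negPf ne) mul0n scale0r.
rewrite mulr_sumr !big_seq; apply: eq_bigr => x xs.
rewrite -scalerAr mulrCA; congr (_ *: (_ * _)).
rewrite /=; have [e|ne] := eqVneq r x.
  by rewrite -(sf_atM (powersumS _)) -pprod_cons e /pprod (perm_big _ (perm_to_rem xs)).
by rewrite -(sf_atM (powersumS _)) -pprod_cons.
Qed.

(** The Euler operator of one variable strips a power of this variable off the
    monomial, as Newton's identity does for the corresponding factor e_(nu i). *)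
Lemma mcoeff_pprod_euler N (i : 'I_N) (m : 'X_{1..N}) s : 0%N \notin s ->
  (m i)%:R * (pprod s N)@_m
  = \sum_(x <- s) if (x <= m i)%N
      then x%:R * (pprod (rem x s) N)@_(m - U_(i) *+ x)%MM else 0.
Proof.
move=> s0; have [mi0|mi0] := eqVneq (m i) 0%N.
  rewrite mi0 mul0r big_seq big1 // => x xs; case: ifP => //.
  by rewrite leqn0 => /eqP x0; rewrite -x0 xs in s0.
have Um : (U_(i) <= m)%MM by rewrite lep1mP.
have := congr1 (mcoeff (m - U_(i))%MM) (mderiv_pprod i s0).
rewrite mcoeff_deriv submK // mnmBE mnm1E eqxx subn1 prednK ?lt0n // mulr_natl => ->.
rewrite raddf_sum !big_seq; apply: eq_bigr => x xs.
have x0 : (0 < x)%N by case: x xs => // h; rewrite h in s0.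
rewrite /= mcoeffZ mcoeff_mulXe mnmBE mnm1E eqxx.
have -> : (x.-1 <= m i - 1)%N = (x <= m i)%N by lia.
case: ifP => _; last by rewrite mulr0.
rewrite submDA; congr (_ * _@__); congr (_ - _)%MM.
apply/mnmP => j; rewrite mnmDE !mulmnE mnm1E; case: (i == j) => //.
by rewrite !mul1n add1n prednK.
Qed.

Lemma elemsym0 : elemsym 0 = 1.
Proof. by apply: symfunP => N /=; rewrite mesym0E. Qed.

Definition eprod N (nu : 'I_N -> nat) : symfun := \prod_(i < N) elemsym (nu i).

Lemma eq_eprod N (nu nu' : 'I_N -> nat) : nu =1 nu' -> eprod nu = eprod nu'.
Proof. by move=> h; apply: eq_bigr => i _; rewrite h. Qed.

(** Newton's identity for one factor e_(nu i) on the left, and the Euler operator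
    in the variable i on the right, give the same recursion on the degree of nu. *)
Lemma omega_form_eprod_pprod N (nu : 'X_{1..N}) s : 0%N \notin s ->
  omega_form (eprod nu) (pprod s) = (pprod s N)@_nu.
Proof.
have [d] := ubnP (mdeg nu); elim: d nu s => // d IH nu s ltd s0.
have [->|nu0] := eqVneq nu 0%MM.
  have -> : eprod (0%MM : 'X_{1..N}) = pprod [::].
    by rewrite /pprod big_nil /eprod big1 // => i _; rewrite mnm0E elemsym0.
  rewrite [in LHS](pprod_mkpart s0) pprod_mkpart // /omega_form diag_form_prod.
  case: s s0 => [|r s] s0.
    have e : parts (mkpart [::]) = [::] by [].
    by rewrite eqxx /omega_weight zpartE e !big_nil /zseq /= big_nil /pprod big_nil mcoeff1 eqxx mulr1.
  rewrite pprod_cons mcoeff_psumM big1 => [|j _]; last by rewrite mnm0E.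
  have -> : (mkpart [::] == mkpart (r :: s)) = false; last by rewrite mul0r.
  apply/negP => /eqP /(congr1 (fun l : intpart => sumn l)); rewrite !sumn_mkpart /=.
  by move: s0; rewrite inE negb_or; case: r.
have [i nui] : exists i, nu i != 0%N.
  apply/existsP; apply: contraNT nu0; rewrite negb_exists => /forallP h.
  by apply/eqP/mnmP => i; rewrite mnm0E; apply/eqP/negPn; exact: h.
apply: (@mulfI _ (nu i)%:R); first by rewrite pnatr_eq0.
rewrite mcoeff_pprod_euler // /omega_form -diag_formZl /eprod (bigD1 i) //= scalerAl newton.
rewrite mulr_suml diag_form_suml.
transitivity (\sum_(r < nu i) (count_mem r.+1 s)%:R *
   (r.+1%:R * (pprod (rem r.+1 s) N)@_(nu - U_(i) *+ r.+1)%MM)).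
  apply: eq_bigr => r _; rewrite -scalerAl diag_formZl -mulrA.
  have -> : elemsym (nu i - r.+1) * \prod_(j < N | j != i) elemsym (nu j)
     = eprod (nu - U_(i) *+ r.+1)%MM.
    rewrite /eprod [RHS](bigD1 i) //= mnmB_mulU eqxx; congr (_ * _).
    by apply: eq_bigr => j ne; rewrite mnmB_mulU (negPf ne).
  rewrite (omega_form_powersumM _ _ s0 : diag_form _ _ _ = _) !mulrA signM_id mul1r natrM IH.
  - by rewrite [_ * r.+1%:R]mulrC.
  - by rewrite mdegB_mulU // mdegE (bigD1 i) //= in ltd *; have := ltn_ord r; lia.
  - by apply: contra s0; exact: mem_rem.
pose F x := x%:R * (pprod (rem x s) N)@_(nu - U_(i) *+ x)%MM.
transitivity (\sum_(r < nu i) \sum_(x <- s) (x == r.+1)%:R * F r.+1).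
  apply: eq_bigr => r _; rewrite -mulr_suml -natr_sum; congr (_%:R * _).
  by elim: (s) => [|x t IHt]; rewrite ?big_nil ?big_cons /= ?IHt.
rewrite exchange_big /= !big_seq; apply: eq_bigr => x xs.
have x0 : (0 < x)%N by case: x xs => // h; rewrite h in s0.
case: leqP => hx; last first.
  rewrite big1 // => r _; have -> : (x == r.+1) = false by have := ltn_ord r; lia.
  by rewrite mul0r.
have hr : (x.-1 < nu i)%N by rewrite prednK.
rewrite (bigD1 (Ordinal hr)) //= prednK // eqxx mul1r big1 ?addr0 // => r ne.
have -> : (x == r.+1) = false; last by rewrite mul0r.
by apply: contraNF ne => /eqP e; apply/eqP/val_inj; rewrite /= e.
Qed.

(** The Cauchy identity for prod (1 + x_i y_j), coefficient by coefficient. *)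
Lemma omega_form_eprod N (nu : 'X_{1..N}) g : omega_form (eprod nu) g = (g N)@_nu.
Proof.
apply: (powersum_ind (H := fun g : symfun => omega_form (eprod nu) g = (g N)@_nu)) g.
- by rewrite /omega_form diag_form0r mcoeff0.
- by move=> c f g e1 e2; rewrite /omega_form diag_form_linr (e1 : diag_form _ _ _ = _) (e2 : diag_form _ _ _ = _) mcoeffD mcoeffZ.
by move=> l; rewrite powersum_prodE omega_form_eprod_pprod ?intpart0.
Qed.

(** The coefficient of x^j in (1 - x)^(-k), for k > 0. *)
Definition negbin (k j : nat) : rat := 'C(j + k.-1, j)%:R.

Lemma negbinS k j : (0 < k)%N -> (j.+1)%:R * negbin k j.+1 = (j + k)%:R * negbin k j.
Proof.
move=> k0; rewrite /negbin -!natrM; congr (_%:R).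
have -> : (j.+1 + k.-1 = (j + k.-1).+1)%N by [].
by rewrite -mul_bin_diag /= -addnS prednK.
Qed.

Lemma negbin_sum k j : (0 < k)%N ->
  k%:R * \sum_(r < j) negbin k (j - r.+1) = j%:R * negbin k j.
Proof.
move=> k0; rewrite [\sum_(r < j) _](_ : _ = \sum_(t < j) negbin k t); last first.
  by rewrite [RHS](reindex_inj rev_ord_inj).
elim: j => [|j IH]; first by rewrite big_ord0 mulr0 mul0r.
by rewrite big_ord_recr /= mulrDr IH negbinS // natrD mulrDl addrC.
Qed.

(** omega_k sends prod_j (1 + u y_j) to prod_i (1 - u x_i)^(-k): the coefficients
    of both satisfy the same recursion in terms of power sums. *)
Lemma omega_elemsym_coef k N a (m : 'X_{1..N}) : (0 < k)%N ->
  (omega k%:R (elemsym a) N)@_m = (mdeg m == a)%:R * \prod_(i < N) negbin k (m i).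
Proof.
move=> k0; have [d] := ubnP a; elim: d a m => // d IH a m lta.
case: a lta => [|a] lta.
  rewrite elemsym0 /omega pscale_mul1 sf_at1 mcoeff1 mdeg_eq0.
  case: eqP => [->|_]; last by rewrite mul0r.
  by rewrite big1 // => i _; rewrite mnm0E /negbin bin0.
apply: (@mulfI _ a.+1%:R); first by rewrite pnatr_eq0.
have -> : a.+1%:R * (omega k%:R (elemsym a.+1) N)@_m
   = (omega k%:R (a.+1%:R *: elemsym a.+1) N)@_m by rewrite /omega /pscale_mul pscaleZ mcoeffZ.
rewrite newton /omega /pscale_mul pscale_sum sf_at_sum raddf_sum.
transitivity (\sum_(r < a.+1) \sum_(j < N) if (r < m j)%N then
   k%:R * ((mdeg m == a.+1)%:R * (\prod_(i < N | i != j) negbin k (m i)) * negbin k (m j - r.+1)) else 0).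
  apply: eq_bigr => r _; rewrite pscaleZ -[pscale _ _]/(pscale_mul (fun i => (-1) ^+ i * k%:R) _) pscale_mulM pscale_mul_powersum.
  rewrite -scalerAl scalerA mulrA signM_id mul1r /= mcoeffZ (mcoeff_psumM _ r) mulr_sumr.
  apply: eq_bigr => j _; case: ifP => hr; last by rewrite mulr0.
  congr (_ * _); rewrite -[pscale_mul _ _]/(omega k%:R _) IH; last by lia.
  rewrite mdegB_mulU //; have hm : (m j <= mdeg m)%N by rewrite mdegE (bigD1 j) //= leq_addr.
  have -> : (mdeg m - r.+1 == a.+1 - r.+1)%N = (mdeg m == a.+1) by have := ltn_ord r; lia.
  rewrite (bigD1 j) //= mnmB_mulU eqxx -mulrA; congr (_ * _); rewrite mulrC; congr (_ * _).
  by apply: eq_bigr => i ne; rewrite mnmB_mulU (negPf ne).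
rewrite exchange_big /=; have [em|_] := eqVneq (mdeg m) a.+1; last first.
  by rewrite mul0r mulr0 big1 // => j _; rewrite big1 // => r _; case: ifP; rewrite ?mul0r ?mulr0.
rewrite mul1r -[in RHS]em mdegE natr_sum mulr_suml; apply: eq_bigr => j _.
have mja : (m j <= a.+1)%N by rewrite -em mdegE (bigD1 j) //= leq_addr.
rewrite -big_mkcond /= -(big_ord_widen a.+1 (fun r => k%:R *
   (1 * (\prod_(i < N | i != j) negbin k (m i)) * negbin k (m j - r.+1)))) //.
rewrite -mulr_sumr mul1r -mulr_sumr mulrCA negbin_sum // [in RHS](bigD1 j) //=; ring.
Qed.

(** * Dominance order and conjugation *)

Definition partsum (t : nat) (s : seq nat) := sumn (take t s).

Lemma partsumE t s : partsum t s = (\sum_(j < t) nth 0 s j)%N.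
Proof.
rewrite /partsum; elim: t s => [|t IH] [|x s]; rewrite ?big_ord0 //=.
  by rewrite big1 // => j _; rewrite nth_nil.
by rewrite big_ord_recl /= IH.
Qed.

Lemma partsum_all t s : (size s <= t)%N -> partsum t s = sumn s.
Proof. by move=> h; rewrite /partsum take_oversize. Qed.

Definition dom_le (mu lam : intpart) : Prop :=
  sumn mu = sumn lam /\ forall i, (partsum i mu <= partsum i lam)%N.

Lemma dom_ltE mu lam : dom_lt mu lam <-> mu <> lam /\ dom_le mu lam.
Proof. by split=> [[h1 h2 h3]|[h1 [h2 h3]]]. Qed.

Lemma dom_le_refl l : dom_le l l. Proof. by []. Qed.
Lemma dom_le_trans m l n : dom_le l m -> dom_le m n -> dom_le l n.
Proof. by move=> [e1 h1] [e2 h2]; split=> [|i]; [rewrite e1|apply: leq_trans (h1 i) _]. Qed.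

Lemma intpart_nth (l m : intpart) : (forall i, nth 0%N l i = nth 0%N m i) -> l = m.
Proof.
move=> h; apply: intpart_inj.
suff sz : size l = size m by apply: (@eq_from_nth _ 0%N) => // i _; exact: h.
suff H (a b : intpart) : (forall i, nth 0%N a i = nth 0%N b i) -> (size a <= size b)%N.
  by apply/eqP; rewrite eqn_leq !H.
move=> {}h; case: (ltnP (size b) (size a)) => // lt.
have := intpart_pos (mem_nth 0%N lt).
by rewrite h nth_default.
Qed.

Lemma nth_partsum t s : nth 0%N s t = (partsum t.+1 s - partsum t s)%N.
Proof. by rewrite !partsumE big_ord_recr /= addKn. Qed.

Lemma partsum_inj (l m : intpart) : (forall t, partsum t l = partsum t m) -> l = m.
Proof. by move=> h; apply: intpart_nth => i; rewrite !nth_partsum !h. Qed.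

Lemma dom_le_anti l m : dom_le l m -> dom_le m l -> l = m.
Proof.
move=> [_ h1] [_ h2]; apply: partsum_inj => t; apply/eqP.
by rewrite eqn_leq h1 h2.
Qed.

(** A strictly increasing function of the dominance order, for induction. *)
Definition dom_height (l : intpart) := (\sum_(t < sumn l) partsum t l)%N.

Lemma dom_height_lt mu lam : dom_lt mu lam -> (dom_height mu < dom_height lam)%N.
Proof.
move=> /dom_ltE [ne [e h]]; rewrite /dom_height e.
have le : (\sum_(t < sumn lam) partsum t mu <= \sum_(t < sumn lam) partsum t lam)%N.
  by apply: leq_sum => t _; exact: h.
rewrite ltn_neqAle le andbT; apply/eqP => eqs; case: ne; apply: partsum_inj => t.
have [lt|ge] := ltnP t (sumn lam); last first.
  by rewrite !partsum_all // (leq_trans (size_le_sumn _)) // e.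
apply/eqP; rewrite eqn_leq h /= leqNgt; apply/negP => lt'.
move: eqs; rewrite (bigD1 (Ordinal lt)) //= [RHS](bigD1 (Ordinal lt)) //= => eqs.
have : (\sum_(i < sumn lam | i != Ordinal lt) partsum i mu
  <= \sum_(i < sumn lam | i != Ordinal lt) partsum i lam)%N by apply: leq_sum => i _; exact: h.
by move=> h2; have := leq_add lt' h2; rewrite addSn eqs ltnn.
Qed.

Lemma dom_ind (H : intpart -> Prop) :
  (forall l, (forall m, dom_lt m l -> H m) -> H l) -> forall l, H l.
Proof.
move=> IH l; have [d] := ubnP (dom_height l); elim: d l => // d IHd l lt.
by apply: IH => m /dom_height_lt h; apply: IHd; apply: leq_trans h _.
Qed.

(** Equivalently, conjugation transposes the diagram. *)
Lemma count_gt_nth (l : intpart) i j :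
  (j < count (fun x => i < x)%N l)%N = (i < nth 0%N l j)%N.
Proof.
have := intpart_sorted l; elim: (parts l) j => [|x s IH] j srt; first by rewrite nth_nil.
have srt' : sorted geq s by apply: path_sorted srt.
have hx : {in s, forall y, (y <= x)%N}.
  by move=> y ys; have := order_path_min geq_trans srt => /allP /(_ _ ys).
case: j => [|j] /=.
  case: (boolP (i < x)%N) => // ix; rewrite add0n -has_count; apply/negbTE/hasPn => y /hx h.
  by rewrite -leqNgt; apply: leq_trans h _; rewrite leqNgt.
case: (boolP (i < x)%N) => ix; first by rewrite add1n ltnS IH.
rewrite add0n; apply/idP/idP => h; last first.
  case: (ltnP j (size s)) => hj; last by rewrite nth_default in h.
  by rewrite (leq_trans h (hx _ (mem_nth 0%N hj))) in ix.
have : has (fun y => i < y)%N s by rewrite has_count; apply: leq_ltn_trans h.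
by case/hasP => y /hx h1 h2; rewrite (leq_trans h2 h1) in ix.
Qed.

Lemma nth_le_head (l : intpart) j : (nth 0%N l j <= head 0%N l)%N.
Proof.
rewrite -nth0 leqNgt; apply/negP => lt; have := count_gt_nth l (nth 0 l 0) j.
by rewrite lt => h; have := leq_ltn_trans (leq0n _) h; rewrite count_gt_nth ltnn.
Qed.

Lemma nth_conj (l : intpart) j :
  nth 0%N (conj_intpart l) j = count (fun x => j < x)%N l.
Proof.
rewrite /= /conj_parts; case: (ltnP j (head 0%N l)) => h.
  by rewrite nth_mkseq.
rewrite nth_default ?size_mkseq //; apply/esym/eqP; rewrite -leqn0 leqNgt count_gt_nth.
by rewrite -leqNgt nth0.
Qed.

Lemma partsum_conj (l : intpart) t :
  partsum t (conj_intpart l) = (\sum_(x <- l) minn x t)%N.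
Proof.
elim: t => [|t IH]; first by rewrite /partsum take0 big1 // => x _; rewrite minn0.
rewrite partsumE big_ord_recr /= -partsumE IH nth_conj -sum1_count [X in (_ + X)%N]big_mkcond -big_split /=.
by apply: eq_bigr => x _; case: ltnP; lia.
Qed.

Lemma sumn_conj (l : intpart) : sumn (conj_intpart l) = sumn l.
Proof.
set t := (sumn l + size (conj_intpart l))%N.
rewrite -(@partsum_all t) ?leq_addl // partsum_conj sumnE !big_seq.
apply: eq_bigr => x xl; apply/minn_idPl; apply: leq_trans (leq_addr _ _).
by rewrite sumnE (big_rem x) //= leq_addr.
Qed.

Lemma conj_intpartK : involutive conj_intpart.
Proof.
move=> l; apply: intpart_nth => j; rewrite nth_conj /= /conj_parts count_map.
rewrite (@eq_count _ _ (fun i => i < nth 0%N l j)%N); last by move=> i /=; exact: count_gt_nth.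
elim: (head 0%N l) (nth_le_head l j) => [|h IH]; first by rewrite leqn0 => /eqP ->.
rewrite -[in count _ _]addn1 iotaD count_cat /= add0n addn0 => le.
case: ltnP => hj; last by rewrite addn0 IH.
have e : nth 0%N l j = h.+1 by apply/eqP; rewrite eqn_leq le hj.
rewrite e (@eq_in_count _ _ predT) ?count_predT ?size_iota ?addn1 // => i.
by rewrite mem_iota add0n => /andP [_ hi]; rewrite ltnS ltnW.
Qed.

Lemma sum_minn_le (s : seq nat) t i :
  (\sum_(x <- s) minn x t + partsum i s <= t * i + sumn s)%N.
Proof.
have e1 : (\sum_(x <- s) minn x t = \sum_(x <- take i s) minn x t + \sum_(x <- drop i s) minn x t)%N.
  by rewrite -big_cat cat_take_drop.
have e2 : sumn s = (sumn (take i s) + sumn (drop i s))%N by rewrite -sumn_cat cat_take_drop.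
rewrite e1 e2 /partsum.
have h1 : (\sum_(x <- take i s) minn x t <= t * i)%N.
  apply: (@leq_trans (\sum_(x <- take i s) t)%N); first by apply: leq_sum => x _; exact: geq_minr.
  by rewrite big_const_seq count_predT iter_addn_0 leq_mul2l size_take_min geq_minl orbT.
have h2 : (\sum_(x <- drop i s) minn x t <= sumn (drop i s))%N.
  by rewrite sumnE; apply: leq_sum => x _; exact: geq_minl.
by lia.
Qed.

(** The equality case of sum_minn_le. Together they express the partial sum of
    length t of the conjugate as the minimum over i of t i plus the sum of the
    parts after the i-th, which shows that conjugation reverses dominance. *)
Lemma sum_minn_eq (l : intpart) t (i := count (fun x => t < x)%N l) :
  (\sum_(x <- l) minn x t + partsum i l = t * i + sumn l)%N.
Proof.
have := intpart_sorted l; rewrite {}/i; elim: (parts l) => [|x s IH] srt.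
  by rewrite big_nil muln0.
have srt' : sorted geq s by apply: path_sorted srt.
have hx : {in s, forall y, (y <= x)%N}.
  by move=> y ys; have := order_path_min geq_trans srt => /allP /(_ _ ys).
rewrite big_cons /=; case: ltnP => ht /=.
  by have := IH srt'; rewrite add1n /partsum /= mulnS; lia.
have c0 : count (fun x0 : nat => (t < x0)%N) s = 0%N.
  apply/eqP; rewrite -leqn0 leqNgt -has_count; apply/hasPn => y /hx h.
  by rewrite -leqNgt (leq_trans h).
by have := IH srt'; rewrite c0 /partsum !take0 /=; lia.
Qed.

Lemma dom_le_conj l m : dom_le l m -> dom_le (conj_intpart m) (conj_intpart l).
Proof.
move=> [e h]; split=> [|t]; first by rewrite !sumn_conj.
rewrite !partsum_conj.
have := sum_minn_le m t (count (fun x => t < x)%N l).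
have := sum_minn_eq l t; have := h (count (fun x => t < x)%N l).
by rewrite e; lia.
Qed.

Lemma dom_lt_conj l m : dom_lt l m -> dom_lt (conj_intpart m) (conj_intpart l).
Proof.
move=> /dom_ltE [ne h]; apply/dom_ltE; split; last exact: dom_le_conj.
by move=> /(inv_inj conj_intpartK) e; apply: ne.
Qed.

Definition eseq (s : seq nat) : symfun := \prod_(x <- s) elemsym x.

Lemma eseq_eprod s N : (size s <= N)%N -> eseq s = eprod (fun i : 'I_N => nth 0%N s i).
Proof.
move=> h; rewrite /eprod -(big_mkord xpredT (fun i => elemsym (nth 0%N s i))).
rewrite (big_cat_nat _ h) //= [X in _ * X]big1_seq ?mulr1.
  by rewrite /eseq (big_nth 0%N).
by move=> i; rewrite mem_index_iota => /andP [_ /andP [le _]]; rewrite nth_default // elemsym0.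
Qed.

Lemma omega_form_eseq (l : intpart) g : omega_form (eseq l) g = sf_coef g l.
Proof.
rewrite (eseq_eprod (leqnn _)) /sf_coef -omega_form_eprod; congr (omega_form _ _).
by apply: eq_eprod => i; rewrite mnmE.
Qed.

(** A monomial of e_x consists of x distinct variables, and at most t of them are
    among the first t. *)
Lemma eseq_supp s N (m : 'X_{1..N}) : (eseq s N)@_m != 0 ->
  mdeg m = sumn s /\ forall t, (\sum_(j < N | j < t) m j <= \sum_(x <- s) minn x t)%N.
Proof.
elim: s m => [|x s IH] m.
  rewrite /eseq big_nil mcoeff1; have [->|] := eqVneq m 0%MM; last by rewrite eqxx.
  by rewrite mdeg0; split=> // t; rewrite big1 // => j _; rewrite mnm0E.
rewrite /eseq big_cons sf_atM -mcoeff_msupp => /msuppM_le /allpairsP [[m1 m2] /= [h1 h2 ->]].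
move: h1; rewrite mem_msupp_mesym => /andP [/eqP d1 /forallP le1].
move: h2; rewrite mcoeff_msupp => /IH [d2 le2].
rewrite mdegD d1 d2; split=> // t; rewrite big_cons.
under eq_bigr do rewrite mnmDE; rewrite big_split /=.
apply: leq_add; last exact: le2.
rewrite leq_min; apply/andP; split.
  by rewrite -d1 mdegE [leqRHS](bigID (fun j : 'I_N => (j < t)%N)) /= leq_addr.
apply: (@leq_trans (\sum_(j < N | (j < t)%N) 1)%N); first by apply: leq_sum => j _; exact: le1.
rewrite -(big_mkord (fun j => j < t)%N (fun=> 1%N)) sum1_count.
have -> : count (fun j => j < t)%N (index_iota 0 N) = size [seq j <- index_iota 0 N | (j < t)%N].
  by rewrite size_filter.
rewrite -[leqRHS](size_iota 0 t); apply: uniq_leq_size.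
  by rewrite filter_uniq ?iota_uniq.
by move=> j; rewrite mem_filter mem_iota => /andP [] /=.
Qed.

Lemma sf_coef_eseq_conj_supp (k s : intpart) :
  sf_coef (eseq (conj_intpart k)) s != 0 -> dom_le s k.
Proof.
move=> h; split; first by have [] := eseq_supp h; rewrite mdeg_mnm_seq // sumn_conj.
move=> t; rewrite -[k]conj_intpartK partsum_conj.
have [_ /(_ t)] := eseq_supp h; apply: leq_trans; rewrite partsumE.
under [leqRHS]eq_bigr do rewrite mnmE.
rewrite -(big_mkord (fun j => j < t)%N (fun j => nth 0%N s j)) -(big_mkord xpredT (fun j => nth 0%N s j)).
rewrite [leqRHS]big_mkcond.
have [le|/ltnW le] := leqP t (size s).
  rewrite (big_cat_nat _ le) //=; apply: leq_trans (leq_addr _ _).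
  by rewrite !big_seq; apply: leq_sum => j; rewrite mem_index_iota => /andP [_ ->].
rewrite (big_cat_nat _ le) //= [X in (_ + X)%N]big1_seq ?addn0.
  by rewrite !big_seq; apply: leq_sum => j; rewrite mem_index_iota => /andP [_ h']; rewrite (leq_trans h').
by move=> j; rewrite mem_index_iota => /andP [_ /andP [h' _]]; rewrite nth_default.
Qed.

(** The leading monomials of the factors multiply to x^k. *)
Lemma sf_coef_eseq_conj_diag (k : intpart) : sf_coef (eseq (conj_intpart k)) k = 1.
Proof.
rewrite /sf_coef /eseq sf_at_prod.
have le x : x \in parts (conj_intpart k) -> (x <= size k)%N.
  by move=> /mapP [j _ ->]; exact: count_size.
have -> : mnm_seq (size k) k
    = (\sum_(x <- conj_intpart k) mlead (mesym (size k) rat x))%MM.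
  apply/mnmP => i; rewrite mnmE mnm_sumE !big_seq.
  under eq_bigr => x /le hx do rewrite mlead_mesym // mnmE.
  have e := nth_conj (conj_intpart k) i; rewrite conj_intpartK in e.
  rewrite -big_seq e -sum1_count big_mkcond.
  by apply: eq_bigr => x _; case: ltnP.
rewrite mleadc_prod big_seq big1 // => x /le hx.
by rewrite mleadc_mesym.
Qed.

(** The products e_(k') are unitriangular on monomial functions for dominance;
    this is the inverse triangularity. *)
Lemma monomial_sub_eseq_ind (H : symfun -> Prop) k :
  H 0 -> (forall c g h, H g -> H h -> H (c *: g + h)) ->
  (forall t, dom_lt t k -> H (eseq (conj_intpart t))) ->
  H (monomialsym k - eseq (conj_intpart k)).
Proof.
move=> H0 HL; elim/dom_ind: k => k IH He; apply: monomial_ind => // s.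
rewrite sf_coefB sf_coef_monomial; have [->|ne] := eqVneq s k.
  by rewrite sf_coef_eseq_conj_diag subrr eqxx.
rewrite sub0r oppr_eq0 => /sf_coef_eseq_conj_supp le.
have lt : dom_lt s k by apply/dom_ltE; split=> //; apply/eqP.
rewrite -[monomialsym s](subrK (eseq (conj_intpart s))) -[X in X + _]scale1r.
apply: (HL); last exact: He.
apply: IH => // t /dom_ltE [ne' le']; apply: He; apply/dom_ltE; split.
  by move=> e; apply: ne'; apply: dom_le_anti le' _; rewrite e.
exact: dom_le_trans le.
Qed.

Lemma monomial_eseq_ind (H : symfun -> Prop) k :
  H 0 -> (forall c g h, H g -> H h -> H (c *: g + h)) ->
  (forall t, dom_le t k -> H (eseq (conj_intpart t))) -> H (monomialsym k).
Proof.
move=> H0 HL He.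
rewrite -[monomialsym k](subrK (eseq (conj_intpart k))) -[X in X + _]scale1r.
apply: (HL); last by apply: He; exact: dom_le_refl.
by apply: monomial_sub_eseq_ind => // t /dom_ltE [_]; exact: He.
Qed.

(** * Jack functions and their duality *)

Lemma sf_coef_fsum (A : set intpart) (F : intpart -> symfun) s :
  (forall x, A x -> sf_coef (F x) s = 0) -> sf_coef (\sum_(x \in A) F x) s = 0.
Proof.
move=> h; rewrite sf_coef_sum big_seq big1 // => x; case: finite_supportP => // X XA _ _.
by move=> /XA; exact: h.
Qed.

Section Jack.
Variables (a : rat) (P : intpart -> symfun) (P_jack : is_jack a P).

Lemma jack_coef_diag l : sf_coef (P l) l = 1.
Proof.
have [u ->] := P_jack.1 l; rewrite sf_coefD sf_coef_monomial eqxx sf_coef_fsum ?addr0 // => x [ne _ _].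
by rewrite sf_coefZ sf_coef_monomial; case: eqP => [e|_]; rewrite ?mulr0 //; case: ne.
Qed.

Lemma jack_coef_supp l s : sf_coef (P l) s != 0 -> dom_le s l.
Proof.
have [u ->] := P_jack.1 l; rewrite sf_coefD sf_coef_monomial; have [-> _|ne] := eqVneq s l; first by [].
rewrite add0r => h; apply: contrapT => nle; move: h; rewrite sf_coef_fsum ?eqxx // => x.
move=> /= /dom_ltE [_ le]; rewrite sf_coefZ sf_coef_monomial; case: eqP => [e|_]; rewrite ?mulr0 //.
by case: nle; rewrite e.
Qed.

Lemma jack_orth l m : l <> m -> jack_scalar a (P l) (P m) = 0.
Proof. exact: P_jack.2. Qed.

(** The inverse of the triangular expansion of Jack functions on monomials. *)
Lemma monomial_jack_ind (H : symfun -> Prop) k :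
  H 0 -> (forall c g h, H g -> H h -> H (c *: g + h)) ->
  (forall t, dom_le t k -> H (P t)) -> H (monomialsym k).
Proof.
move=> H0 HL; elim/dom_ind: k => k IH HP.
rewrite -[monomialsym k](subrK (P k)) -[X in X + _]scale1r.
apply: (HL); last by apply: HP; exact: dom_le_refl.
apply: monomial_ind => // s; rewrite sf_coefB sf_coef_monomial; have [->|ne] := eqVneq s k.
  by rewrite jack_coef_diag subrr eqxx.
rewrite sub0r oppr_eq0 => /jack_coef_supp le; apply: IH.
  by apply/dom_ltE; split=> //; apply/eqP.
by move=> t h; apply: HP; exact: dom_le_trans le.
Qed.

Lemma jack_ind (H : symfun -> Prop) :
  H 0 -> (forall c g h, H g -> H h -> H (c *: g + h)) ->
  (forall t, H (P t)) -> forall f, H f.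
Proof.
by move=> H0 HL HP f; apply: monomial_ind => // s _; apply: monomial_jack_ind.
Qed.

Lemma jack_nondeg f : a != 0 -> (forall t, jack_scalar a f (P t) = 0) -> f = 0.
Proof.
move=> a0 h; apply: (@diag_form_nondeg (fun l => (zpart l)%:R * a ^+ size l)).
  by move=> l; rewrite mulf_neq0 ?zpart_neq0 ?expf_neq0.
move=> g; apply: (jack_ind (H := fun g => diag_form _ f g = 0)) g.
- exact: diag_form0r.
- by move=> c g g' e1 e2; rewrite diag_form_linr e1 e2 mulr0 addr0.
- exact: h.
Qed.

End Jack.

Section Duality.
Variables (k : rat) (P P' Q' : intpart -> symfun).
Hypotheses (k0 : k != 0) (P_jack : is_jack k P) (P'_jack : is_jack k^-1 P')
  (Q'_dual : is_dual k^-1 P' Q').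

Let omega_form_subspace l :
  let H := fun f => omega_form f (P l) = 0 in
  H 0 /\ (forall c g h, H g -> H h -> H (c *: g + h)).
Proof.
move=> H; split; first exact: diag_form0l.
by move=> c g h e1 e2; rewrite /H /omega_form diag_form_linl (e1 : diag_form _ _ _ = _) (e2 : diag_form _ _ _ = _) mulr0 addr0.
Qed.

Let omega_form_eseq_supp l t :
  omega_form (eseq (conj_intpart t)) (P l) != 0 -> dom_le (conj_intpart t) l.
Proof. by rewrite omega_form_eseq => /(jack_coef_supp P_jack). Qed.

(** Expand P' m in products e_(t') with t below m, pair each with P l by
    omega_form_eseq, and use that conjugation reverses dominance. *)
Lemma omega_form_jack_supp m l : omega_form (P' m) (P l) != 0 -> dom_le (conj_intpart m) l.
Proof.
move=> h; apply: contrapT => nle; move/eqP: h; apply.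
have [H0 HL] := omega_form_subspace l.
apply: (@monomial_ind (fun f => omega_form f (P l) = 0)) => // s /(jack_coef_supp P'_jack) le_sm.
apply: (@monomial_eseq_ind (fun f => omega_form f (P l) = 0)) => // t le_ts.
apply: contrapT => /eqP /omega_form_eseq_supp le; apply: nle; apply: dom_le_trans le.
by apply: dom_le_conj; exact: dom_le_trans le_sm.
Qed.

(** In the expansion of P' (conj l) in products e_(t'), only the leading one, with
    t' = l, is paired nontrivially with P l. *)
Lemma omega_form_jack_diag l : omega_form (P' (conj_intpart l)) (P l) = 1.
Proof.
set m := conj_intpart l.
have [H0 HL] := omega_form_subspace l.
have He t : dom_lt t m -> omega_form (eseq (conj_intpart t)) (P l) = 0.
  move=> /dom_lt_conj; rewrite conj_intpartK => /dom_ltE [ne le].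
  by apply: contrapT => /eqP /omega_form_eseq_supp le'; apply: ne; exact: dom_le_anti.
have h1 : omega_form (monomialsym m - eseq (conj_intpart m)) (P l) = 0.
  by apply: (@monomial_sub_eseq_ind (fun f => omega_form f (P l) = 0)).
have h2 : omega_form (P' m - monomialsym m) (P l) = 0.
  apply: (@monomial_ind (fun f => omega_form f (P l) = 0)) => // s; rewrite sf_coefB sf_coef_monomial.
  have [->|ne] := eqVneq s m; first by rewrite (jack_coef_diag P'_jack) subrr eqxx.
  rewrite subr0 => /(jack_coef_supp P'_jack) le.
  apply: (@monomial_eseq_ind (fun f => omega_form f (P l) = 0)) => // t le_ts; apply: He.
  apply/dom_ltE; split; last exact: dom_le_trans le.
  by move=> e; move/eqP: ne; apply; apply: dom_le_anti; rewrite // -e.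
have -> : P' m = (P' m - monomialsym m) + ((monomialsym m - eseq (conj_intpart m)) + eseq (conj_intpart m)).
  by rewrite !subrK.
rewrite /omega_form diag_formDl (h2 : diag_form _ _ _ = _) diag_formDl (h1 : diag_form _ _ _ = _) !add0r.
by rewrite -/(omega_form _ _) (omega_form_eseq (conj_intpart m)) conj_intpartK (jack_coef_diag P_jack).
Qed.

Lemma dual_jack_uniq f m : (forall t, jack_scalar k^-1 (P' t) f = (t == m)%:R) -> f = Q' m.
Proof.
move=> h; apply/eqP; rewrite -subr_eq0; apply/eqP; apply: (jack_nondeg P'_jack).
  by rewrite invr_eq0.
move=> t; rewrite jack_scalarE diag_formC diag_formDr -scaleN1r diag_formZr -jack_scalarE h.
by rewrite -jack_scalarE Q'_dual mulN1r subrr.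
Qed.

(** The functions omega_k (P l) are orthogonal for the parameter 1/k, and by
    omega_form_jack_supp and omega_form_jack_diag they are unitriangular with
    respect to the duals of the P'. A triangular transition between two
    orthogonal bases is diagonal. *)
Lemma jack_duality l : omega k (P l) = Q' (conj_intpart l).
Proof.
elim/dom_ind: l => l IH; apply: dual_jack_uniq => m; rewrite jack_omega_form_inv //.
have [->|ne] := eqVneq m (conj_intpart l); first exact: omega_form_jack_diag.
apply: contrapT => /eqP h; have le := omega_form_jack_supp h.
have lt : dom_lt (conj_intpart m) l.
  by apply/dom_ltE; split=> // e; rewrite -e conj_intpartK eqxx in ne.
have eQ := IH _ lt; rewrite conj_intpartK in eQ.
set c := jack_scalar k^-1 (P' m) (P' m).
have eP : P' m = c *: Q' m.
  apply/eqP; rewrite -subr_eq0; apply/eqP; apply: (jack_nondeg P'_jack); first by rewrite invr_eq0.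
  move=> t; rewrite jack_scalarE diag_formC diag_formDr -scaleN1r !diag_formZr -!jack_scalarE Q'_dual.
  have [->|net] := eqVneq t m; first by rewrite mulr1 mulN1r subrr.
  by rewrite jack_orth ?mulr0 ?addr0 //; apply/eqP.
have : omega_form (P' m) (P l) = 0.
  rewrite -(jack_omega_form_inv _ _ k0) eP -eQ jack_scalarE diag_formZl -jack_scalarE jack_omega //.
  by rewrite (jack_orth P_jack) ?mulr0 //; have [] := (dom_ltE (conj_intpart m) l).1 lt.
by move/eqP: h.
Qed.

End Duality.

(** * Partial fractions in one variable *)

Definition eq_upto (K : nat) (p q : {poly rat}) := forall j, (j <= K)%N -> p`_j = q`_j.

Lemma eq_uptoM K p q p' q' : eq_upto K p q -> eq_upto K p' q' -> eq_upto K (p * p') (q * q').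
Proof.
move=> h h' j hj; rewrite !coefM; apply: eq_bigr => i _.
by rewrite h ?h' //; have := ltn_ord i; lia.
Qed.

Lemma eq_upto_prod K (I : Type) (r : seq I) P (F : I -> {poly rat}) :
  (forall i, eq_upto K (F i) 1) -> eq_upto K (\prod_(i <- r | P i) F i) 1.
Proof.
move=> h; elim/big_rec: _ => // i x _ hx; rewrite -[1]mulr1; exact: eq_uptoM.
Qed.

(** The series (1 - u X)^(-k) up to degree K. *)
Definition negpow (K k : nat) (u : rat) : {poly rat} :=
  \poly_(j < K.+1) (negbin k j * u ^+ j).

Lemma negpow_mul K k u : (0 < k)%N -> eq_upto K (negpow K k u * (1 - u *: 'X) ^+ k) 1.
Proof.
case: k => // k _; elim: k => [|k IH] j hj.
  rewrite expr1 mulrBr mulr1 -scalerAr coefB coefZ coefMX !coef_poly ltnS hj coef1.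
  case: j hj => [|j] hj; first by rewrite mulr0 subr0 expr0 mulr1 /negbin bin0.
  by rewrite /= ltnS ltnW // /negbin !addn0 !binn !mul1r exprS subrr.
rewrite exprS mulrA; have {}IH := IH j hj; rewrite -{}IH.
suff e : eq_upto K (negpow K k.+2 u * (1 - u *: 'X)) (negpow K k.+1 u).
  by apply: eq_uptoM e _ _ hj => i.
move=> i hi; rewrite mulrBr mulr1 -scalerAr coefB coefZ coefMX !coef_poly ltnS hi.
case: i hi => [|i] hi; first by rewrite mulr0 subr0 /negbin !bin0.
rewrite /= ltnS ltnW // /negbin /= addSn binS natrD addSn exprS -addnS; ring.
Qed.

Section Partial.
Variables (k r K M : nat) (u : nat -> rat).
Hypotheses (k0 : (0 < k)%N) (u0 : forall a, u a != 0)
  (u_inj : injective u) (leMK : (M <= K)%N).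

Let w a : {poly rat} := (1 - u a *: 'X) ^+ k.
Let W r := \prod_(a < r) w a.

Lemma w_coprime a b : a != b -> coprimep (w a) (w b).
Proof.
move=> ne; apply/coprimep_expl/coprimep_expr/Bezout_eq1_coprimepP.
have h : u b - u a != 0.
  by rewrite subr_eq0; apply: contra ne => /eqP /u_inj ->.
exists (((u b - u a)^-1 * u b)%:P, (- ((u b - u a)^-1 * u a))%:P) => /=.
rewrite -!mul_polyC !(polyCM, polyCN).
have e : (u b - u a)^-1%:P * ((u b)%:P - (u a)%:P) = 1.
  by rewrite -polyCB -polyCM mulVf.
by rewrite -[RHS]e; ring.
Qed.

(** The idempotents of the Chinese remainder theorem modulo W r. *)
Lemma partial_units : exists c : nat -> {poly rat},
  (forall a, (a < r)%N -> W r %| c a * w a) /\ W r %| \sum_(a < r) c a - 1.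
Proof.
elim: r => [|s [c [h1 h2]]].
  by exists (fun=> 0); split=> //; rewrite /W big_ord0 dvd1p.
have cop : coprimep (W s) (w s).
  rewrite /W; elim/big_ind: _ => [|x y|a _]; first exact: coprime1p.
    by move=> hx hy; rewrite coprimepMl hx hy.
  by apply: w_coprime; rewrite neq_ltn ltn_ord.
have /Bezout_eq1_coprimepP [[x y] /= e] := cop.
exists (fun a => if (a < s)%N then c a * (y * w s) else x * W s).
have WS : W s.+1 = W s * w s by rewrite /W big_ord_recr.
split=> [a|].
  rewrite ltnS leq_eqVlt => /predU1P [->|lt]; first by rewrite ltnn WS -mulrA dvdp_mull.
  rewrite lt WS mulrAC [y * _]mulrC mulrA -[_ * y]mulrC dvdp_mull //.
  by apply: dvdp_mul => //; exact: h1.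
rewrite WS big_ord_recr /= ltnn.
under eq_bigr => a _ do rewrite ltn_ord.
rewrite -mulr_suml.
have -> : (\sum_(a < s) c a) * (y * w s) + x * W s - 1
   = y * ((\sum_(a < s) c a - 1) * w s).
  have -> : x * W s = 1 - y * w s by rewrite -e addrK.
  by ring.
by rewrite dvdp_mull // dvdp_mul.
Qed.

Let S := \prod_(a < r) negpow K k (u a).
(** The coefficient of X^M in g / W r, the inverse of W r being truncated. *)
Definition quot_coef (g : {poly rat}) : rat := (S * g)`_M.

Lemma size_w a : size (w a) = k.+1.
Proof.
have sz : size (1 - u a *: 'X : {poly rat}) = 2%N.
  rewrite addrC -scaleNr -mul_polyC mulrC -['X * _ + _]/('X * _ + 1%:P) mulrC.
  rewrite size_MXaddC polyC_eq0 oppr_eq0 (negPf (u0 a)) /=.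
  by rewrite size_polyC oppr_eq0 u0.
have nz : 1 - u a *: 'X != 0 :> {poly rat} by rewrite -size_poly_gt0 sz.
by rewrite -[size _]prednK ?size_poly_gt0 ?expf_neq0 // size_exp sz mul1n.
Qed.

Lemma size_W : size (W r) = (r * k).+1.
Proof.
rewrite /W size_prod => [|a _]; last by rewrite -size_poly_gt0 size_w.
under eq_bigr do rewrite size_w.
rewrite sum_nat_const card_ord mulnS -addnS addnC addnK //.
Qed.

Lemma quot_coef_lin c g h : quot_coef (c *: g + h) = c * quot_coef g + quot_coef h.
Proof. by rewrite /quot_coef mulrDr -scalerAr coefD coefZ. Qed.

Lemma quot_coef0 : quot_coef 0 = 0. Proof. by rewrite /quot_coef mulr0 coef0. Qed.

Lemma quot_coef_mulW g : quot_coef (g * W r) = g`_M.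
Proof.
have h : eq_upto K (S * W r) 1.
  by rewrite /S /W -big_split; apply: eq_upto_prod => a; exact: negpow_mul.
rewrite /quot_coef mulrCA.
have := eq_uptoM (fun j _ => erefl g`_j) h leMK.
by rewrite mulr1.
Qed.

Lemma quot_coef_mod (g : {poly rat}) :
  (size g <= M + r * k)%N -> quot_coef (g %% W r) = quot_coef g.
Proof.
move=> sz; rewrite {2}(divp_eq g (W r)) -[_ * W r]scale1r quot_coef_lin mul1r quot_coef_mulW.
rewrite nth_default ?add0r // size_divp; first by rewrite size_W /= leq_subLR addnC.
by rewrite -size_poly_gt0 size_W.
Qed.

Lemma quot_coef_sum (I : Type) (s : seq I) Q (F : I -> {poly rat}) :
  quot_coef (\sum_(i <- s | Q i) F i) = \sum_(i <- s | Q i) quot_coef (F i).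
Proof.
by elim/big_rec2: _ => [|i x y _ <-]; rewrite ?quot_coef0 // -[F i]scale1r quot_coef_lin mul1r scale1r.
Qed.

(** Below degree M + r k there is no contribution from infinity: the coefficient
    depends on g modulo W r only, and by the Chinese remainder theorem it is a
    sum of functionals depending on g modulo each w a, that is, on the jet of
    order k of g at 1 / u a. *)
Lemma quot_coef_split : exists psi : nat -> {poly rat} -> rat,
  [/\ forall a c g h, psi a (c *: g + h) = c * psi a g + psi a h,
      forall a g, (a < r)%N -> psi a (g * w a) = 0 &
      forall g : {poly rat}, (size g <= M + r * k)%N -> quot_coef g = \sum_(a < r) psi a g].
Proof.
have [c [h1 h2]] := partial_units.
exists (fun a g => quot_coef ((g * c a) %% W r)); split=> [a d g h|a g ar|g sz].
- by rewrite mulrDl -scalerAl modpD modpZl quot_coef_lin.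
- rewrite -mulrA [w a * _]mulrC; have /modp_eq0P -> : W r %| g * (c a * w a).
    by rewrite dvdp_mull // h1.
  exact: quot_coef0.
rewrite -quot_coef_sum -(big_morph (fun g => g %% W r) (fun g h => modpD _ g h) (mod0p _)).
rewrite -mulr_sumr -(quot_coef_mod sz); congr quot_coef.
apply/eqP; rewrite -subr_eq0 -modpN -modpD -{1}[g]mulr1 -mulrBr; apply/eqP/modp_eq0P.
by rewrite dvdp_mull // -dvdpNr opprB.
Qed.

End Partial.

(** * Tensor products of linear functionals *)

Section LinExt.
Variable N : nat.
Implicit Types (tau : 'X_{1..N} -> rat) (Z : {mpoly rat[N]}).

Definition lin_ext tau Z := \sum_(m <- msupp Z) Z@_m * tau m.

Lemma lin_ext_bounded tau Z K : (msize Z <= K)%N ->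
  lin_ext tau Z = \sum_(m : 'X_{1..N < K}) Z@_m * tau m.
Proof.
move=> lt_pk; pose I : subFinType _ := 'X_{1..N < K}.
rewrite /lin_ext (big_mksub I) //=; first last.
- by move=> x /msize_mdeg_lt /leq_trans; apply.
- by rewrite msupp_uniq.
by rewrite big_rmcond //= => i; move/memN_msupp_eq0 ->; rewrite mul0r.
Qed.

Lemma lin_ext_lin tau c Y Z : lin_ext tau (c *: Y + Z) = c * lin_ext tau Y + lin_ext tau Z.
Proof.
pose K := maxn (msize (c *: Y + Z)) (maxn (msize Y) (msize Z)).
rewrite !(@lin_ext_bounded _ _ K) /K ?leq_max ?leqnn ?orbT // mulr_sumr -big_split.
by apply: eq_bigr => m _; rewrite mcoeffD mcoeffZ /=; ring.
Qed.

Lemma lin_ext0 tau : lin_ext tau 0 = 0.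
Proof. by rewrite /lin_ext msupp0 big_nil. Qed.
Lemma lin_extZ tau c Z : lin_ext tau (c *: Z) = c * lin_ext tau Z.
Proof. by rewrite -[c *: Z]addr0 lin_ext_lin lin_ext0 addr0. Qed.
Lemma lin_extD tau Y Z : lin_ext tau (Y + Z) = lin_ext tau Y + lin_ext tau Z.
Proof. by rewrite -[Y]scale1r lin_ext_lin mul1r scale1r. Qed.
Lemma lin_ext_sum tau (I : Type) (s : seq I) Q (F : I -> {mpoly rat[N]}) :
  lin_ext tau (\sum_(i <- s | Q i) F i) = \sum_(i <- s | Q i) lin_ext tau (F i).
Proof. by elim/big_rec2: _ => [|i x y _ <-]; rewrite ?lin_ext0 ?lin_extD. Qed.
Lemma lin_extX tau m : lin_ext tau 'X_[m] = tau m.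
Proof. by rewrite /lin_ext msuppX big_seq1 mcoeffX eqxx mul1r. Qed.

Definition in_var (i : 'I_N) (g : {poly rat}) : {mpoly rat[N]} := horner_alg 'X_i g.

Lemma in_varE i (g : {poly rat}) D : (size g <= D)%N ->
  in_var i g = \sum_(t < D) g`_t *: 'X_i ^+ t.
Proof.
move=> h; have e : g = \sum_(t < D) g`_t *: 'X^t.
  rewrite -poly_def; apply/polyP => j; rewrite coef_poly; case: ltnP => // h'.
  by rewrite nth_default // (leq_trans h).
rewrite {1}e /in_var raddf_sum; apply: eq_bigr => t _.
by rewrite /= linearZ /= mulr_algl rmorphXn /= horner_algX.
Qed.

Lemma in_var_prod i (I : Type) (s : seq I) Q (F : I -> {poly rat}) :
  in_var i (\prod_(j <- s | Q j) F j) = \prod_(j <- s | Q j) in_var i (F j).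
Proof. by rewrite /in_var rmorph_prod. Qed.

Lemma mcoeff_prod_in_var (g : 'I_N -> {poly rat}) (m : 'X_{1..N}) :
  (\prod_(i < N) in_var i (g i))@_m = \prod_(i < N) (g i)`_(m i).
Proof.
pose D := (\max_(i < N) maxn (size (g i)) (m i).+1)%N.
have hD i : (maxn (size (g i)) (m i).+1 <= D)%N by exact: (@leq_bigmax _ (fun i => maxn (size (g i)) (m i).+1) i).
have mD i : (m i < D)%N by apply: leq_trans (hD i); rewrite leq_max leqnn orbT.
under eq_bigr => i _ do rewrite (@in_varE _ _ D) ?(leq_trans _ (hD i)) ?leq_maxl //.
rewrite bigA_distr_bigA raddf_sum (bigD1 [ffun i => Ordinal (mD i)]) //=.
have E (f : {ffun 'I_N -> 'I_D}) :
    (\prod_(i < N) ((g i)`_(f i) *: 'X_i ^+ (f i)))@_m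
    = (\prod_(i < N) (g i)`_(f i)) * ([multinom (f i : nat) | i < N] == m)%:R.
  rewrite scaler_prod mcoeffZ; congr (_ * _); rewrite -mcoeffX; congr mcoeff.
  by rewrite mpolyXE_id; apply: eq_bigr => i _; rewrite mnmE.
rewrite E [X in _ + X]big1 ?addr0 => [|f ne].
  have -> : [multinom ([ffun i => Ordinal (mD i)] i : nat) | i < N] = m.
    by apply/mnmP => i; rewrite mnmE ffunE.
  by rewrite eqxx mulr1; apply: eq_bigr => i _; rewrite ffunE.
rewrite E; case: eqP => [e|_]; last by rewrite mulr0.
case/eqP: ne; apply/ffunP => i; apply: val_inj; rewrite ffunE /=.
by rewrite -e mnmE.
Qed.

Section Tens.
Variable phi : 'I_N -> {poly rat} -> rat.
Hypothesis phi_lin : forall i c g h, phi i (c *: g + h) = c * phi i g + phi i h.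

(** The tensor product of the functionals phi i. *)
Definition tens := lin_ext (fun m => \prod_(i < N) phi i 'X^(m i)).

Lemma tens_phi0 i : phi i 0 = 0.
Proof.
have := phi_lin i 1 0 0; rewrite scale1r addr0 mul1r => /eqP.
by rewrite -subr_eq0 opprD addrA subrr add0r oppr_eq0 => /eqP.
Qed.

Lemma tens_in_var i (g : {poly rat}) m : tens (in_var i g * 'X_[m])
  = phi i (g * 'X^(m i)) * \prod_(j < N | j != i) phi j 'X^(m j).
Proof.
rewrite (in_varE i (leqnn _)) mulr_suml /tens lin_ext_sum.
have -> : phi i (g * 'X^(m i)) = \sum_(t < size g) g`_t * phi i 'X^(m i + t).
  rewrite -{1}[g]coefK poly_def mulr_suml.
  elim/big_rec2: _ => [|t x y _ <-]; first exact: tens_phi0.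
  by rewrite -scalerAl -exprD phi_lin addnC.
rewrite mulr_suml; apply: eq_bigr => t _.
rewrite -scalerAl lin_extZ -mulrA; congr (_ * _).
rewrite mpolyXn -mpolyXD lin_extX (bigD1 i) //= mnmDE mulmnE mnm1E eqxx mul1n addnC.
congr (_ * _); apply: eq_bigr => j ne.
by rewrite mnmDE mulmnE mnm1E eq_sym (negPf ne) mul0n.
Qed.

Lemma tens_kill i g Z : (forall h, phi i (h * g) = 0) -> tens (in_var i g * Z) = 0.
Proof.
move=> hg; rewrite [Z]mpolyE mulr_sumr /tens lin_ext_sum big1 // => m _.
by rewrite -scalerAr lin_extZ -/tens tens_in_var [g * _]mulrC hg mul0r mulr0.
Qed.

(** If phi i and phi j depend on jets of order k at the same point 1/u, then in
    the binomial expansion of (x_i - x_j)^(2k) about this point every term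
    vanishes to order k in one of the two variables. *)
Lemma tens_coincide i j (u : rat) k Z : i != j -> u != 0 ->
  (forall h, phi i (h * (1 - u *: 'X) ^+ k) = 0) ->
  (forall h, phi j (h * (1 - u *: 'X) ^+ k) = 0) ->
  tens (('X_i - 'X_j) ^+ (k + k) * Z) = 0.
Proof.
move=> ne u0 hi hj.
(* after scaling by u, the difference is that of 1 - u x_j and 1 - u x_i *)
suff : tens (u ^+ (k + k) *: (('X_i - 'X_j) ^+ (k + k) * Z)) = 0.
  by rewrite /tens lin_extZ => /eqP; rewrite mulf_eq0 expf_eq0 (negPf u0) andbF => /eqP.
have U t : in_var t ((1 - u *: 'X) ^+ k) = (1 - u *: 'X_t) ^+ k.
  by rewrite /in_var rmorphXn rmorphB rmorph1 /= linearZ /= mulr_algl horner_algX.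
rewrite scalerAl -exprZn.
have -> : u *: ('X_i - 'X_j) = (1 - u *: 'X_j) - (1 - u *: 'X_i) :> {mpoly rat[N]}.
  by rewrite scalerBr opprB addrCA addrAC subrr add0r addrC.
rewrite exprBn mulr_suml /tens lin_ext_sum big1 // => s _; rewrite -/tens.
case: (leqP k s) => hs.
  have -> : (1 - u *: 'X_i) ^+ s = in_var i ((1 - u *: 'X) ^+ k) * (1 - u *: 'X_i) ^+ (s - k).
    by rewrite U -exprD subnKC.
  set X := (X in tens X); have -> : X = in_var i ((1 - u *: 'X) ^+ k) *
     ((-1) ^+ s * (1 - u *: 'X_j) ^+ (k + k - s) * (1 - u *: 'X_i) ^+ (s - k) *+ 'C(k + k, s) * Z).
    by rewrite /X; ring.
  exact: tens_kill.
have -> : (1 - u *: 'X_j) ^+ (k + k - s) = in_var j ((1 - u *: 'X) ^+ k) * (1 - u *: 'X_j) ^+ (k - s).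
  by rewrite U -exprD addnBA // ltnW.
set X := (X in tens X); have -> : X = in_var j ((1 - u *: 'X) ^+ k) *
     ((-1) ^+ s * (1 - u *: 'X_j) ^+ (k - s) * (1 - u *: 'X_i) ^+ s *+ 'C(k + k, s) * Z).
  by rewrite /X; ring.
exact: tens_kill.
Qed.
End Tens.
End LinExt.

(** * Coefficients of rational functions with few poles *)

Definition cst_mnm (n M : nat) : 'X_{1..n} := [multinom M | i < n].

(** The weight prod_(i <> j) (1 - x_i / x_j)^k of the second scalar product, with
    denominators cleared. *)
Definition selberg (n k : nat) : {mpoly rat[n]} :=
  \prod_(i < n) \prod_(j < n | i != j) ('X_j - 'X_i) ^+ k.

(** Total degrees would not do: the contribution from infinity is controlled in
    one variable at a time. *)
Definition vdeg n (i : 'I_n) (c : nat) (Z : {mpoly rat[n]}) :=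
  forall m, m \in msupp Z -> (m i <= c)%N.

Lemma vdegM n (i : 'I_n) c d Y Z : vdeg i c Y -> vdeg i d Z -> vdeg i (c + d) (Y * Z).
Proof.
move=> hY hZ m /msuppM_le /allpairsP [[m1 m2] /= [h1 h2 ->]].
by rewrite mnmDE leq_add ?hY ?hZ.
Qed.

Lemma vdeg1 n (i : 'I_n) : vdeg i 0 1.
Proof. by move=> m; rewrite msupp1 inE => /eqP ->; rewrite mnm0E. Qed.

Lemma vdegX n (i : 'I_n) c Z k : vdeg i c Z -> vdeg i (k * c) (Z ^+ k).
Proof.
move=> h; elim: k => [|k IH]; first exact: vdeg1.
by rewrite exprS mulSn; apply: vdegM.
Qed.

Lemma vdeg_prod n (i : 'I_n) (J : finType) (Q : pred J) (c : J -> nat) F :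
  (forall j, Q j -> vdeg i (c j) (F j)) ->
  vdeg i (\sum_(j | Q j) c j) (\prod_(j | Q j) F j).
Proof.
move=> h; elim/big_rec2: _ => [|j Y d Qj hY]; first exact: vdeg1.
by apply: vdegM => //; exact: h.
Qed.

Lemma vdeg_sub n (a b i : 'I_n) : vdeg i ((i == a) + (i == b)) ('X_a - 'X_b).
Proof.
move=> m /msuppB_le; rewrite mem_cat !msuppX !inE => /orP [] /eqP ->; rewrite mnm1E eq_sym.
  exact: leq_addr.
exact: leq_addl.
Qed.

Lemma vdeg_selberg n k (i : 'I_n) : vdeg i (n.-1 * k + n.-1 * k) (selberg n k).
Proof.
have h := @vdeg_prod n i 'I_n predT
   (fun a => \sum_(b < n | a != b) k * ((i == b) + (i == a)))%N
   (fun a => \prod_(b < n | a != b) ('X_b - 'X_a) ^+ k) _.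
suff e : (\sum_(a < n) \sum_(b < n | a != b) k * ((i == b) + (i == a)) = n.-1 * k + n.-1 * k)%N.
  rewrite -e; apply: h => a _; apply: vdeg_prod => b _; apply: vdegX; exact: vdeg_sub.
have cnt (c : 'I_n) : (\sum_(b < n | b != c) k = n.-1 * k)%N.
  by rewrite sum_nat_const cardC1 card_ord.
under eq_bigr => a _ do rewrite -big_distrr /= big_split /= mulnDr !big_distrr /=.
rewrite big_split /=; congr (_ + _)%N.
  rewrite (exchange_big_dep predT) //= (bigD1 i) //= [X in (_ + X)%N]big1 ?addn0.
    by under eq_bigr do rewrite eqxx muln1; rewrite cnt.
  by move=> b ne; rewrite big1 // => a _; rewrite eq_sym (negPf ne) muln0.
rewrite (bigD1 i) //= [X in (_ + X)%N]big1 ?addn0.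
  by under eq_bigr do rewrite eqxx muln1; under eq_bigl do rewrite eq_sym; rewrite cnt.
by move=> a ne; rewrite big1 // => b _; rewrite eq_sym (negPf ne) muln0.
Qed.

Lemma selberg_factor n k (i j : 'I_n) : i != j ->
  exists Y, selberg n k = ('X_i - 'X_j) ^+ (k + k) * Y.
Proof.
move=> ne; rewrite /selberg (bigD1 i) //= (bigD1 j) //= [X in _ * X](bigD1 j) 1?eq_sym //=.
rewrite [X in _ * (X * _)](bigD1 i) 1?eq_sym //=.
rewrite -['X_j - 'X_i]opprB exprNn exprD.
set a := ('X_i - 'X_j) ^+ k.
exists ((-1) ^+ k * \prod_(i0 < n | (i != i0) && (i0 != j)) ('X_i0 - 'X_i) ^+ k *
  \prod_(i0 < n | (j != i0) && (i0 != i)) ('X_i0 - 'X_j) ^+ k *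
  \prod_(i0 < n | (i0 != i) && (i0 != j)) \prod_(j0 < n | i0 != j0) ('X_j0 - 'X_i0) ^+ k).
by ring.
Qed.

Lemma mcoeff_mulX_sub n (m c : 'X_{1..n}) (G : {mpoly rat[n]}) :
  ('X_[m] * G)@_c = if (m <= c)%MM then G@_(c - m) else 0.
Proof.
rewrite mulrC; case: ifP => h; first by rewrite -[in LHS](submK h) addmC mcoeffMX.
apply/eqP; rewrite mcoeff_eq0 (perm_mem (msuppMX _ _)); apply/mapP => -[t _ e].
by rewrite e lem_addr in h.
Qed.

Lemma mcoeff_mul_in_var n (S : {poly rat}) M (Z : {mpoly rat[n]}) :
  (Z * \prod_(i < n) in_var i S)@_(cst_mnm n M)
  = lin_ext (fun m => \prod_(i < n) (S * 'X^(m i))`_M) Z.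
Proof.
rewrite {1}[Z]mpolyE mulr_suml raddf_sum; apply: eq_bigr => m _.
rewrite -scalerAl /= mcoeffZ mcoeff_mulX_sub; congr (_ * _).
case: ifP => h.
  rewrite mcoeff_prod_in_var; apply: eq_bigr => i _; rewrite coefMXn mnmBE mnmE.
  by move/mnm_lepP: h => /(_ i); rewrite mnmE ltnNge => ->.
move/negbT: h => /mnm_lepP h.
have [i hi] : exists i, (M < m i)%N.
  apply: contrapT => hn; apply: h => i; rewrite mnmE leqNgt; apply/negP => hi.
  by apply: hn; exists i.
by rewrite (bigD1 i) //= coefMXn hi mul0r.
Qed.

(** With n - 1 poles for n variables, two variables are always evaluated at the
    same pole, where the power of their difference vanishes to too high an order.
    The exponent M is the least one for which the degrees leave no contribution
    from infinity. *)
Lemma selberg_residue n k p (u : nat -> rat) K (h : {mpoly rat[n]})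
  (M := (p.+1 + n.-1 * k)%N) :
  (0 < n)%N -> (0 < k)%N -> (forall a, u a != 0) -> injective u -> (M <= K)%N ->
  (forall i, vdeg i p h) ->
  (selberg n k * h * \prod_(i < n) in_var i (\prod_(a < n.-1) negpow K k (u a)))@_(cst_mnm n M) = 0.
Proof.
move=> n0 k0 u0 u_inj leMK hp; rewrite mcoeff_mul_in_var.
have [psi [psi_lin psi_kill psi_split]] := quot_coef_split n.-1 k0 u0 u_inj leMK.
(* f chooses a pole for each variable *)
transitivity (\sum_(f : {ffun 'I_n -> 'I_n.-1})
    tens (fun i => psi (f i)) (selberg n k * h)).
  transitivity (\sum_(m <- msupp (selberg n k * h)) \sum_(f : {ffun 'I_n -> 'I_n.-1})
      (selberg n k * h)@_m * \prod_(i < n) psi (f i) 'X^(m i)); last first.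
    by rewrite exchange_big.
  rewrite /lin_ext big_seq [RHS]big_seq; apply: eq_bigr => m hm; rewrite -mulr_sumr; congr (_ * _).
  rewrite -(bigA_distr_bigA (fun i a => psi (nat_of_ord a) 'X^(m i))).
  apply: eq_bigr => i _; apply: (psi_split 'X^(m i)); rewrite size_polyXn.
  have := vdegM (@vdeg_selberg n k i) (hp i) hm.
  by rewrite /M; lia.
rewrite big1 // => f _.
have [i [j [ne e]]] : exists i j, i != j /\ f i = f j.
  apply: contrapT => hn; have f_inj : injective f.
    move=> i j e; apply/eqP/negPn/negP => ne; apply: hn; by exists i, j.
  by have := leq_card f f_inj; rewrite !card_ord; case: (n) n0 => // n' _; rewrite ltnn.
have [Y ->] := selberg_factor k ne; rewrite -mulrA.
apply: (@tens_coincide _ _ _ i j (u (f i))) => //.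
- by move=> g; exact: psi_kill.
- by move=> g; rewrite e; exact: psi_kill.
Qed.

(** * Separation of the coefficients of a generating function *)

Lemma digits_inj E r (g g' : nat -> nat) :
  (forall a, g a < E)%N -> (forall a, g' a < E)%N ->
  (\sum_(a < r) E ^ a * g a = \sum_(a < r) E ^ a * g' a)%N ->
  forall a, (a < r)%N -> g a = g' a.
Proof.
elim: r g g' => // r IH g g' hg hg'; rewrite !big_ord_recl /= !expn0 !mul1n.
have D (f : nat -> nat) : (\sum_(i < r) E ^ bump 0 i * f (bump 0 i)
    = E * \sum_(i < r) E ^ i * f i.+1)%N.
  by rewrite big_distrr /=; apply: eq_bigr => i _; rewrite expnS mulnA.
rewrite !D => e.
have e0 : g 0%N = g' 0%N.
  by have := congr1 (modn^~ E) e; rewrite ![(E * _)%N]mulnC ![(_ + _ * E)%N]addnC !modnMDl !modn_small.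
have E0 : (0 < E)%N by apply: leq_ltn_trans (hg 0%N).
move: e; rewrite e0 => /addnI /eqP; rewrite eqn_pmul2l // => /eqP e [|a] // ar.
exact: (IH (fun a => g a.+1) (fun a => g' a.+1)).
Qed.

(** Kronecker substitution: a polynomial of degree less than E in each of its
    variables is determined by its values at (t, t^E, t^(E^2), ...). For t > 1
    and E > 1 the coordinates of such points are distinct. *)
Lemma kronecker r E (c : {ffun 'I_r -> 'I_E} -> rat) :
  (forall t : nat, (1 < t)%N ->
     \sum_g c g * \prod_(a < r) (t%:R ^+ (E ^ a)) ^+ g a = 0) ->
  forall g, c g = 0.
Proof.
move=> h g0.
pose wt (g : {ffun 'I_r -> 'I_E}) := (\sum_(a < r) E ^ a * g a)%N.
pose p : {poly rat} := \sum_g c g *: 'X^(wt g).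
have p0 : p = 0.
  apply/eqP/negPn/negP => pn0.
  (* all integers greater than 1 are roots *)
  pose rs : seq rat := [seq i.+2%:R | i <- iota 0 (size p)].
  have : (size rs < size p)%N.
    apply: max_poly_roots pn0 _ _.
      apply/allP => x /mapP [i _ ->]; rewrite rootE /p horner_sum -[X in _ == X](h i.+2) //.
      apply/eqP/eq_bigr => g _; rewrite hornerZ hornerXn; congr (_ * _).
      rewrite /wt -prodrXr; apply: eq_bigr => a _; by rewrite exprM.
    rewrite map_inj_uniq ?iota_uniq // => i j /eqP.
    by rewrite eqr_nat => /eqP [].
  by rewrite size_map size_iota ltnn.
have := congr1 (fun q : {poly rat} => q`_(wt g0)) p0; rewrite coef0 coef_sum.
rewrite (bigD1 g0) //= coefZ coefXn eqxx mulr1 big1 ?addr0 // => g ne.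
rewrite coefZ coefXn; case: eqP => [e|]; last by rewrite mulr0.
case/eqP: ne; apply/ffunP => a; apply: val_inj => /=.
pose ext (f : {ffun 'I_r -> 'I_E}) b := if insub b is Some a' then nat_of_ord (f a') else 0%N.
have E0 : (0 < E)%N := leq_ltn_trans (leq0n _) (ltn_ord (g a)).
have ext_lt f b : (ext f b < E)%N by rewrite /ext; case: insubP.
have extE f (b : 'I_r) : ext f b = f b by rewrite /ext valK.
have := @digits_inj E r (ext g) (ext g0) (ext_lt g) (ext_lt g0) _ a (ltn_ord a).
rewrite !extE; apply; move: e; rewrite /wt => e.
under eq_bigr do rewrite extE; under [RHS]eq_bigr do rewrite extE; exact: esym.
Qed.

Lemma mcoeff_pihomog n d (p : {mpoly rat[n]}) m :
  (pihomog mdeg d p)@_m = if mdeg m == d then p@_m else 0.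
Proof.
rewrite pihomogE raddf_sum /=; under eq_bigr do rewrite mcoeffZ mcoeffX.
have [hm|hm] := boolP (m \in msupp p); last first.
  rewrite (memN_msupp_eq0 hm) if_same big_seq_cond big1 // => m' /andP [hm' _].
  by case: eqP => [e|]; rewrite ?mulr0 //; rewrite e (negPf hm) in hm'.
rewrite big_mkcond (bigD1_seq m) ?msupp_uniq //= eqxx mulr1 big1 ?addr0 // => m' ne.
by case: ifP; rewrite // (negPf ne) mulr0.
Qed.

Lemma negpow_coef K k u j : (negpow K k u)`_j = (negpow K k 1)`_j * u ^+ j.
Proof. by rewrite !coef_poly; case: ifP => _; rewrite ?mul0r // expr1n mulr1. Qed.

Section Homog.
Variables (n k K : nat).
Let E := (n * K).+1.
(** The part of degree d in prod_i (1 - x_i)^(-k), truncated in each variable. *)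
Definition qtrunc d : {mpoly rat[n]} :=
  pihomog mdeg d (\prod_(i < n) in_var i (negpow K k 1)).

Lemma qtrunc_sum u :
  \prod_(i < n) in_var i (negpow K k u) = \sum_(d < E) u ^+ d *: qtrunc d.
Proof.
apply/mpolyP => m; rewrite mcoeff_prod_in_var raddf_sum /=.
under [RHS]eq_bigr do rewrite mcoeffZ mcoeff_pihomog mcoeff_prod_in_var.
under eq_bigr do rewrite negpow_coef; rewrite big_split /= prodrXr -mdegE mulrC.
have [hm|hm] := ltnP (mdeg m) E.
  rewrite [RHS](bigD1 (Ordinal hm)) //= eqxx [X in _ = _ + X]big1 ?addr0 // => d ne.
  case: eqP => [e|]; last by rewrite mulr0.
  by case/eqP: ne; apply: val_inj; rewrite /= e.
rewrite [RHS]big1 => [|d _]; last first.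
  by case: eqP => [e|]; rewrite ?mulr0 //; have := ltn_ord d; rewrite -e ltnNge hm.
have [i hi] : exists i, (K < m i)%N.
  apply: contrapT => hn; move: hm; rewrite leqNgt /E ltnS mdegE; apply/negP/negPn.
  apply: (@leq_trans (\sum_(i < n) K)%N); last by rewrite sum_nat_const card_ord.
  by apply: leq_sum => i _; rewrite leqNgt; apply/negP => hi; apply: hn; exists i.
by rewrite (bigD1 i) //= coef_poly ltnS leqNgt hi mul0r mulr0.
Qed.

Lemma qtrunc_omega d : (0 < k)%N -> (d <= K)%N -> qtrunc d = omega k%:R (elemsym d) n.
Proof.
move=> k0 le; apply/mpolyP => m; rewrite omega_elemsym_coef // mcoeff_pihomog mcoeff_prod_in_var.
case: eqP => [e|_]; last by rewrite mul0r.
rewrite mul1r; apply: eq_bigr => i _; rewrite coef_poly expr1n mulr1 ltnS.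
have hi : (m i <= mdeg m)%N by rewrite mdegE (bigD1 i) //= leq_addr.
by rewrite (leq_trans hi) // e.
Qed.
End Homog.

(** By selberg_residue the generating function of these coefficients, in
    parameters u_a, vanishes at all points with distinct nonzero coordinates. *)
Lemma selberg_orth n k p (h : {mpoly rat[n]}) (nu : 'I_n.-1 -> nat) :
  (0 < n)%N -> (0 < k)%N -> (forall i, vdeg i p h) ->
  (selberg n k * h * \prod_(a < n.-1) omega k%:R (elemsym (nu a)) n)@_(cst_mnm n (p.+1 + n.-1 * k)) = 0.
Proof.
move=> n0 k0 hp; set M := (_ + _)%N.
(* K exceeds every degree in play, so that truncation at K changes nothing *)
pose K := (M + \sum_(a < n.-1) nu a)%N; pose E := (n * K).+1.
have nuK a : (nu a <= K)%N by rewrite /K (bigD1 a) //= addnCA leq_addr.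
have MK : (M <= K)%N by rewrite leq_addr.
have K0 : (0 < K)%N by apply: leq_trans MK.
have nuE a : (nu a < E)%N by rewrite ltnS (leq_trans (nuK a)) // leq_pmull.
have E1 : (1 < E)%N by rewrite ltnS muln_gt0 n0.
pose c (g : {ffun 'I_n.-1 -> 'I_E}) : rat :=
  (selberg n k * h * \prod_(a < n.-1) qtrunc n k K (g a))@_(cst_mnm n M).
have c0 : forall g, c g = 0.
  apply: kronecker => t t1.
  pose u (a : nat) : rat := t%:R ^+ (E ^ a).
  have u0 a : u a != 0 by rewrite expf_neq0 // pnatr_eq0 -lt0n (ltn_trans _ t1).
  have u_inj : injective u.
    by move=> a b; rewrite /u -!natrX => /eqP; rewrite eqr_nat !eqn_exp2l // => /eqP.
  rewrite -[RHS](selberg_residue n0 k0 u0 u_inj MK hp).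
  under [X in _ = mcoeff _ (_ * X)]eq_bigr => i _ do rewrite in_var_prod.
  rewrite exchange_big /=; under [X in _ = mcoeff _ (_ * X)]eq_bigr => a _ do rewrite qtrunc_sum.
  rewrite bigA_distr_bigA mulr_sumr raddf_sum; apply: eq_bigr => g _.
  by rewrite scaler_prod -scalerAr /= mcoeffZ mulrC.
have := c0 [ffun a => Ordinal (nuE a)]; rewrite /c => e; rewrite -[RHS]e.
congr (mcoeff _ (_ * _)); apply: eq_bigr => a _; by rewrite ffunE /= (qtrunc_omega _ k0 (nuK a)).
Qed.

(** * Alternants *)

Section Alternant.
Variable n : nat.
Implicit Types w : 'I_n -> nat.
Local Notation R := {mpoly rat[n]}.

Definition altp w : R := \sum_(s : 'S_n) (-1) ^+ s *: 'X_[[multinom w (s i) | i < n]].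

Lemma altpE w : altp w = \det (\matrix_(i < n, j < n) ('X_j ^+ w i : R)).
Proof.
rewrite -det_tr /altp /determinant; apply: eq_bigr => s _.
rewrite -mul_mpolyC rmorphXn rmorphN1; congr (_ * _).
by rewrite [LHS]mpolyXE_id; apply: eq_bigr => i _; rewrite mnmE !mxE.
Qed.

Definition vander : R := altp (fun j => j).

Lemma vanderE : vander = \prod_(i < n) \prod_(j < n | (i < j)%N) ('X_j - 'X_i).
Proof.
rewrite /vander altpE.
have := det_Vandermonde (\row_(j < n) ('X_j : R)); rewrite /Vandermonde.
have -> : \matrix_(i < n, j < n) (\row_j0 ('X_j0 : R)) 0 j ^+ i = \matrix_(i, j) 'X_j ^+ i.
  by apply/matrixP => i j; rewrite !mxE.
by move=> ->; apply: eq_bigr => i _; apply: eq_bigr => j _; rewrite !mxE.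
Qed.

Definition rev_perm : 'S_n := perm (@rev_ord_inj n).

Lemma altp_rev w : altp (fun j => w (rev_ord j)) = (-1) ^+ rev_perm *: altp w.
Proof.
rewrite /altp scaler_sumr [RHS](reindex_inj (mulIg rev_perm)) /=.
apply: eq_bigr => s _; rewrite odd_permM signr_addb scalerA mulrCA -signr_addb addbb mulr1.
by congr (_ *: 'X_[_]); apply/mnmP => i; rewrite !mnmE permM permE.
Qed.

(** Reversing the order of the exponents in a Vandermonde determinant amounts to
    reversing the order of the variables. *)
Lemma vander_rev : (-1) ^+ rev_perm *: vander
  = \prod_(i < n) \prod_(j < n | (i < j)%N) ('X_i - 'X_j).
Proof.
transitivity (\det (Vandermonde n (\row_(j < n) ('X_(rev_ord j) : R)))).
  rewrite /vander altpE.
  have -> : Vandermonde n (\row_j 'X_(rev_ord j)) =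
     col_perm rev_perm (\matrix_(i, j) 'X_j ^+ i) :> 'M[R]_n.
    by apply/matrixP => i j; rewrite !mxE permE.
  rewrite col_permE det_mulmx det_perm odd_permV mulrC.
  by rewrite -mul_mpolyC rmorphXn rmorphN1.
rewrite det_Vandermonde.
rewrite (reindex_inj rev_ord_inj) /= [RHS](exchange_big_dep predT) //=.
apply: eq_bigr => i _; rewrite (reindex_inj rev_ord_inj) /=.
apply: eq_big => [j|j _]; last by rewrite !mxE !rev_ordK.
by have := ltn_ord i; have := ltn_ord j; lia.
Qed.

Lemma selbergE k : selberg n k = (vander * ((-1) ^+ rev_perm *: vander)) ^+ k.
Proof.
rewrite vander_rev vanderE -big_split /= /selberg.
have -> : \prod_(i < n) \prod_(j < n | i != j) ('X_j - 'X_i : R) ^+ k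
   = (\prod_(i < n) \prod_(j < n | i != j) ('X_j - 'X_i)) ^+ k.
  by rewrite -prodrXl; apply: eq_bigr => i _; rewrite -prodrXl.
congr (_ ^+ k); rewrite big_split /= [X in _ = _ * X](exchange_big_dep predT) //= -big_split /=.
apply: eq_bigr => i _; rewrite (bigID (fun j : 'I_n => (i < j)%N)) /=.
congr (_ * _); apply: eq_bigl => j.
  by rewrite andb_idl // => h; rewrite neq_ltn h.
by rewrite -leqNgt neq_ltn; case: ltngtP.
Qed.

Lemma prod_altp (J : finType) (w : J -> 'I_n -> nat) :
  \prod_j altp (w j) = \sum_(s : {ffun J -> 'S_n})
     (\prod_j (-1) ^+ s j) *: 'X_[[multinom (\sum_j w j (s j i))%N | i < n]].
Proof.
rewrite /altp bigA_distr_bigA; apply: eq_bigr => s _; rewrite scaler_prod; congr (_ *: _).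
rewrite mprodXE; congr 'X_[_]; apply/mnmP => i; rewrite mnmE mnm_sumE.
by apply: eq_bigr => j _; rewrite mnmE.
Qed.

(** The exponents 0, 1, 2, ... with q left out. *)
Definition gap_exp (q : nat) (j : 'I_n) := ((q <= j) + j)%N.

Lemma prod_X_sub_mesym l : (l <= n)%N ->
  (\prod_(i < n) ('X - ('X_i : R)%:P))`_(n - l) = (-1) ^+ l * mesym n rat l.
Proof.
move=> le.
have [cs cE] : exists cs : n.-tuple R, forall i, tnth cs i = 'X_i.
  by exists (mktuple (fun i => 'X_i)) => i; rewrite tnth_mktuple.
have e := mroots_coeff cs (Ordinal (le : l < n.+1)%N).
rewrite big_tuple (eq_bigr (fun i => 'X - ('X_i)%:P)) in e; last by move=> i _; rewrite cE.
rewrite [LHS]e; congr (_ * _).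
rewrite /mesym raddf_sum; apply: eq_bigr => h _.
by rewrite /= rmorph_prod; apply: eq_bigr => i _; rewrite /= mevalXU cE.
Qed.

(** The bialternant formula for e_l: expand a Vandermonde determinant with one
    more variable t along the column of t, and compare coefficients of powers
    of t. *)
Lemma altp_gap_exp l : (l <= n)%N -> altp (gap_exp (n - l)) = mesym n rat l * vander.
Proof.
move=> le.
(* the variable t is the one of {poly R}, in the last column *)
pose a : 'rV[{poly R}]_n.+1 := \row_j (if unlift ord_max j is Some j' then ('X_j' : R)%:P else 'X).
have aW (j : 'I_n) : a 0 (widen_ord (leqnSn n) j) = ('X_j)%:P.
  have -> : widen_ord (leqnSn n) j = lift ord_max j.
    by apply: val_inj; rewrite /= /bump leqNgt ltn_ord.
  by rewrite mxE liftK.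
have aM : a 0 ord_max = 'X by rewrite mxE unlift_none.
have e1 : \det (Vandermonde n.+1 a) = vander%:P * \prod_(i < n) ('X - ('X_i)%:P).
  rewrite det_Vandermonde big_ord_recr /= [X in _ * X]big1 ?mulr1; last first.
    by move=> j; rewrite ltnNge -ltnS ltn_ord.
  rewrite vanderE rmorph_prod -big_split; apply: eq_bigr => i _ /=.
  rewrite big_mkcond big_ord_recr /= ltn_ord -big_mkcond /= aW aM rmorph_prod.
  by congr (_ * _); apply: eq_bigr => j _; rewrite !aW rmorphB.
have e2 := expand_det_col (Vandermonde n.+1 a) ord_max; rewrite e1 in e2.
have {e2} := congr1 (fun q : {poly R} => q`_(n - l)) e2.
rewrite coefCM prod_X_sub_mesym // coef_sum.
have hnl : (n - l < n.+1)%N by rewrite ltnS leq_subr.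
have cof (i : 'I_n.+1) : cofactor (Vandermonde n.+1 a) i ord_max
    = ((-1) ^+ (i + n) * altp (fun r => lift i r))%:P.
  rewrite /cofactor altpE rmorphM rmorphXn rmorphN1; congr (_ * _).
  rewrite -det_map_mx; congr (\det _); apply/matrixP => r c; rewrite !mxE.
  by rewrite liftK rmorphXn.
rewrite (bigD1 (Ordinal hnl)) //= big1 ?addr0 => [|i ne]; last first.
  rewrite cof mxE aM coefMC coefXn; case: eqP => [e|]; last by rewrite mul0r.
  by case/eqP: ne; apply: val_inj; rewrite /= e.
rewrite cof mxE aM coefMC coefXn eqxx mul1r /=.
have -> : (n - l + n = l + (n - l).*2)%N by rewrite -addnn; lia.
rewrite exprD -mul2n exprM sqrrN !expr1n mulr1.
move=> h; have : (-1) ^+ l * altp (gap_exp (n - l)) = (-1) ^+ l * (mesym n rat l * vander).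
  by rewrite -h; ring.
by apply: mulfI; rewrite signr_eq0.
Qed.

End Alternant.

(** * The hyperdeterminant as a linear functional *)

Lemma sum_Posz (I : Type) (r : seq I) Q (F : I -> nat) :
  \sum_(i <- r | Q i) (F i)%:Z = (\sum_(i <- r | Q i) F i)%N%:Z.
Proof. by elim/big_rec2: _ => // i x y _ ->. Qed.

Lemma omega_form_elemsymz n (z : 'I_n -> int) g :
  omega_form (\prod_(i < n) elemsymz (z i)) g
  = if [forall i, 0 <= z i] then (g n)@_[multinom `|z i|%N | i < n] else 0.
Proof.
case: forallP => h.
  rewrite -omega_form_eprod; congr (omega_form _ _); apply: eq_bigr => i _; rewrite mnmE.
  by case: (z i) (h i).
have [i hi] : exists i, ~~ (0 <= z i).
  by apply: contrapT => hn; apply: h => i; apply: contrapT => /negP hi; apply: hn; exists i.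
rewrite (bigD1 i) //=; case: (z i) hi => // m _.
by rewrite mul0r /omega_form diag_form0l.
Qed.

Section Toeplitz.
Variables (n p l k : nat) (k_gt0 : (0 < k)%N) (le_ln : (l <= n)%N).
Local Notation R := {mpoly rat[n]}.

Definition toep_exp (s : {ffun 'I_(k + k) -> 'S_n}) (i : 'I_n) : int :=
  \sum_(a < k) (s (lshift k a) i : nat)%:Z - \sum_(a < k) (s (rshift k a) i : nat)%:Z
  + near_const_vec p l (s (lshift k (Ordinal k_gt0)) i).

Definition multi_sign (s : {ffun 'I_(k + k) -> 'S_n}) : rat := \prod_j (-1) ^+ s j.

Lemma toeplitzE :
  shifted_toeplitz k_gt0 (@near_const_vec n p l)
  = (n`!%:R)^-1 *: \sum_s multi_sign s *: \prod_(i < n) elemsymz (toep_exp s i).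
Proof.
rewrite /shifted_toeplitz /hyperdet; congr (_ *: _); apply: eq_bigr => s _.
rewrite -mulr_algl; congr (_ * _).
rewrite /multi_sign -in_algE rmorph_prod; apply: eq_bigr => j _.
by rewrite rmorphXn rmorphN1.
Qed.

Lemma factN0 : n`!%:R != 0 :> rat.
Proof. by rewrite pnatr_eq0 -lt0n fact_gt0. Qed.

Lemma omega_form_toeplitz g :
  n`!%:R * omega_form (shifted_toeplitz k_gt0 (@near_const_vec n p l)) g
  = \sum_s multi_sign s * if [forall i, 0 <= toep_exp s i]
      then (g n)@_[multinom `|toep_exp s i|%N | i < n] else 0.
Proof.
rewrite toeplitzE /omega_form diag_formZl mulrA divff ?factN0 // mul1r diag_form_suml.
by apply: eq_bigr => s _; rewrite diag_formZl; congr (_ * _); exact: omega_form_elemsymz.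
Qed.

(** w0 is for the index carrying the shift v, w1 for the other indices counted
    positively, and w2 for those counted negatively. *)
Definition pick_exp (w0 w1 w2 : 'I_n -> nat) (j : 'I_(k + k)) : 'I_n -> nat :=
  if j == 0 :> nat then w0 else if (j < k)%N then w1 else w2.

Lemma prod_pick_exp w0 w1 w2 :
  \prod_j altp (pick_exp w0 w1 w2 j) = altp w0 * altp w1 ^+ k.-1 * altp w2 ^+ k.
Proof.
rewrite big_split_ord /=; congr (_ * _).
  rewrite (bigD1 (Ordinal k_gt0)) //=; congr (_ * _).
  rewrite -[k in RHS]card_ord -(cardC1 (Ordinal k_gt0)) -prodr_const.
  apply: eq_big => [a|a ne]; first by rewrite inE.
  rewrite /pick_exp /= ltn_ord ifF //.
  by apply: contraNF ne => /eqP e; apply/eqP/val_inj.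
rewrite -[k in RHS]card_ord -prodr_const; apply: eq_bigr => a _.
rewrite /pick_exp /= ltnNge leq_addr /= ifF //.
by apply/eqP; lia.
Qed.

Lemma sum_pick_exp w0 w1 w2 (s : {ffun 'I_(k + k) -> 'S_n}) i
  (x0 := s (lshift k (Ordinal k_gt0)) i) :
  (\sum_j pick_exp w0 w1 w2 j (s j i) + w1 x0
   = w0 x0 + \sum_(a < k) w1 (s (lshift k a) i) + \sum_(a < k) w2 (s (rshift k a) i))%N.
Proof.
rewrite big_split_ord /=.
have -> : (\sum_(a < k) pick_exp w0 w1 w2 (rshift k a) (s (rshift k a) i)
   = \sum_(a < k) w2 (s (rshift k a) i))%N.
  apply: eq_bigr => a _; rewrite /pick_exp /= ltnNge leq_addr /= ifF //.
  by apply/eqP; lia.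
rewrite (bigD1 (Ordinal k_gt0)) //= [in RHS](bigD1 (Ordinal k_gt0)) //=.
have -> : (\sum_(a < k | a != Ordinal k_gt0) pick_exp w0 w1 w2 (lshift k a) (s (lshift k a) i)
   = \sum_(a < k | a != Ordinal k_gt0) w1 (s (lshift k a) i))%N.
  apply: eq_bigr => a ne; rewrite /pick_exp /= ltn_ord ifF //.
  by apply: contraNF ne => /eqP e; apply/eqP/val_inj.
by rewrite /pick_exp /= /x0; ring.
Qed.

Lemma sum_rev (f : 'I_k -> 'I_n) :
  (\sum_(a < k) (rev_ord (f a) : nat) + \sum_(a < k) (f a : nat) = n.-1 * k)%N.
Proof.
rewrite -big_split /=; under eq_bigr => a _.
  have -> : (n - (f a).+1 + f a = n.-1)%N by have := ltn_ord (f a); lia.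
  over.
by rewrite sum_nat_const card_ord mulnC.
Qed.

Definition toep_deg := (p.+1 + n.-1 * k)%N.

Let exp_toep_rev :=
  pick_exp (fun x => gap_exp l (rev_ord x)) (fun x => rev_ord x : nat) (fun x => x : nat).
Let exp_toep := pick_exp (gap_exp (n - l)) (fun x => x : nat) (fun x => rev_ord x : nat).

Lemma sum_exp_toep_rev (s : {ffun 'I_(k + k) -> 'S_n}) i :
  ((\sum_j exp_toep_rev j (s j i))%N%:Z + toep_exp s i = toep_deg%:Z)%R.
Proof.
have := @sum_pick_exp (fun x => gap_exp l (rev_ord x)) (fun x => rev_ord x : nat) (fun x => x : nat) s i.
rewrite -/exp_toep_rev /= /gap_exp /toep_exp !sum_Posz /toep_deg /near_const_vec.
set x0 := s _ i; have := sum_rev (fun a => s (lshift k a) i); rewrite /=.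
have hx := ltn_ord x0.
set A := (\sum_(a < k) (n - _))%N; set B := (\sum_(a < k) nat_of_ord (s (lshift k a) i))%N.
set C := (\sum_(a < k) nat_of_ord (s (rshift k a) i))%N; set D := (\sum_(j < k + k) _)%N.
set E := (n.-1 * k)%N; move: A B C D E => A B C D E; clearbody x0; clear -hx le_ln.
move: (nat_of_ord x0) hx => x hx.
by case: ltnP => h; case: leqP => h'; lia.
Qed.

Lemma sum_exp_toep (s : {ffun 'I_(k + k) -> 'S_n}) i :
  (toep_exp s i + (n.-1 * k)%N%:Z = (\sum_j exp_toep j (s j i) + p)%N%:Z)%R.
Proof.
have := @sum_pick_exp (gap_exp (n - l)) (fun x => x : nat) (fun x => rev_ord x : nat) s i.
rewrite -/exp_toep /= /gap_exp /toep_exp !sum_Posz /near_const_vec.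
set x0 := s _ i; have := sum_rev (fun a => s (rshift k a) i); rewrite /=.
have hx := ltn_ord x0.
set A := (\sum_(a < k) (n - _))%N; set B := (\sum_(a < k) nat_of_ord (s (lshift k a) i))%N.
set C := (\sum_(a < k) nat_of_ord (s (rshift k a) i))%N; set D := (\sum_(j < k + k) _)%N.
set E := (n.-1 * k)%N; move: A B C D E => A B C D E; clearbody x0; clear -hx le_ln.
move: (nat_of_ord x0) hx => x hx.
by case: ltnP => h; lia.
Qed.

Local Notation c := ((-1) ^+ rev_perm n : rat).

Lemma prod_exp_toep_rev : \prod_j altp (exp_toep_rev j) = mesym n rat (n - l) * selberg n k.
Proof.
rewrite prod_pick_exp altp_rev -{1}(subKn le_ln) altp_gap_exp ?leq_subr //.
rewrite (altp_rev (fun x => x)) -/(vander n) selbergE exprMn.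
rewrite -[in RHS](prednK k_gt0) [(_ *: _) ^+ k.-1.+1]exprS prednK //.
by rewrite -!mul_mpolyC mulrCA mulrC [in RHS]mulrCA !mulrA.
Qed.

Lemma prod_exp_toep : \prod_j altp (exp_toep j) = mesym n rat l * selberg n k.
Proof.
rewrite prod_pick_exp altp_gap_exp // (altp_rev (fun x => x)) -/(vander n) selbergE exprMn.
rewrite -[in RHS](prednK k_gt0) [vander n ^+ k.-1.+1]exprS prednK //.
by rewrite !mulrA.
Qed.

(** Sum the permutations into alternants whose exponents complement those of the
    hyperdeterminant to toep_deg. *)
Lemma omega_form_toeplitz_coef g :
  n`!%:R * omega_form (shifted_toeplitz k_gt0 (@near_const_vec n p l)) g
  = (selberg n k * (mesym n rat (n - l) * g n))@_(cst_mnm n toep_deg).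
Proof.
rewrite omega_form_toeplitz mulrA [selberg _ _ * _]mulrC -prod_exp_toep_rev prod_altp mulr_suml raddf_sum.
apply: eq_bigr => s _; rewrite -scalerAl /= mcoeffZ mcoeff_mulX_sub; congr (_ * _).
set e := (X in (X <= _)%MM).
have E i : (e i)%:Z + toep_exp s i = toep_deg%:Z by rewrite /e mnmE; exact: sum_exp_toep_rev.
have C i : cst_mnm n toep_deg i = toep_deg by rewrite mnmE.
have -> : [forall i, 0 <= toep_exp s i] = (e <= cst_mnm n toep_deg)%MM.
  apply/forallP/mnm_lepP => h i; move: (E i) (h i); rewrite C;
  by move: (toep_exp s i) (e i) toep_deg => z x M; lia.
case: ifP => // /mnm_lepP h; congr mcoeff; apply/mnmP => i; rewrite mnmBE C mnmE.
rewrite -[X in (toep_deg - X)%N]/(e i).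
move: (E i) (h i); rewrite C; move: (toep_exp s i) (e i) toep_deg => z x M.
by lia.
Qed.

End Toeplitz.

(** * The constant term scalar product *)

Local Notation "x %:F" := (@FracField.tofrac _ x).

Lemma mpolyX_neq0 n (m : 'X_{1..n}) : 'X_[m] != 0 :> {mpoly rat[n]}.
Proof.
by apply/eqP => /(congr1 (mcoeff m)) /eqP; rewrite mcoeffX eqxx mcoeff0 oner_eq0.
Qed.

Lemma cst_mnmD n a b : (cst_mnm n a + cst_mnm n b)%MM = cst_mnm n (a + b).
Proof. by apply/mnmP => i; rewrite mnmDE !mnmE. Qed.

Lemma prodX_exp n N : (\prod_(i < n) ('X_i : {mpoly rat[n]})) ^+ N = 'X_[cst_mnm n N].
Proof.
by rewrite -prodrXl [RHS]mpolyXE_id; apply: eq_bigr => i _; rewrite mnmE.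
Qed.

Lemma prodXF_exp n N : (\prod_(i < n) ('X_i : {mpoly rat[n]})%:F) ^+ N = ('X_[cst_mnm n N])%:F.
Proof. by rewrite -prodX_exp tofracXn rmorph_prod. Qed.

Lemma const_termE n (F : {fraction {mpoly rat[n]}}) N (q : {mpoly rat[n]}) :
  F * ('X_[cst_mnm n N])%:F = q%:F -> const_term F = q@_(cst_mnm n N).
Proof.
move=> e; apply: xget_unique; first by exists N, q; rewrite prodXF_exp.
move=> c [N' [q' [e' ->]]]; rewrite prodXF_exp in e'.
have : q * 'X_[cst_mnm n N'] = q' * 'X_[cst_mnm n N].
  by apply/eqP; rewrite -tofrac_eq !tofracM -e -e' mulrAC.
move/(congr1 (mcoeff (cst_mnm n (N + N')))).
by rewrite -cst_mnmD mcoeffMX addmC mcoeffMX.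
Qed.

Lemma inv_evalE n (g : {mpoly rat[n]}) d :
  (forall m, m \in msupp g -> (m <= cst_mnm n d)%MM) ->
  inv_eval g * ('X_[cst_mnm n d])%:F
  = (\sum_(m <- msupp g) g@_m *: 'X_[cst_mnm n d - m])%:F.
Proof.
move=> hd; rewrite /inv_eval /mmap mulr_suml rmorph_sum !big_seq; apply: eq_bigr => m hm.
rewrite /= -mul_mpolyC tofracM -mulrA; congr (_ * _).
rewrite -[in LHS](submK (hd _ hm)) mpolyXD tofracM mulrCA -[RHS]mulr1; congr (_ * _).
rewrite /mmap1 [X in _ * X%:F]mpolyXE_id rmorph_prod -big_split big1 //= => i _.
by rewrite tofracXn -exprMn mulVf ?expr1n // tofrac_eq0 mpolyX_neq0.
Qed.

Lemma selberg_frac n k :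
  (\prod_(i < n) \prod_(j < n | i != j)
     (1 - ('X_i : {mpoly rat[n]})%:F / ('X_j)%:F) ^+ k) * ('X_[cst_mnm n (n.-1 * k)])%:F
  = (selberg n k)%:F.
Proof.
have x0 (j : 'I_n) : ('X_j : {mpoly rat[n]})%:F != 0 by rewrite tofrac_eq0 mpolyX_neq0.
have -> : ('X_[cst_mnm n (n.-1 * k)] : {mpoly rat[n]})%:F
   = \prod_(i < n) \prod_(j < n | i != j) ('X_j)%:F ^+ k.
  rewrite (exchange_big_dep predT) //= -prodXF_exp -prodrXl; apply: eq_bigr => j _.
  by rewrite prodr_const cardC1 card_ord -exprM mulnC.
rewrite -big_split rmorph_prod; apply: eq_bigr => i _ /=.
rewrite -big_split rmorph_prod; apply: eq_bigr => j _ /=.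
by rewrite -exprMn mulrBl mul1r divfK // tofracXn tofracB.
Qed.

Lemma jack_scalar'_coef n k (f g : symfun) :
  n`!%:R * jack_scalar' n k f g
  = \sum_(m <- msupp (g n)) (g n)@_m * (f n * selberg n k)@_(m + cst_mnm n (n.-1 * k))%MM.
Proof.
rewrite /jack_scalar' mulrA divff ?factN0 // mul1r.
(* x^d clears the denominators of g(1/x) *)
pose d := (\max_(m <- msupp (g n)) mdeg m)%N.
have hd m : m \in msupp (g n) -> (m <= cst_mnm n d)%MM.
  move=> hm; apply/mnm_lepP => i; rewrite mnmE.
  apply: (@leq_trans (mdeg m)); first by rewrite mdegE (bigD1 i) //= leq_addr.
  by rewrite /d (big_rem m) //= leq_maxl.
pose q := f n * selberg n k * \sum_(m <- msupp (g n)) (g n)@_m *: 'X_[cst_mnm n d - m].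
rewrite (@const_termE _ _ (d + n.-1 * k) q); last first.
  rewrite /q -cst_mnmD mpolyXD !tofracM -inv_evalE // -selberg_frac; ring.
rewrite /q mulr_sumr raddf_sum !big_seq; apply: eq_bigr => m hm.
rewrite -scalerAr /= mcoeffZ; congr (_ * _).
have -> : cst_mnm n (d + n.-1 * k) = (cst_mnm n d - m + (m + cst_mnm n (n.-1 * k)))%MM.
  by rewrite addmA submK ?hd // cst_mnmD.
by rewrite mcoeffMX.
Qed.

(** The permutations in the hyperdeterminant and those in the alternants that make
    up the integrand run over the same terms. *)
Lemma jack_scalar'_toeplitz n p l k (k_gt0 : (0 < k)%N) (le_ln : (l <= n)%N) (f g : symfun) :
  f n = 'X_[cst_mnm n p] * mesym n rat l ->
  jack_scalar' n k f g = omega_form (shifted_toeplitz k_gt0 (@near_const_vec n p l)) g.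
Proof.
move=> fE; apply: (mulfI (factN0 n)); rewrite jack_scalar'_coef omega_form_toeplitz.
rewrite fE -mulrA -(prod_exp_toep k_gt0 le_ln) prod_altp.
under eq_bigr => m _ do rewrite mulr_sumr raddf_sum mulr_sumr.
rewrite exchange_big; apply: eq_bigr => s _ /=.
under eq_bigr => m _ do rewrite -scalerAr mcoeffZ -mpolyXD mcoeffX mulrCA.
rewrite -mulr_sumr; congr (_ * _).
set e' := [multinom \sum_(j < k + k) _ | i < n].
have E i : toep_exp p l k_gt0 s i + (n.-1 * k)%N%:Z = (e' i + p)%N%:Z.
  by rewrite /e' mnmE; exact: sum_exp_toep.
move: e' E => e' E; move: (n.-1 * k)%N E => N E.
case: forallP => h.
  set e := [multinom _ | i < n].
  have eqe m : (cst_mnm n p + e' == m + cst_mnm n N)%MM = (m == e).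
    apply/eqP/eqP => [em|->]; apply/mnmP => i.
      move/mnmP: em => /(_ i); rewrite /e !mnmDE !mnmE; move: (E i) (h i).
      by move: (toep_exp p l k_gt0 s i) (e' i) (m i) => z x y; lia.
    rewrite /e !mnmDE !mnmE; move: (E i) (h i).
    by move: (toep_exp p l k_gt0 s i) (e' i) => z x; lia.
  transitivity (\sum_(m <- msupp (g n)) if m == e then (g n)@_m else 0).
    by apply: eq_bigr => m _; rewrite eqe; case: eqP; rewrite ?mulr1 ?mulr0.
  have [he|he] := boolP (e \in msupp (g n)).
    by rewrite (bigD1_seq e) ?msupp_uniq //= eqxx big1 ?addr0 // => m /negPf ->.
  rewrite (memN_msupp_eq0 he) big_seq big1 // => m hm.
  by case: eqP => // e1; rewrite -e1 hm in he.
rewrite big1 // => m _; case: eqP => [em|]; last by rewrite mulr0.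
case: h => i; move/mnmP: em => /(_ i); rewrite !mnmDE !mnmE; move: (E i).
by move: (toep_exp p l k_gt0 s i) (e' i) (m i) => z x y; lia.
Qed.

(** * Near-rectangular partitions *)

Lemma partsum_le_sumn t s : (partsum t s <= sumn s)%N.
Proof. by rewrite -[X in sumn X](cat_take_drop t) sumn_cat leq_addr. Qed.

Lemma partsumS t s : partsum t.+1 s = (partsum t s + nth 0%N s t)%N.
Proof. by rewrite !partsumE big_ord_recr. Qed.

Lemma dom_le_head s l : dom_le s l -> (head 0%N s <= head 0%N l)%N.
Proof. by move=> [_ /(_ 1%N)]; rewrite !partsumE !big_ord1 !nth0. Qed.

Lemma dom_le_size s l : dom_le s l -> (size l <= size s)%N.
Proof.
move=> [e h]; rewrite leqNgt; apply/negP => lt.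
have := h (size s); rewrite partsum_all // e => h1.
have h2 := partsum_le_sumn (size s).+1 l; rewrite partsumS in h2.
have := intpart_pos (mem_nth 0%N lt).
by rewrite -(ltn_add2l (partsum (size s) l)) addn0 ltnNge (leq_trans h2 h1).
Qed.

Lemma nth_anti (s : intpart) i j : (i <= j)%N -> (nth 0%N s j <= nth 0%N s i)%N.
Proof.
move=> le; rewrite leqNgt; apply/negP => lt.
have := count_gt_nth s (nth 0%N s i) j; rewrite lt => h.
by have := count_gt_nth s (nth 0%N s i) i; rewrite ltnn (leq_ltn_trans le h).
Qed.

Lemma size_conj (s : intpart) : size (conj_intpart s) = head 0%N s.
Proof. by rewrite size_mkseq. Qed.

(** Both conjugates have at most n parts, and that of s dominates that of l; so
    its n-th part is the smaller one. *)
Lemma last_column_le n (s l : intpart) : (0 < n)%N -> (head 0%N l <= n)%N -> dom_le s l ->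
  (nth 0%N (conj_intpart s) n.-1 <= nth 0%N (conj_intpart l) n.-1)%N.
Proof.
move=> n0 hl le; have hs := leq_trans (dom_le_head le) hl.
have [e h] := dom_le_conj le.
have := partsumS n.-1 (conj_intpart s); have := partsumS n.-1 (conj_intpart l).
rewrite prednK // [partsum n (conj_intpart l)]partsum_all ?size_conj //.
rewrite [partsum n (conj_intpart s)]partsum_all ?size_conj // e => e1 e2.
by have := h n.-1; rewrite -(leq_add2r (nth 0%N (conj_intpart s) n.-1)) -e2 e1 leq_add2l.
Qed.

Section NearRect.
Variables (n p l : nat) (p_gt0 : (0 < p)%N) (l_gt0 : (0 < l)%N) (le_ln : (l <= n)%N).
Let lam := near_rect p l_gt0 le_ln.

Lemma nth_near_rect j : nth 0%N lam j = if (j < p)%N then n else if j == p then l else 0%N.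
Proof. by rewrite nth_rcons size_nseq nth_nseq; case: ltnP. Qed.

Lemma sumn_near_rect : sumn lam = (n * p + l)%N.
Proof. by rewrite /= sumn_rcons sumn_nseq. Qed.

Lemma head_near_rect : head 0%N lam = n.
Proof. by rewrite -nth0 nth_near_rect p_gt0. Qed.

Lemma partsum_near_rect t : (t <= p)%N -> partsum t lam = (n * t)%N.
Proof.
move=> le; rewrite partsumE (eq_bigr (fun=> n)) ?sum_nat_const ?card_ord 1?mulnC //.
by move=> j _; rewrite nth_near_rect (leq_trans (ltn_ord j)).
Qed.

Lemma near_rect_max (s : intpart) :
  (head 0%N s <= n)%N -> sumn s = (n * p + l)%N -> dom_le s lam.
Proof.
move=> hs e; split=> [|t]; first by rewrite e sumn_near_rect.
have [lt|le] := leqP t p.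
  rewrite partsum_near_rect // partsumE; apply: (@leq_trans (\sum_(j < t) n)%N).
    by apply: leq_sum => j _; apply: leq_trans (nth_le_head _ _) hs.
  by rewrite sum_nat_const card_ord mulnC.
rewrite [leqRHS]partsum_all ?sumn_near_rect -?e ?partsum_le_sumn //.
by rewrite size_rcons size_nseq.
Qed.

Lemma near_rect_uniq (s : intpart) :
  (0 < n)%N -> (head 0%N s <= n)%N -> sumn s = (n * p + l)%N ->
  (p <= nth 0%N (conj_intpart s) n.-1)%N -> (size s <= p.+1)%N -> s = lam.
Proof.
move=> n0 hs e hc sz; rewrite nth_conj in hc.
have hn j : (j < p)%N -> nth 0%N s j = n.
  move=> jp; have := count_gt_nth s n.-1 j; rewrite (leq_trans jp hc) prednK // => /esym h.
  by apply/eqP; rewrite eqn_leq h (leq_trans (nth_le_head _ _)).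
have hp : partsum p s = (n * p)%N.
  rewrite partsumE (eq_bigr (fun=> n)) ?sum_nat_const ?card_ord 1?mulnC //.
  by move=> j _; rewrite hn.
apply: intpart_nth => j; rewrite nth_near_rect; case: ltnP => [|le]; first exact: hn.
case: eqVneq => [->|ne]; last by rewrite nth_default //; lia.
by have := partsumS p s; rewrite hp partsum_all // e => /addnI.
Qed.

Let mu := conj_intpart lam.

Lemma nth_conj_near_rect j : nth 0%N mu j = ((if (j < n)%N then p else 0) + (j < l))%N.
Proof.
rewrite nth_conj /= -cats1 count_cat /= addn0 count_nseq; congr (_ + _)%N.
by case: ltnP; rewrite ?mul1n.
Qed.

Lemma sumn_conj_near_rect : sumn mu = (n * p + l)%N.
Proof. by rewrite sumn_conj sumn_near_rect. Qed.

Lemma conj_near_rect_uniq (s : intpart) : (size s <= n)%N -> sumn s = (n * p + l)%N ->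
  (forall j, (j < n)%N -> (p <= nth 0%N s j <= p.+1)%N) -> s = mu.
Proof.
move=> sz e h; set c := count (fun x => p < x)%N s.
have hj j : (j < n)%N -> nth 0%N s j = (p + (j < c))%N.
  by move=> jn; rewrite /c count_gt_nth; have := h j jn; case: ltnP; lia.
have cn : (c <= n)%N by apply: leq_trans (count_size _ _) sz.
have ec : c = l.
  have : partsum n s = (n * p + l)%N by rewrite partsum_all.
  rewrite partsumE; under eq_bigr => j _ do rewrite hj //.
  rewrite big_split /= sum_nat_const card_ord => /addnI <-.
  rewrite (bigID (fun j : 'I_n => (j < c)%N)) /= [X in (_ + X)%N]big1 ?addn0; last first.
    by move=> j /negbTE ->.
  under eq_bigr => j -> do [].
  by rewrite -(big_ord_widen n (fun=> 1%N) cn) sum1_card card_ord.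
apply: intpart_nth => j; rewrite nth_conj_near_rect; case: ltnP => jn.
  by rewrite hj // ec.
by rewrite nth_default ?(leq_trans sz) // add0n ltnNge (leq_trans le_ln jn).
Qed.

(** The first part is at most p + 1; comparing the sums of the first n - 1 parts,
    the n-th one is at least p. The weight then decides how many parts are p + 1. *)
Lemma conj_near_rect_min (s : intpart) : (0 < n)%N -> (size s <= n)%N -> dom_le s mu -> s = mu.
Proof.
move=> n0 sz [e h]; rewrite sumn_conj_near_rect in e; apply: conj_near_rect_uniq => // j jn.
apply/andP; split; last first.
  apply: leq_trans (nth_le_head _ _) _; rewrite -nth0.
  have := h 1%N; rewrite !partsumE !big_ord1 => /leq_trans; apply.
  by rewrite nth_conj_near_rect; case: ifP; lia.
have jn1 : (j <= n.-1)%N by lia.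
apply: leq_trans (nth_anti s jn1).
have := partsumS n.-1 s; have := partsumS n.-1 mu; have := h n.-1.
rewrite prednK // [partsum n s]partsum_all // [partsum n mu]partsum_all ?size_conj ?head_near_rect //.
rewrite e sumn_conj_near_rect nth_conj_near_rect prednK // leqnn; lia.
Qed.

Lemma mkpart_conj_near_rect (m : 'X_{1..n}) :
  (mkpart m == mu) = (cst_mnm n p <= m)%MM && mechar l (m - cst_mnm n p).
Proof.
have sumE : (cst_mnm n p <= m)%MM -> mdeg m = (n * p + mdeg (m - cst_mnm n p))%N.
  move=> h; rewrite -{1}(submK h) mdegD addnC; congr (_ + _)%N.
  rewrite mdegE (eq_bigr (fun=> p)) ?sum_nat_const ?card_ord // => i _; exact: mnmE.
have sm : sumn (mkpart m) = mdeg m by rewrite sumn_mkpart sumnE.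
apply/eqP/andP => [em|[h /andP [/eqP d /forallP le1]]].
  have szm : size (pos_part m) = size m.
    rewrite -size_mkpart em size_conj head_near_rect size_tuple //.
  have allm : all (fun x => 0 < x)%N m by rewrite all_count -size_filter szm.
  have pm : pos_part m = m by apply/all_filterP.
  have hm i : (p <= m i <= p.+1)%N.
    have : m i \in parts (mkpart m).
      by rewrite (perm_mem (perm_mkpart m)) pm mnm_tnth mem_tnth.
    rewrite em => /(nthP 0%N) [j]; rewrite size_conj head_near_rect => jn <-.
    by rewrite nth_conj_near_rect jn; lia.
  have h : (cst_mnm n p <= m)%MM.
    by apply/mnm_lepP => i; rewrite mnmE; case/andP: (hm i).
  split=> //; apply/andP; split.
    have := sumE h; rewrite -sm em sumn_conj_near_rect => /addnI <-; exact: eqxx.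
  by apply/forallP => i; rewrite mnmBE mnmE; have := hm i; lia.
have hm i : (p <= m i <= p.+1)%N.
  have := le1 i; rewrite mnmBE mnmE; move/mnm_lepP: h => /(_ i); rewrite mnmE; lia.
have pm : pos_part m = m.
  apply/all_filterP/allP => x /tnthP [i ->]; rewrite -mnm_tnth.
  by have := hm i; lia.
have szs : size (mkpart m) = n by rewrite size_mkpart pm size_tuple.
apply: conj_near_rect_uniq; rewrite ?szs // ?sm ?sumE // ?d // => j jn.
have : nth 0%N (mkpart m) j \in parts (mkpart m) by apply: mem_nth; rewrite szs.
by rewrite (perm_mem (perm_mkpart m)) pm => /tnthP [i ->]; rewrite -mnm_tnth.
Qed.

(** By minimality the other monomial functions in P mu have more than n parts, and
    vanish in n variables. *)
Lemma jack_conj_near_rect a P : (0 < n)%N -> is_jack a P ->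
  P mu n = 'X_[cst_mnm n p] * mesym n rat l.
Proof.
move=> n0 Pj; apply/mpolyP => m; rewrite mcoeff_mulX_sub mcoeff_mesym sf_coefE.
have -> : sf_coef (P mu) (mkpart m) = (mkpart m == mu)%:R.
  case: eqP => [->|ne]; first exact: jack_coef_diag Pj _.
  apply: contrapT => /eqP /(jack_coef_supp Pj) h; apply: ne.
  by apply: conj_near_rect_min => //; exact: size_mkpart_mnm.
by rewrite mkpart_conj_near_rect; case: (_ <= _)%MM.
Qed.

End NearRect.

(** * Orthogonality of the hyperdeterminant to Jack functions *)

Lemma vdeg_le n (i : 'I_n) c d Z : (c <= d)%N -> vdeg i c Z -> vdeg i d Z.
Proof. by move=> le h m /h hm; apply: leq_trans le. Qed.

Lemma vdeg_mesym n (i : 'I_n) q : vdeg i (0 < q)%N (mesym n rat q).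
Proof.
move=> m; case: q => [|q]; first by rewrite mesym0E msupp1 inE => /eqP ->; rewrite mnm0E.
by rewrite mem_msupp_mesym => /andP [_ /forallP].
Qed.

Lemma vdeg_omega n k (i : 'I_n) q : (0 < k)%N -> vdeg i q (omega k%:R (elemsym q) n).
Proof.
move=> k0 m; rewrite mcoeff_msupp omega_elemsym_coef //.
have [<- _|_] := eqVneq (mdeg m) q; last by rewrite mul0r eqxx.
by rewrite mdegE (bigD1 i) //= leq_addr.
Qed.

Lemma size_pos_part n (m : 'X_{1..n}) : size (pos_part m) = (\sum_(i < n) (0 < m i))%N.
Proof.
rewrite size_filter -sum1_count big_mkcond big_tuple; apply: eq_bigr => i _.
by rewrite mnm_tnth; case: ifP.
Qed.

Lemma mul_monomial_size (X : symfun) s t :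
  sf_coef (X * monomialsym s) t != 0 -> (size s <= size t)%N.
Proof.
rewrite /sf_coef sf_atM -mcoeff_msupp => /msuppM_le /allpairsP [[m1 m2] /= [_ h2 e]].
have -> : size t = size (pos_part (mnm_seq (size t) t)) by rewrite pos_part_mnm_seq.
rewrite e; have : sf_coef (monomialsym s) (mkpart m2) != 0 by rewrite -sf_coefE -mcoeff_msupp.
rewrite sf_coef_monomial; have [<- _|_] := eqVneq (mkpart m2) s; last by rewrite eqxx.
rewrite size_mkpart !size_pos_part; apply: leq_sum => i _; rewrite mnmDE.
by case: (m2 i) => // x; rewrite addnS.
Qed.

Section Main.
Variables (n p k : nat) (n_gt0 : (0 < n)%N) (p_gt0 : (0 < p)%N) (k_gt0 : (0 < k)%N).
Variables (P : intpart -> symfun) (P_jack : is_jack k%:R P).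

Let Toep l := shifted_toeplitz k_gt0 (@near_const_vec n p l).
Let form f g := jack_scalar k%:R f g.

Let form_linr f c g h : form f (c *: g + h) = c * form f g + form f h.
Proof. exact: diag_form_linr. Qed.
Let form_linl f c g h : form (c *: g + h) f = c * form g f + form h f.
Proof. exact: diag_form_linl. Qed.
Let form0r f : form f 0 = 0. Proof. exact: diag_form0r. Qed.
Let form0l f : form 0 f = 0. Proof. exact: diag_form0l. Qed.

Lemma toep_formE l f : (l <= n)%N -> n`!%:R * form (Toep l) f
  = (selberg n k * (mesym n rat (n - l) * omega k%:R f n))@_(cst_mnm n (p.+1 + n.-1 * k)).
Proof. by move=> le; rewrite /form jack_omega_form omega_form_toeplitz_coef. Qed.

(** One factor of small degree is put into the polynomial h of selberg_orth,
    together with e_(n-l); the n - 1 others provide the poles. *)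
Lemma toep_orth_eprod l (nu : 'I_n -> nat) i : (l <= n)%N -> (nu i + (l < n) <= p)%N ->
  form (Toep l) (eprod nu) = 0.
Proof.
move=> le h; apply: (mulfI (factN0 n)); rewrite mulr0 toep_formE //.
rewrite /omega /eprod pscale_mul_prod sf_at_prod -/(omega k%:R).
case: (n) n_gt0 nu i le h => // n' _ nu i le h.
rewrite (bigD1_ord i) //= mulrA mulrA -[selberg _ _ * _ * _]mulrA.
apply: (@selberg_orth n'.+1 k p _ (fun a => nu (lift i a))) => // j.
apply: (@vdeg_le _ _ ((0 < n'.+1 - l) + nu i)); first by rewrite subn_gt0 addnC.
by apply: vdegM; [exact: vdeg_mesym|exact: vdeg_omega].
Qed.

(** The products of n elementary functions that express m_s all have a factor
    whose degree is at most the number of parts n of s. *)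
Lemma toep_orth_short_column l (s : intpart) : (l <= n)%N -> (head 0%N s <= n)%N ->
  (nth 0%N (conj_intpart s) n.-1 + (l < n) <= p)%N -> form (Toep l) (monomialsym s) = 0.
Proof.
move=> le hs h; apply: (@monomial_eseq_ind (fun f => form (Toep l) f = 0)) => //.
  by move=> c f g e1 e2; rewrite form_linr e1 e2 mulr0 addr0.
move=> t le_ts; rewrite (@eseq_eprod _ n); last first.
  by rewrite size_conj (leq_trans (dom_le_head le_ts)).
have ltn1 : (n.-1 < n)%N by rewrite prednK.
apply: (@toep_orth_eprod _ _ (Ordinal ltn1)) => //=; apply: leq_trans h.
by rewrite leq_add2r last_column_le.
Qed.

Lemma sum_toep_exp l (s : {ffun 'I_(k + k) -> 'S_n}) : (l <= n)%N ->
  \sum_(i < n) toep_exp p l k_gt0 s i = (n * p + l)%N%:Z.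
Proof.
move=> le; rewrite !big_split /= sumrN [X in X - _]exchange_big [X in _ - X]exchange_big /=.
have S (q : 'S_n) : \sum_(i < n) (q i : nat)%:Z = \sum_(i < n) i%:Z.
  by rewrite [RHS](reindex_inj (@perm_inj _ q)).
under eq_bigr => a _ do rewrite S.
under [X in _ - X]eq_bigr => a _ do rewrite S.
rewrite subrr add0r.
rewrite (_ : \sum_(i < n) _ = \sum_(i < n) near_const_vec p l i); last first.
  by rewrite [RHS](reindex_inj (@perm_inj _ (s (lshift k (Ordinal k_gt0))))).
under eq_bigr => i _.
  have -> : near_const_vec p l i = (p + (n - l <= i)%N)%N%:Z.
    by rewrite /near_const_vec; case: ltnP => _; rewrite ?addn0 ?addn1.
  over.
rewrite sum_Posz big_split /= sum_nat_const card_ord; congr (_ + _)%N%:Z.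
rewrite (reindex_inj rev_ord_inj) /=.
rewrite (eq_bigr (fun i : 'I_n => if (i < l)%N then 1 else 0))%N => [|i _]; last first.
  have -> : (n - l <= n - i.+1)%N = (i < l)%N by have := ltn_ord i; lia.
  by case: ifP.
by rewrite -big_mkcond -(big_ord_widen n (fun=> 1%N) le) sum1_card card_ord.
Qed.

(** A product of n elementary functions has degree at most n in each variable. *)
Lemma toep_supp l (s : intpart) : (l <= n)%N -> sf_coef (Toep l) s != 0 ->
  (head 0%N s <= n)%N /\ sumn s = (n * p + l)%N.
Proof.
move=> le h; apply: contrapT => hn; move: h.
rewrite /Toep toeplitzE sf_coefZ sf_coef_sum big1 ?mulr0 ?eqxx // => t _; rewrite sf_coefZ.
suff -> : sf_coef (\prod_(i < n) elemsymz (toep_exp p l k_gt0 t i)) s = 0 by rewrite mulr0.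
have st := sum_toep_exp t le; move: (toep_exp p l k_gt0 t) st => z st.
apply: contrapT => /eqP h; apply: hn.
case: (boolP [forall i, 0 <= z i]) => [/forallP hz|/forallPn [i hi]]; last first.
  move: h; rewrite (bigD1 i) //=; case: (z i) hi => // m _.
  by rewrite mul0r sf_coef0 eqxx.
have e : \prod_(i < n) elemsymz (z i) = eseq [seq `|z i|%N | i <- enum 'I_n].
  rewrite /eseq big_map big_enum; apply: eq_bigr => i _.
  by case: (z i) (hz i).
move: h; rewrite e => /eseq_supp [d /(_ 1%N)].
rewrite mdeg_mnm_seq // in d; move=> h1; split.
  case: (size s =P 0%N) => [/size0nil ->//|/eqP]; rewrite -lt0n => sz.
  have : (head 0%N s <= \sum_(j < size s | (j < 1)%N) mnm_seq (size s) s j)%N.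
    by rewrite (bigD1 (Ordinal sz)) //= mnmE nth0 leq_addr.
  move/leq_trans/(_ h1)/leq_trans; apply.
  rewrite big_map; apply: (@leq_trans (\sum_(i <- enum 'I_n) 1)%N).
    by apply: leq_sum => i _; exact: geq_minr.
  by rewrite big_enum sum1_card card_ord.
apply/eqP; rewrite d sumnE big_map big_enum /= -eqz_nat -st -sum_Posz; apply/eqP.
by apply: eq_bigr => i _; have := hz i; case: (z i).
Qed.

(** For mu with the weight of lam and parts at most n, expand P mu in monomial
    functions; lam does not occur, being maximal. The other P mu do not occur in
    the expansion of the hyperdeterminant on Jack functions. *)
Lemma toep_orth_jack l (l_gt0 : (0 < l)%N) (le : (l <= n)%N) (lam := near_rect p l_gt0 le) :
  (forall s : intpart, (head 0%N s <= n)%N -> sumn s = (n * p + l)%N -> s <> lam ->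
     form (Toep l) (monomialsym s) = 0) ->
  forall mu, mu <> lam -> form (Toep l) (P mu) = 0.
Proof.
move=> H mu ne.
have [[h1 h2]|bad] := pselect ((head 0%N mu <= n)%N /\ sumn mu = (n * p + l)%N).
  apply: (@monomial_ind (fun f => form (Toep l) f = 0)) => //.
    by move=> c f g e1 e2; rewrite form_linr e1 e2 mulr0 addr0.
  move=> s /(jack_coef_supp P_jack) le_s; apply: H.
  - exact: leq_trans (dom_le_head le_s) h1.
  - by rewrite -h2; case: le_s.
  move=> e; apply: ne; apply: dom_le_anti; first exact: near_rect_max.
  by rewrite -/lam -e.
apply: (@monomial_ind (fun f => form f (P mu) = 0)) => //.
  by move=> c f g e1 e2; rewrite form_linl e1 e2 mulr0 addr0.
move=> s /(toep_supp le) [h1 h2].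
apply: (@monomial_jack_ind _ _ P_jack (fun f => form f (P mu) = 0)) => //.
  by move=> c f g e1 e2; rewrite form_linl e1 e2 mulr0 addr0.
move=> t le_t; apply: (jack_orth P_jack) => e; apply: bad; rewrite -e; split.
  exact: leq_trans (dom_le_head le_t) h1.
by rewrite -h2; case: le_t.
Qed.

(** Here e_(n-l) = 1, so one more degree is left for the small factor: at most p
    parts equal to n is enough, and p + 1 of them already make the rectangle. *)
Lemma rect_toep_orth_jack (mu : intpart) : mu <> near_rect p n_gt0 (leqnn n) ->
  form (Toep n) (P mu) = 0.
Proof.
apply: toep_orth_jack => s hs es ne; apply: toep_orth_short_column => //.
rewrite ltnn addn0 leqNgt; apply/negP => hc; apply: ne.
apply: near_rect_uniq => //; first exact: ltnW.
rewrite leqNgt; apply/negP => sz; rewrite nth_conj in hc.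
have hn j : (j < p.+1)%N -> nth 0%N s j = n.
  move=> jp; have := count_gt_nth s n.-1 j; rewrite (leq_trans jp hc) prednK // => /esym h.
  by apply/eqP; rewrite eqn_leq h (leq_trans (nth_le_head _ _)).
have hp : partsum p.+1 s = (n * p.+1)%N.
  rewrite partsumE (eq_bigr (fun=> n)) ?sum_nat_const ?card_ord 1?mulnC //.
  by move=> j _; rewrite hn.
have := partsum_le_sumn p.+2 s; rewrite partsumS hp es mulnS.
have := intpart_pos (mem_nth 0%N sz).
by move: (nth 0%N s p.+1) (n * p)%N => x y; lia.
Qed.

(** The functional of the hyperdeterminant is that of the rectangle n^(p+1)
    composed with multiplication by e_(n-l), and multiplying m_s by a symmetric
    function cannot decrease the number of parts. *)
Lemma toep_orth_long l (s : intpart) : (l <= n)%N -> (p.+1 < size s)%N ->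
  form (Toep l) (monomialsym s) = 0.
Proof.
move=> le sz; apply: (mulfI (factN0 n)); rewrite mulr0 toep_formE //.
have k0 : k%:R != 0 :> rat by rewrite pnatr_eq0 -lt0n.
pose X := omega k%:R^-1 (elemsym (n - l)).
have oX : omega k%:R X = elemsym (n - l).
  by rewrite /X -{1}[k%:R]invrK omegaK // invr_eq0.
suff : n`!%:R * form (Toep n) (X * monomialsym s) = 0.
  by rewrite toep_formE // subnn mesym0E mul1r /omega pscale_mulM -!/(omega _) oX.
suff -> : form (Toep n) (X * monomialsym s) = 0 by rewrite mulr0.
have L c f g : form (Toep n) f = 0 -> form (Toep n) g = 0 -> form (Toep n) (c *: f + g) = 0.
  by move=> e1 e2; rewrite form_linr e1 e2 mulr0 addr0.
apply: (@monomial_ind (fun f => form (Toep n) f = 0)) => // t /mul_monomial_size le_st.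
apply: (@monomial_jack_ind _ _ P_jack (fun f => form (Toep n) f = 0)) => // u /dom_le_size le_tu.
apply: rect_toep_orth_jack => e; have := leq_trans sz (leq_trans le_st le_tu).
by rewrite e /= size_rcons size_nseq ltnn.
Qed.

Lemma near_rect_toep_orth_jack l (l_gt0 : (0 < l)%N) (le : (l <= n)%N) (mu : intpart) :
  mu <> near_rect p l_gt0 le -> form (Toep l) (P mu) = 0.
Proof.
apply: toep_orth_jack => s hs es ne.
have [sz|sz] := leqP (size s) p.+1; last exact: toep_orth_long.
apply: toep_orth_short_column => //.
have hc : (nth 0%N (conj_intpart s) n.-1 < p)%N.
  by rewrite ltnNge; apply/negP => hc; apply: ne; apply: near_rect_uniq.
by apply: leq_trans hc; rewrite -[leqRHS]addn1 leq_add2l leq_b1.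
Qed.

End Main.

Theorem proposition3p1 (n p l k : nat)
  (n_gt0 : (0 < n)%N) (p_gt0 : (0 < p)%N) (l_gt0 : (0 < l)%N) (k_gt0 : (0 < k)%N)
  (le_ln : (l <= n)%N)
  (P Q P' Q' : intpart -> symfun)
  (P_jack : is_jack k%:R%R P) (Q_dual : is_dual k%:R%R P Q)
  (P'_jack : is_jack (k%:R^-1)%R P') (Q'_dual : is_dual (k%:R^-1)%R P' Q') :
  jack_R n k P' Q' Q (near_rect p l_gt0 le_ln)
  = shifted_toeplitz k_gt0 (@near_const_vec n p l).
Proof.
have k0 : k%:R != 0 :> rat by rewrite pnatr_eq0 -lt0n.
set lam := near_rect p l_gt0 le_ln; set T := shifted_toeplitz _ _.
have rE : jack_scalar' n k (P' (conj_intpart lam)) (Q' (conj_intpart lam))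
    = jack_scalar k%:R T (P lam).
  rewrite jack_omega_form (jack_duality k0 P_jack P'_jack Q'_dual).
  apply: (jack_scalar'_toeplitz _ le_ln).
  exact: jack_conj_near_rect P'_jack.
apply/eqP; rewrite /jack_R rE -subr_eq0; apply/eqP; apply: (jack_nondeg P_jack k0) => t.
have -> : forall r, jack_scalar k%:R (r *: Q lam - T) (P t)
    = r * (t == lam)%:R - jack_scalar k%:R T (P t).
  move=> r; rewrite -Q_dual !jack_scalarE diag_form_linl -scaleN1r diag_formZl mulN1r.
  by rewrite [diag_form _ (Q lam) _]diag_formC.
have [->|ne] := eqVneq t lam; first by rewrite mulr1 subrr.
rewrite mulr0 add0r (@near_rect_toep_orth_jack n p k n_gt0 p_gt0 k_gt0 P) ?oppr0 //.
exact/eqP.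
Qed.
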